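(* Suppose $X$ is a $\mathrm{Rep}(C_2)$-chain complex built from finitely many cells. Then $X$ is quasi-isomorphic to a direct sum of complexes of the form $\Sigma^{k_i}H(r_i)$ with $0\leq r_i\leq k_i$ for all $i$.
   Context: A $\underline{\mathbb Z/2}$-module is a $C_2$-Mackey functor $M$ (abelian groups $M_\Theta,M_\bullet$, maps $t\colon M_\Theta\to M_\Theta$, $p^*\colon M_\bullet\to M_\Theta$, $p_*\colon M_\Theta\to M_\bullet$ with $tp^*=p^*$, $p_*t=p_*$, $t^2=1$, $p^*p_*=1+t$) with both groups $\mathbb F_2$-vector spaces and $p_*p^*=0$. $H$: both groups $\mathbb F_2$, $t=p^*=\mathrm{id}$, $p_*=0$. $F$: $F_\Theta=\mathbb F_2^2$, $t$ the swap, $F_\bullet=\mathbb F_2$, $p_*(x,y)=x+y$, $p^*(z)=(z,z)$. $p\colon F\to H$, $p\colon H\to F$ are the unique nonzero maps; $u=1+t\colon F\to F$. Homological grading, $(\Sigma C)_i=C_{i-1}$. $H(0)=H$ in degree $0$; for $q>0$, $H(q)$ is $F\xrightarrow{u}\cdots\xrightarrow{u}F\xrightarrow{p}H$ with $F$ in degrees $0,\dots,-(q-1)$ and $H$ in degree $-q$. Also for $r\ge0$, $B_r$ is $H\xrightarrow{p}F\xrightarrow{u}\cdots\xrightarrow{u}F\xrightarrow{p}H$ with $H$ in degree $0$, $F$ in degrees $-1,\dots,-(r+1)$, $H$ in degree $-(r+2)$; $A_k$ is $F$ in degrees $k,\dots,0$ with differentials $u$; and for $n>0$, $H(-n)$ is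 $H$ in degree $n$, $F$ in degrees $n-1,\dots,0$ with differentials $p,u,\dots,u$. Every perfect complex (bounded complex of finite sums of $H$, $F$, up to quasi-isomorphism) is quasi-isomorphic to a direct sum of shifts of $A_k$, $B_r$, $H(n)$, with the summands uniquely determined. A representation cell is a complex $\Sigma^mH(q)$ with $0\le q\le m$. A map in the derived category $\mathcal D(\underline{\mathbb Z/2})$ is spacelike if its cofiber (mapping cone) has no summand of the form $\Sigma^iB_r$ in such a decomposition. A $\mathrm{Rep}(C_2)$-chain complex is a chain complex $X$ with a filtration $X_0\subseteq X_1\subseteq\cdots\subseteq X$ where $X_0$ is $0$ or a direct sum of copies of $H$ (in degree $0$), and $X_m=\mathrm{Cof}(\bigoplus_i\Sigma^{m-1}H(q_i)\to X_{m-1})$ with $0\le q_i\le m$ for each $i$, where all attaching maps are spacelike; it is built from finitely many cells if finitely many representation cells are attached in total. *)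

(* Defs.v *)
(* Concrete model of bounded, degreewise finite
   chain complexes of Z/2-modules (C_2-Mackey functors over F_2 with
   p_* p^* = 0), encoded as totalised graded matrices over 'F_2.
   Row-vector convention: a linear map V -> W is a matrix A with
   x |-> x *m A, so the composite "f then g" is (f *m g). *)
From HB Require Import structures.
From mathcomp Require Import all_boot all_order all_algebra.
From Stdlib Require Import Relation_Operators.


Import GRing.Theory.
Local Open Scope ring_scope.

Notation F2 := 'F_2.

(* A graded object: a Theta-level space F2^nT and a bullet-level space
   F2^nB, each with a homogeneous basis whose degrees are gT / gB,
   with the Mackey structure maps t, p^*, p_* and differentials
   dT (Theta level) and dB (bullet level). *)
Record cpx := Cpx {
  nT : nat;
  nB : nat;
  gT : 'I_nT -> int;
  gB : 'I_nB -> int;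
  tT : 'M[F2]_nT;
  ps : 'M[F2]_(nB, nT);
  pl : 'M[F2]_(nT, nB);
  dT : 'M[F2]_nT;
  dB : 'M[F2]_nB
}.

Set Implicit Arguments.
Unset Strict Implicit.
Unset Printing Implicit Defensive.

Definition homog m n (g1 : 'I_m -> int) (g2 : 'I_n -> int) (k : int)
  (A : 'M[F2]_(m, n)) : Prop :=
  forall i j, A i j != 0 -> g2 j = g1 i + k.

Definition is_cpx (C : cpx) : Prop :=
  [/\
   [/\ tT C *m tT C = 1%:M,
      ps C *m tT C = ps C,
      tT C *m pl C = pl C,
      pl C *m ps C = 1%:M + tT C &
      ps C *m pl C = 0],
   [/\ homog (gT C) (gT C) 0 (tT C),
       homog (gB C) (gT C) 0 (ps C),
       homog (gT C) (gB C) 0 (pl C),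
       homog (gT C) (gT C) (-1) (dT C) &
       homog (gB C) (gB C) (-1) (dB C)] &
   [/\ dT C *m dT C = 0, dB C *m dB C = 0,
       tT C *m dT C = dT C *m tT C,
       ps C *m dT C = dB C *m ps C &
       pl C *m dB C = dT C *m pl C]].

Definition is_cmap (A X : cpx) (FT : 'M[F2]_(nT A, nT X))
    (FB : 'M[F2]_(nB A, nB X)) : Prop :=
  [/\ homog (gT A) (gT X) 0 FT /\ homog (gB A) (gB X) 0 FB,
      tT A *m FT = FT *m tT X,
      ps A *m FT = FB *m ps X,
      pl A *m FB = FT *m pl X &
      dT A *m FT = FT *m dT X /\ dB A *m FB = FB *m dB X].
Arguments is_cmap : clear implicits.

Definition homology_iso m n (dV : 'M[F2]_m) (dW : 'M[F2]_n)
    (F : 'M[F2]_(m, n)) : Prop :=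
  (forall x : 'rV[F2]_m, x *m dV = 0 -> (x *m F <= dW)%MS -> (x <= dV)%MS) /\
  (forall z : 'rV[F2]_n, z *m dW = 0 ->
     exists2 x : 'rV[F2]_m, x *m dV = 0 & (z - x *m F <= dW)%MS).

(* a chain map which is a quasi-isomorphism (homology of Mackey functors
   is computed levelwise; the map preserves degrees, so an isomorphism
   on total homology is the same as one in every degree) *)
Definition qmap (A X : cpx) : Prop :=
  is_cpx A /\ is_cpx X /\
  exists FT FB, is_cmap A X FT FB /\
    homology_iso (dT A) (dT X) FT /\ homology_iso (dB A) (dB X) FB.

(* quasi-isomorphic = isomorphic in the derived category
   = connected by a zigzag of quasi-isomorphisms *)
Definition qiso : cpx -> cpx -> Prop := clos_refl_sym_trans cpx qmap.

(* suspension Sigma^k: (Sigma^k C)_n = C_(n-k) (signs irrelevant in char 2) *)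
Definition shift (k : int) (C : cpx) : cpx :=
  @Cpx (nT C) (nB C) (fun i => gT C i + k) (fun i => gB C i + k)
       (tT C) (ps C) (pl C) (dT C) (dB C).

Definition zero_cpx : cpx :=
  @Cpx 0 0 (fun _ => 0) (fun _ => 0) 0 0 0 0 0.

Definition dsum (C D : cpx) : cpx :=
  @Cpx (nT C + nT D) (nB C + nB D)
    (fun i => match split i with inl a => gT C a | inr b => gT D b end)
    (fun i => match split i with inl a => gB C a | inr b => gB D b end)
    (block_mx (tT C) 0 0 (tT D)) (block_mx (ps C) 0 0 (ps D))
    (block_mx (pl C) 0 0 (pl D)) (block_mx (dT C) 0 0 (dT D))
    (block_mx (dB C) 0 0 (dB D)).

Definition bigsum (s : seq cpx) : cpx := foldr dsum zero_cpx s.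

Definition cone (A X : cpx) (FT : 'M[F2]_(nT A, nT X))
    (FB : 'M[F2]_(nB A, nB X)) : cpx :=
  @Cpx (nT A + nT X) (nB A + nB X)
    (fun i => match split i with inl a => gT A a + 1 | inr b => gT X b end)
    (fun i => match split i with inl a => gB A a + 1 | inr b => gB X b end)
    (block_mx (tT A) 0 0 (tT X)) (block_mx (ps A) 0 0 (ps X))
    (block_mx (pl A) 0 0 (pl X)) (block_mx (dT A) FT 0 (dT X))
    (block_mx (dB A) FB 0 (dB X)).

(* "Chains" of cells: for s = [:: c_0; ...; c_l] (true = F, false = H),
   chain top s has c_k in degree top - k, and each differential
   c_k -> c_(k+1) is:  u = 1+t : F -> F,  p : F -> H,  p : H -> F.
   Theta-level basis: one vector (k,false) per H-cell, two vectors
   (k,false),(k,true) (the two coordinates of F_Theta = F2^2) per F-cell;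
   bullet-level basis: one vector k per cell.
   H: t = p^* = id, p_* = 0.  F: t = swap, p^*(z) = (z,z), p_*(x,y) = x+y.
   p : F -> H is (x,y) |-> x+y on Theta and 0 on bullet;
   p : H -> F is z |-> (z,z) on Theta and id on bullet;
   u : F -> F is (x,y) |-> (x+y,x+y) on Theta and 0 on bullet. *)
Definition cdesc (s : seq bool) : seq (nat * bool) :=
  flatten [seq (if nth false s k then [:: (k, false); (k, true)]
                else [:: (k, false)]) | k <- iota 0 (size s)].

Definition chain (top : int) (s : seq bool) : cpx :=
  let D := cdesc s in
  let cell (i : nat) := (nth (0%N, false) D i).1 in
  let comp (i : nat) := (nth (0%N, false) D i).2 in
  let isF (k : nat) := nth false s k in
  @Cpx (size D) (size s)
    (fun i => top - (cell i)%:Z)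
    (fun k => top - (nat_of_ord k)%:Z)
    (\matrix_(i, j) ((cell i == cell j) &&
                      (if isF (cell i) then comp i != comp j else true))%:R)
    (\matrix_(k, j) (cell j == k)%:R)
    (\matrix_(i, k) ((cell i == k) && isF k)%:R)
    (\matrix_(i, j) ((cell j == (cell i).+1) && (isF (cell i) || isF (cell j)))%:R)
    (\matrix_(k, l) ((nat_of_ord l == k.+1) && ~~ isF k && isF l)%:R).

Definition Hq (q : nat) : cpx := chain 0 (rcons (nseq q true) false).

Definition Br (r : nat) : cpx := chain 0 (false :: rcons (nseq r.+1 true) false).

Definition Hcx : cpx := chain 0 [:: false].

Definition Hsum (a : nat) : cpx := bigsum (nseq a Hcx).

Definition cellsum (m : nat) (qs : seq nat) : cpx :=
  bigsum [seq shift m%:Z (Hq q) | q <- qs].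

Definition spacelike (A X : cpx) (FT : 'M[F2]_(nT A, nT X))
    (FB : 'M[F2]_(nB A, nB X)) : Prop :=
  ~ exists (i : int) (r : nat) (Y : cpx),
      is_cpx Y /\ qiso (cone FT FB) (dsum (shift i (Br r)) Y).

(* built m X : X is (a model of) the stage X_m of a Rep(C_2)-cell
   structure.  X_0 is a finite sum of copies of H in degree 0; X_(m+1) is
   the cofiber of a spacelike map  (+)_i Sigma^m H(q_i) -> X_m  with
   0 <= q_i <= m+1 (finitely many cells at each stage).  Since the cells
   are bounded complexes of projective Z/2-modules, every map in the
   derived category out of them is represented by a chain map, whose
   mapping cone is the cofiber. *)
Inductive built : nat -> cpx -> Prop :=
| built0 (a : nat) : built 0 (Hsum a)
| builtS (m : nat) (X : cpx) (qs : seq nat)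
    (FT : 'M[F2]_(nT (cellsum m qs), nT X))
    (FB : 'M[F2]_(nB (cellsum m qs), nB X)) :
    built m X ->
    all (fun q => q <= m.+1)%N qs ->
    is_cmap (cellsum m qs) X FT FB ->
    spacelike FT FB ->
    built m.+1 (cone FT FB).

(* Main.v *)
(* Every stage of a cell structure maps by a quasi-isomorphism to a direct sum of
   representation cells, i.e. of strands F -> ... -> F -> H (top degree k, bottom
   degree f = k - r). So let a sum of cells Sigma^m H(q) be attached to a sum S of
   strands with tops at most m, and look at the bullet-level images z in S of the
   bottom H-generators of the cells.

   Suppose some z is nonzero; choose such a cell with q maximal, and among the
   strands met by z one with maximal bottom degree f. If f is the degree of z, the
   cell maps isomorphically onto that strand and both cancel. If f is smaller, the
   cone retracts onto a shift of some B_r, contradicting spacelikeness.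

   Once all z vanish, the cells can be attached one at a time. After a change of
   generators the differential of a new cell hits only bottom H-generators of
   strands, and then the new cell and the strands it hits exchange their bottoms
   (the Kronholm shift), so that the result is again a sum of strands. *)
Require Import Defs.
From HB Require Import structures.
From mathcomp Require Import all_boot all_order all_algebra.
From Stdlib Require Import Relation_Operators.
From mathcomp Require Import zify.

Set Implicit Arguments.
Unset Strict Implicit.
Unset Printing Implicit Defensive.

Import GRing.Theory.
Local Open Scope ring_scope.

(** * Graded matrices and isomorphisms *)

(** Spacelikeness speaks only about the cone of all cells of a stage together, so a forbidden [B_r]
    has to be split off that whole cone, by an inclusion and a projection that compose to the
    identity. Maximality of [f] serves the inclusion: the components of [z] on the other strands
    must extend downwards as far as the chosen strand does. Maximality of [q] serves the projection:
    any other cell with nonzero image has its bottom at or above the top of the [B_r], and this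
    makes its attaching map null-homotopic after projection. If [f] is the degree of [z], the
    differential forces the strand to reach as high as the cell, and the bound [m] on tops leaves
    only equality. Maps and homotopies are given and compared on generators only: a map out of F is
    a Theta-level element, a map out of H a bullet-level element, where [p_* p^* = 0] enters. In the
    last step no inverse is written down. The new strands generate the cone, and their number and
    total length give the same dimensions as the cone, so the map from the sum of strands is
    invertible. *)

Lemma F2P (c : F2) : c = 0 \/ c = 1.
Proof. by case: c => [[|[|n]] H] //; [left|right]; apply/val_inj. Qed.

Lemma addmm m n (A : 'M[F2]_(m, n)) : A + A = 0.
Proof.
apply/matrixP => i j; rewrite !mxE.
by case: (F2P (A i j)) => ->; apply/val_inj.
Qed.

Lemma oppmm m n (A : 'M[F2]_(m, n)) : - A = A.
Proof. by apply/eqP; rewrite eq_sym -addr_eq0 addmm. Qed.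

Lemma addmmK m n (A B : 'M[F2]_(m, n)) : A + B + B = A.
Proof. by rewrite -addrA addmm addr0. Qed.

Lemma addmKm m n (A B : 'M[F2]_(m, n)) : B + (B + A) = A.
Proof. by rewrite addrA addmm add0r. Qed.

Lemma addmm_eq m n (A B : 'M[F2]_(m, n)) : A + B = 0 -> A = B.
Proof. by move/eqP; rewrite addr_eq0 oppmm => /eqP. Qed.

Definition hd n (g : 'I_n -> int) (z : int) (x : 'rV[F2]_n) : Prop :=
  forall j, x 0 j != 0 -> g j = z.

(** A name for the degree function inside [dsum]; [cone] has it with the first argument raised by 1.
    It is convertible with both, so lemmas about it apply there directly. *)
Definition djoin m n (g1 : 'I_m -> int) (g2 : 'I_n -> int) (i : 'I_(m + n)) :=
  match split i with inl a => g1 a | inr b => g2 b end.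

Lemma djoinl m n (g1 : 'I_m -> int) (g2 : 'I_n -> int) i :
  djoin g1 g2 (lshift n i) = g1 i.
Proof. by rewrite /djoin (unsplitK (inl i)). Qed.

Lemma djoinr m n (g1 : 'I_m -> int) (g2 : 'I_n -> int) i :
  djoin g1 g2 (rshift m i) = g2 i.
Proof. by rewrite /djoin (unsplitK (inr i)). Qed.

Lemma hd0 n (g : 'I_n -> int) z : hd g z 0.
Proof. by move=> j; rewrite mxE eqxx. Qed.

Lemma hdD n (g : 'I_n -> int) z x y : hd g z x -> hd g z y -> hd g z (x + y).
Proof.
move=> hx hy j; rewrite mxE; case: (eqVneq (x 0 j) 0) => [->|/hx //].
by rewrite add0r => /hy.
Qed.

Lemma hdZ n (g : 'I_n -> int) z c x : hd g z x -> hd g z (c *: x).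
Proof. by move=> hx j; rewrite mxE mulf_eq0 negb_or => /andP[_ /hx]. Qed.

Lemma mul_neq0 m n p (A : 'M[F2]_(m, n)) (B : 'M[F2]_(n, p)) i j :
  (A *m B) i j != 0 -> exists2 k, A i k != 0 & B k j != 0.
Proof.
rewrite mxE => h.
have [/existsP[k /andP[h1 h2]]|/existsPn h'] :=
  boolP [exists k, (A i k != 0) && (B k j != 0)]; first by exists k.
case/negP: h; apply/eqP/big1 => k _; move: (h' k).
by rewrite negb_and !negbK => /orP[] /eqP ->; rewrite ?mul0r ?mulr0.
Qed.

Lemma hd_mul m n (g1 : 'I_m -> int) (g2 : 'I_n -> int) k A z x :
  homog g1 g2 k A -> hd g1 z x -> hd g2 (z + k) (x *m A).
Proof. by move=> hA hx j /mul_neq0[i /hx <- /hA]. Qed.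

Lemma homogP m n (g1 : 'I_m -> int) (g2 : 'I_n -> int) k A :
  homog g1 g2 k A <-> forall i, hd g2 (g1 i + k) (row i A).
Proof.
split=> [h i j|h i j]; first by rewrite mxE => /h.
by move=> h'; apply: (h i j); rewrite mxE.
Qed.

Lemma homog0 m n (g1 : 'I_m -> int) (g2 : 'I_n -> int) k : homog g1 g2 k 0.
Proof. by move=> i j; rewrite mxE eqxx. Qed.

Lemma homog1 n (g : 'I_n -> int) : homog g g 0 1%:M.
Proof.
move=> i j; rewrite mxE; case: (eqVneq i j) => [->|_]; first by rewrite addr0.
by rewrite eqxx.
Qed.

Lemma homog_mul m n p (g1 : 'I_m -> int) (g2 : 'I_n -> int) (g3 : 'I_p -> int)
    k l r A B :
  homog g1 g2 k A -> homog g2 g3 l B -> k + l = r -> homog g1 g3 r (A *m B).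
Proof. by move=> hA hB <- i j /mul_neq0[s /hA hq0 /hB ->]; rewrite hq0 addrA. Qed.

Lemma homog_row m n p (g : 'I_m -> int) (g1 : 'I_n -> int) (g2 : 'I_p -> int)
    k A B :
  homog g g1 k A -> homog g g2 k B -> homog g (djoin g1 g2) k (row_mx A B).
Proof.
move=> hA hB i j; case: (splitP j) => l jl.
  have -> : j = lshift p l by apply/val_inj.
  by rewrite row_mxEl djoinl => /hA.
have -> : j = rshift n l by apply/val_inj.
by rewrite row_mxEr djoinr => /hB.
Qed.

Lemma homog_col m n p (g : 'I_m -> int) (g1 : 'I_n -> int) (g2 : 'I_p -> int)
    k A B :
  homog g1 g k A -> homog g2 g k B -> homog (djoin g1 g2) g k (col_mx A B).
Proof.
move=> hA hB i j; case: (splitP i) => l il.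
  have -> : i = lshift p l by apply/val_inj.
  by rewrite col_mxEu djoinl => /hA.
have -> : i = rshift n l by apply/val_inj.
by rewrite col_mxEd djoinr => /hB.
Qed.

Lemma homog_usub m n p (g : 'I_m -> int) (g1 : 'I_n -> int) (g2 : 'I_p -> int)
    k A :
  homog (djoin g1 g2) g k A -> homog g1 g k (usubmx A).
Proof. by move=> h i j; rewrite mxE => /h; rewrite djoinl. Qed.

Lemma homog_dsub m n p (g : 'I_m -> int) (g1 : 'I_n -> int) (g2 : 'I_p -> int)
    k A :
  homog (djoin g1 g2) g k A -> homog g2 g k (dsubmx A).
Proof. by move=> h i j; rewrite mxE => /h; rewrite djoinr. Qed.

Lemma homog_block m n p q (g1 : 'I_m -> int) (g2 : 'I_n -> int)
    (g3 : 'I_p -> int) (g4 : 'I_q -> int) k A B C D :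
  homog g1 g3 k A -> homog g1 g4 k B -> homog g2 g3 k C -> homog g2 g4 k D ->
  homog (djoin g1 g2) (djoin g3 g4) k (block_mx A B C D).
Proof.
by move=> *; rewrite /block_mx; apply: homog_col; apply: homog_row.
Qed.

Lemma hd_row n p (g1 : 'I_n -> int) (g2 : 'I_p -> int) z x y :
  hd g1 z x -> hd g2 z y -> hd (djoin g1 g2) z (row_mx x y).
Proof.
move=> hA hB j; case: (splitP j) => l jl.
  have -> : j = lshift p l by apply/val_inj.
  by rewrite row_mxEl djoinl => /hA.
have -> : j = rshift n l by apply/val_inj.
by rewrite row_mxEr djoinr => /hB.
Qed.

Lemma hd_rowl n p (g1 : 'I_n -> int) (g2 : 'I_p -> int) z x :
  hd (djoin g1 g2) z x -> hd g1 z (lsubmx x).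
Proof. by move=> h j; rewrite mxE => /h; rewrite djoinl. Qed.

Lemma hd_rowr n p (g1 : 'I_n -> int) (g2 : 'I_p -> int) z x :
  hd (djoin g1 g2) z x -> hd g2 z (rsubmx x).
Proof. by move=> h j; rewrite mxE => /h; rewrite djoinr. Qed.

(** Naturality alone, without degrees or differentials: this covers differentials and
    null-homotopies as well as chain maps, and it is what allows an equation to be checked on
    generators. *)
Definition mack (A X : cpx) (FT : 'M[F2]_(nT A, nT X))
    (FB : 'M[F2]_(nB A, nB X)) : Prop :=
  [/\ tT A *m FT = FT *m tT X, ps A *m FT = FB *m ps X &
      pl A *m FB = FT *m pl X].

Lemma mackD A X FT FB GT GB :
  @mack A X FT FB -> @mack A X GT GB -> mack (FT + GT) (FB + GB).
Proof.
by case=> a1 a2 a3 [b1 b2 b3]; split;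
  rewrite !mulmxDl !mulmxDr ?a1 ?a2 ?a3 ?b1 ?b2 ?b3.
Qed.

Lemma mackM A X Z FT FB GT GB :
  @mack A X FT FB -> @mack X Z GT GB -> @mack A Z (FT *m GT) (FB *m GB).
Proof.
case=> a1 a2 a3 [b1 b2 b3]; split.
- by rewrite mulmxA a1 -!mulmxA b1.
- by rewrite mulmxA a2 -!mulmxA b2.
- by rewrite mulmxA a3 -!mulmxA b3.
Qed.

Lemma mack_d X : is_cpx X -> @mack X X (dT X) (dB X).
Proof. by case=> _ _ [_ _ h1 h2 h3]; split. Qed.

Lemma cmap_mack A X FT FB : is_cmap A X FT FB -> mack FT FB.
Proof. by case. Qed.

Lemma cmap1 X : is_cmap X X 1%:M 1%:M.
Proof. by split; [split; exact: homog1|..]; rewrite ?mulmx1 ?mul1mx. Qed.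

Lemma cmap_comp A X Z FT FB GT GB :
  is_cmap A X FT FB -> is_cmap X Z GT GB ->
  is_cmap A Z (FT *m GT) (FB *m GB).
Proof.
move=> F G; have [M1 M2 M3] := mackM (cmap_mack F) (cmap_mack G).
case: F => [[h1 h2] _ _ _ [d1 d2]]; case: G => [[h3 h4] _ _ _ [d3 d4]].
split=> //; first by split; apply: homog_mul; eauto; rewrite addr0.
by split; rewrite mulmxA ?d1 ?d2 -!mulmxA ?d3 ?d4.
Qed.

Definition ciso (X Z : cpx) : Prop :=
  exists FT FB GT GB, [/\ is_cmap X Z FT FB, is_cmap Z X GT GB,
    FT *m GT = 1%:M /\ FB *m GB = 1%:M & GT *m FT = 1%:M /\ GB *m FB = 1%:M].

Lemma ciso_refl X : ciso X X.
Proof.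
exists 1%:M, 1%:M, 1%:M, 1%:M.
by split; [exact: cmap1|exact: cmap1|rewrite !mulmx1|rewrite !mulmx1].
Qed.

Lemma ciso_sym X Z : ciso X Z -> ciso Z X.
Proof. by case=> FT [FB [GT [GB [? ? ? ?]]]]; exists GT, GB, FT, FB. Qed.

Lemma mulmx_cancel m n p (A : 'M[F2]_(m, n)) (B : 'M[F2]_(n, p)) C D :
  A *m D = 1%:M -> B *m C = 1%:M -> A *m B *m (C *m D) = 1%:M.
Proof. by move=> h1 h2; rewrite mulmxA -(mulmxA A) h2 mulmx1. Qed.

Lemma ciso_trans X Y Z : ciso X Y -> ciso Y Z -> ciso X Z.
Proof.
case=> FT [FB [GT [GB [f g [e1 e2] [e3 e4]]]]].
case=> FT' [FB' [GT' [GB' [f' g' [e1' e2'] [e3' e4']]]]].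
exists (FT *m FT'), (FB *m FB'), (GT' *m GT), (GB' *m GB).
by split; [exact: cmap_comp f f'|exact: cmap_comp g' g|..];
  split; apply: mulmx_cancel.
Qed.

Lemma cpx_dsum C D : is_cpx C -> is_cpx D -> is_cpx (dsum C D).
Proof.
case=> [[a1 a2 a3 a4 a5] [b1 b2 b3 b4 b5] [c1 c2 c3 c4 c5]].
case=> [[a1' a2' a3' a4' a5'] [b1' b2' b3' b4' b5'] [c1' c2' c3' c4' c5']].
split; split=> /=; rewrite ?mulmx_block ?mulmx0 ?mul0mx ?addr0 ?add0r;
  rewrite ?(a1, a2, a3, a4, a5, a1', a2', a3', a4', a5', c1, c2, c3, c4, c5,
    c1', c2', c3', c4', c5') -?scalar_mx_block //;
  try by apply: homog_block => //; apply: homog0.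
- by apply: (etrans _ (congr1 (+%R^~ _) (esym (scalar_mx_block _ _ _))));
    rewrite add_block_mx !addr0.
- exact: block_mx0.
- exact: block_mx0.
- exact: block_mx0.
Qed.

Lemma cpx_zero : is_cpx zero_cpx.
Proof. by split; split=> /=; try (by move=> []); apply/matrixP => [[]]. Qed.

Lemma cpx_bigsum s : foldr (fun C P => is_cpx C /\ P) True s -> is_cpx (bigsum s).
Proof.
elim: s => [_|C s IH /= [hC /IH]]; [exact: cpx_zero|exact: cpx_dsum].
Qed.

Lemma cpx_shift k C : is_cpx C -> is_cpx (shift k C).
Proof.
case=> [A [b1 b2 b3 b4 b5] D]; split=> //.
by split=> i j /=; [move=> /b1|move=> /b2|move=> /b3|move=> /b4|move=> /b5];
  move=> ->; rewrite addrAC.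
Qed.

Lemma homog_s m n (g1 : 'I_m -> int) (g2 : 'I_n -> int) k l l' A :
  l = l' + k -> homog g1 g2 l A -> homog (fun i => g1 i + k) g2 l' A.
Proof. by move=> -> h i j /h ->; rewrite addrAC addrA. Qed.

Lemma homog_st m n (g1 : 'I_m -> int) (g2 : 'I_n -> int) k l A :
  homog g1 g2 l A -> homog (fun i => g1 i + k) (fun i => g2 i + k) l A.
Proof. by move=> h i j /h ->; rewrite addrAC. Qed.

Lemma cpx_cone A X FT FB :
  is_cpx A -> is_cpx X -> is_cmap A X FT FB -> is_cpx (cone FT FB).
Proof.
case=> [[a1 a2 a3 a4 a5] [b1 b2 b3 b4 b5] [c1 c2 c3 c4 c5]].
case=> [[a1' a2' a3' a4' a5'] [b1' b2' b3' b4' b5'] [c1' c2' c3' c4' c5']].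
case=> [[h1 h2] h3 h4 h5 [h6 h7]].
split; split=> /=; rewrite ?mulmx_block ?mulmx0 ?mul0mx ?addr0 ?add0r;
  rewrite ?(a1, a2, a3, a4, a5, a1', a2', a3', a4', a5', c1, c2, c3, c4, c5,
    c1', c2', c3', c4', c5', h3, h4, h5, h6, h7, addmm) -?scalar_mx_block //;
  try by (apply: homog_block => //; try exact: homog0; try (by apply: homog_st);
          by apply: homog_s; last eassumption).
- by apply: (etrans _ (congr1 (+%R^~ _) (esym (scalar_mx_block _ _ _))));
    rewrite add_block_mx !addr0.
- exact: block_mx0.
- exact: block_mx0.
- exact: block_mx0.
Qed.

(** * Quasi-isomorphisms and cones *)

Lemma hiso_inv m n (dV : 'M[F2]_m) (dW : 'M[F2]_n) F G :
  dV *m F = F *m dW -> dW *m G = G *m dV -> F *m G = 1%:M -> G *m F = 1%:M ->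
  homology_iso dV dW F.
Proof.
move=> cF cG FG GF; split=> [x _ /submxP[D xF]|z zW].
  by apply/submxP; exists (D *m G);
    rewrite -[x]mulmx1 -FG mulmxA xF -!mulmxA cG.
exists (z *m G); first by rewrite -mulmxA -cG mulmxA zW mul0mx.
by rewrite -mulmxA GF mulmx1 subrr sub0mx.
Qed.

Lemma hiso_trans m n p (dU : 'M[F2]_m) (dV : 'M[F2]_n) (dW : 'M[F2]_p) F G :
  dU *m F = F *m dV -> dV *m G = G *m dW ->
  homology_iso dU dV F -> homology_iso dV dW G ->
  homology_iso dU dW (F *m G).
Proof.
move=> cF cG [iF sF] [iG sG]; split=> [x xU xFG|z zW].
  apply: iF => //; apply: iG; last by rewrite -mulmxA.
  by rewrite -mulmxA -cF mulmxA xU mul0mx.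
have [y yV zy] := sG z zW; have [x xU /submxP[D yx]] := sF y yV.
exists x => //; apply/submxP; case/submxP: zy => D' zy.
have e : D *m G *m dW = (y - x *m F) *m G by rewrite -mulmxA -cG mulmxA -yx.
by exists (D' + D *m G); rewrite mulmxDl e -zy mulmxBl mulmxA addrA subrK.
Qed.

Lemma ciso_qmap X Z : is_cpx X -> is_cpx Z -> ciso X Z -> qmap X Z.
Proof.
move=> hX hZ [FT [FB [GT [GB [f g [e1 e2] [e3 e4]]]]]].
split=> //; split=> //; exists FT, FB; split=> //.
case: f => _ _ _ _ [f1 f2]; case: g => _ _ _ _ [g1 g2].
by split; [apply: (hiso_inv f1 g1)|apply: (hiso_inv f2 g2)].
Qed.

Lemma qmap_trans X Y Z : qmap X Y -> qmap Y Z -> qmap X Z.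
Proof.
case=> hX [hY [FT [FB [f [f1 f2]]]]] [_ [hZ [GT [GB [g [g1 g2]]]]]].
split=> //; split=> //; exists (FT *m GT), (FB *m GB).
split; first exact: cmap_comp f g.
case: f => _ _ _ _ [cf1 cf2]; case: g => _ _ _ _ [cg1 cg2].
by split; [apply: (hiso_trans cf1 cg1)|apply: (hiso_trans cf2 cg2)].
Qed.

Lemma row_mx_inj m n1 n2 (a a' : 'M[F2]_(m, n1)) (b b' : 'M[F2]_(m, n2)) :
  row_mx a b = row_mx a' b' -> a = a' /\ b = b'.
Proof. exact: eq_row_mx. Qed.

(** The part of the five lemma that is needed, by a direct chase. The source component is carried
    along unchanged and only the target component is corrected. *)
Lemma hiso_cone_target a n p (dA : 'M[F2]_a) (dX : 'M[F2]_n) (dZ : 'M[F2]_p)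
    F R :
  dA *m F = F *m dX -> dX *m dX = 0 -> dX *m R = R *m dZ ->
  homology_iso dX dZ R ->
  homology_iso (block_mx dA F 0 dX) (block_mx dA (F *m R) 0 dZ)
    (block_mx 1%:M 0 0 R).
Proof.
move=> cF dd cR [iR sR]; split=> [v|v].
- rewrite -[v]hsubmxK; move: (lsubmx v) (rsubmx v) => x y.
  rewrite !mul_row_block !mulmx0 !addr0 !add0r mulmx1 -row_mx0.
  case/row_mx_inj => xA /addmm_eq yX /submxP[D].
  rewrite -[D]hsubmxK; move: (lsubmx D) (rsubmx D) => x' y'.
  rewrite mul_row_block !mulmx0 !addr0 => /row_mx_inj[ex ey].
  have uX : (y + x' *m F) *m dX = 0.
    by rewrite mulmxDl -yX ex -!mulmxA cF addmm.
  have : ((y + x' *m F)%R <= dX)%MS.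
    apply: iR => //; apply/submxP; exists y'.
    by rewrite mulmxDl ey -mulmxA addrC addmKm.
  case/submxP=> y2 e2; apply/submxP; exists (row_mx x' y2).
  by rewrite mul_row_block mulmx0 addr0 -ex -e2 addrC addmmK.
- rewrite -[v]hsubmxK; move: (lsubmx v) (rsubmx v) => x z.
  rewrite mul_row_block mulmx0 addr0 -row_mx0.
  case/row_mx_inj => xA /addmm_eq zZ.
  have : (x *m F <= dX)%MS.
    apply: iR; first by rewrite -mulmxA -cF mulmxA xA mul0mx.
    by apply/submxP; exists z; rewrite -zZ mulmxA.
  case/submxP=> y1 e1.
  have /sR[y2 y2X /submxP[w e3]] : (z + y1 *m R) *m dZ = 0.
    by rewrite mulmxDl -zZ mulmxA e1 -!mulmxA cR addmm.
  exists (row_mx x (y1 + y2)).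
    by rewrite mul_row_block !mulmx0 addr0 xA mulmxDl y2X addr0 e1 addmm row_mx0.
  apply/submxP; exists (row_mx 0 w).
  rewrite !mul_row_block !mulmx0 !mul0mx !addr0 !add0r mulmx1 -e3.
  by rewrite opp_row_mx add_row_mx subrr !oppmm mulmxDl addrA.
Qed.

(** * Chain maps into and out of sums and cones *)

Lemma cmap_sub A B X FT FB :
  is_cmap (dsum A B) X FT FB ->
  is_cmap A X (usubmx FT) (usubmx FB) /\ is_cmap B X (dsubmx FT) (dsubmx FB).
Proof.
case=> [[h1 h2] h3 h4 h5 [h6 h7]].
have g1 := homog_usub h1; have g2 := homog_dsub h1.
have g3 := homog_usub h2; have g4 := homog_dsub h2.
move: FT FB h3 h4 h5 h6 h7 g1 g2 g3 g4 {h1 h2} => /= FT FB.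
rewrite -[FT]vsubmxK -[FB]vsubmxK !col_mxKu !col_mxKd.
rewrite !mul_block_col !mul_col_mx !mul0mx !addr0 !add0r.
by move=> /eq_col_mx[? ?] /eq_col_mx[? ?] /eq_col_mx[? ?] /eq_col_mx[? ?]
  /eq_col_mx[? ?].
Qed.

Lemma cmap_col A B X FT FB GT GB :
  is_cmap A X FT FB -> is_cmap B X GT GB ->
  is_cmap (dsum A B) X (col_mx FT GT) (col_mx FB GB).
Proof.
case=> [[h1 h2] h3 h4 h5 [h6 h7]] [[g1 g2] g3 g4 g5 [g6 g7]].
split; first by split; apply: homog_col.
all: try split.
all: by rewrite /= mul_block_col mul_col_mx !mul0mx addr0 add0r ?h3 ?h4 ?h5
  ?h6 ?h7 ?g3 ?g4 ?g5 ?g6 ?g7.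
Qed.

Lemma cmap_row A X Z FT FB GT GB :
  is_cmap A X FT FB -> is_cmap A Z GT GB ->
  is_cmap A (dsum X Z) (row_mx FT GT) (row_mx FB GB).
Proof.
case=> [[h1 h2] h3 h4 h5 [h6 h7]] [[g1 g2] g3 g4 g5 [g6 g7]].
split; first by split; apply: homog_row.
all: try split.
all: by rewrite /= mul_row_block mul_mx_row !mulmx0 addr0 add0r ?h3 ?h4 ?h5
  ?h6 ?h7 ?g3 ?g4 ?g5 ?g6 ?g7.
Qed.

Lemma cmap0 A X : is_cmap A X 0 0.
Proof.
by split; [split; exact: homog0|..]; rewrite ?mulmx0 ?mul0mx.
Qed.

Definition injl X Z : is_cmap X (dsum X Z) (row_mx 1%:M 0) (row_mx 1%:M 0) :=
  cmap_row (cmap1 X) (cmap0 X Z).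
Definition injr X Z : is_cmap Z (dsum X Z) (row_mx 0 1%:M) (row_mx 0 1%:M) :=
  cmap_row (cmap0 Z X) (cmap1 Z).
Definition projl X Z : is_cmap (dsum X Z) X (col_mx 1%:M 0) (col_mx 1%:M 0) :=
  cmap_col (cmap1 X) (cmap0 Z X).
Definition projr X Z : is_cmap (dsum X Z) Z (col_mx 0 1%:M) (col_mx 0 1%:M) :=
  cmap_col (cmap0 X Z) (cmap1 Z).

(* [HT], [HB] form a null-homotopy of the composite with the attaching map. *)
Lemma cmap_cone A X Z FT FB HT HB RT RB :
  is_cmap X Z RT RB -> mack HT HB ->
  homog (gT A) (gT Z) 1 HT -> homog (gB A) (gB Z) 1 HB ->
  dT A *m HT + FT *m RT = HT *m dT Z -> dB A *m HB + FB *m RB = HB *m dB Z ->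
  is_cmap (@cone A X FT FB) Z (col_mx HT RT) (col_mx HB RB).
Proof.
case=> [[h1 h2] h3 h4 h5 [h6 h7]] [m1 m2 m3] g1 g2 d1 d2.
split; first by split; apply: homog_col => //; move=> i j;
  [move/g1 -> | move/g2 ->]; rewrite addr0.
all: try split.
all: rewrite /= mul_block_col mul_col_mx ?mul0mx ?addr0 ?add0r ?h3 ?h4 ?h5
  ?h6 ?h7 ?m1 ?m2 ?m3 ?d1 ?d2 //.
Qed.

Lemma cmap_cone_target A A' X Z FT FB PT PB RT RB GT GB :
  is_cmap A A' PT PB -> is_cmap X Z RT RB ->
  FT *m RT = PT *m GT -> FB *m RB = PB *m GB ->
  is_cmap (@cone A X FT FB) (@cone A' Z GT GB) (block_mx PT 0 0 RT)
    (block_mx PB 0 0 RB).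
Proof.
case=> [[g1 g2] g3 g4 g5 [g6 g7]] [[h1 h2] h3 h4 h5 [h6 h7]] e1 e2.
split; first by split; apply: homog_block => //; try exact: homog0;
  exact: homog_st.
all: try split.
all: rewrite /= !mulmx_block !mul0mx !mulmx0 !addr0 !add0r ?h3 ?h4 ?h5
  ?h6 ?h7 ?g3 ?g4 ?g5 ?g6 ?g7 ?e1 ?e2 //.
Qed.

Lemma qmap_cone A X Z FT FB RT RB :
  is_cpx A -> is_cmap A X FT FB -> is_cpx X -> is_cpx Z -> is_cmap X Z RT RB ->
  homology_iso (dT X) (dT Z) RT -> homology_iso (dB X) (dB Z) RB ->
  qmap (cone FT FB) (@cone A Z (FT *m RT) (FB *m RB)).
Proof.
move=> hA f hX hZ r h1 h2; split; first exact: cpx_cone.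
split; first by apply: cpx_cone => //; apply: cmap_comp f r.
exists (block_mx 1%:M 0 0 RT), (block_mx 1%:M 0 0 RB); split.
  by apply: cmap_cone_target => //; rewrite ?mul1mx //; apply: cmap1.
case: f => _ _ _ _ [f1 f2]; case: r => _ _ _ _ [r1 r2].
case: hX => _ _ [d1 d2 _ _ _].
by split; apply: hiso_cone_target.
Qed.

Lemma ciso_cone_source A A' X FT FB PT PB QT QB :
  is_cmap A A' PT PB -> is_cmap A' A QT QB ->
  PT *m QT = 1%:M -> PB *m QB = 1%:M -> QT *m PT = 1%:M -> QB *m PB = 1%:M ->
  ciso (@cone A' X FT FB) (@cone A X (PT *m FT) (PB *m FB)).
Proof.
move=> p q e1 e2 e3 e4.
exists (block_mx QT 0 0 1%:M), (block_mx QB 0 0 1%:M),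
  (block_mx PT 0 0 1%:M), (block_mx PB 0 0 1%:M); split.
- by apply: cmap_cone_target => //; rewrite ?mulmx1 ?mulmxA ?e3 ?e4 ?mul1mx //;
    apply: cmap1.
- by apply: cmap_cone_target => //; rewrite ?mulmx1 //; apply: cmap1.
- by rewrite !mulmx_block !mulmx0 !mul0mx !mulmx1 !addr0 !add0r e3 e4
    -!scalar_mx_block.
- by rewrite !mulmx_block !mulmx0 !mul0mx !mulmx1 !addr0 !add0r e1 e2
    -!scalar_mx_block.
Qed.

Lemma ciso_cone_target A X Z FT FB PT PB QT QB :
  is_cmap X Z PT PB -> is_cmap Z X QT QB ->
  PT *m QT = 1%:M -> PB *m QB = 1%:M -> QT *m PT = 1%:M -> QB *m PB = 1%:M ->
  ciso (@cone A X FT FB) (@cone A Z (FT *m PT) (FB *m PB)).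
Proof.
move=> p q e1 e2 e3 e4.
exists (block_mx 1%:M 0 0 PT), (block_mx 1%:M 0 0 PB),
  (block_mx 1%:M 0 0 QT), (block_mx 1%:M 0 0 QB); split.
- by apply: cmap_cone_target => //; rewrite ?mul1mx //; apply: cmap1.
- by apply: cmap_cone_target => //; rewrite ?mul1mx -?mulmxA ?e1 ?e2 ?mulmx1 //;
    apply: cmap1.
- by rewrite !mulmx_block !mulmx0 !mul0mx !mulmx1 !addr0 !add0r e1 e2
    -!scalar_mx_block.
- by rewrite !mulmx_block !mulmx0 !mul0mx !mulmx1 !addr0 !add0r e3 e4
    -!scalar_mx_block.
Qed.

Lemma homog_eq m n (g1 g1' : 'I_m -> int) (g2 g2' : 'I_n -> int) k A :
  g1 =1 g1' -> g2 =1 g2' -> homog g1 g2 k A -> homog g1' g2' k A.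
Proof. by move=> e1 e2 h i j; rewrite -e1 -e2; apply: h. Qed.

Lemma djoinD m n (g1 : 'I_m -> int) (g2 : 'I_n -> int) k :
  djoin (fun i => g1 i + k) (fun i => g2 i + k) =1 fun i => djoin g1 g2 i + k.
Proof. by move=> i; rewrite /djoin; case: split. Qed.

Lemma homog_colD m n p (g : 'I_m -> int) (g1 : 'I_n -> int) (g2 : 'I_p -> int)
    k l A B :
  homog (fun i => g1 i + l) g k A -> homog (fun i => g2 i + l) g k B ->
  homog (fun i => djoin g1 g2 i + l) g k (col_mx A B).
Proof.
by move=> hA hB; apply: homog_eq (homog_col hA hB) => //; apply: djoinD.
Qed.

Lemma homog_rowD m n p (g : 'I_m -> int) (g1 : 'I_n -> int) (g2 : 'I_p -> int)
    k l A B :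
  homog g (fun i => g1 i + l) k A -> homog g (fun i => g2 i + l) k B ->
  homog g (fun i => djoin g1 g2 i + l) k (row_mx A B).
Proof.
by move=> hA hB; apply: homog_eq (homog_row hA hB) => //; apply: djoinD.
Qed.

Lemma comm_inv m n (a : 'M[F2]_m) (b : 'M[F2]_n) F G :
  a *m F = F *m b -> F *m G = 1%:M -> G *m F = 1%:M -> b *m G = G *m a.
Proof.
by move=> c FG GF; rewrite -[b]mul1mx -GF -(mulmxA G) -c -!mulmxA FG mulmx1.
Qed.

Lemma cmap_inv X Z FT FB GT GB :
  is_cmap X Z FT FB -> homog (gT Z) (gT X) 0 GT -> homog (gB Z) (gB X) 0 GB ->
  FT *m GT = 1%:M -> FB *m GB = 1%:M -> GT *m FT = 1%:M -> GB *m FB = 1%:M ->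
  is_cmap Z X GT GB.
Proof.
case=> _ m1 m2 m3 [d1 d2] h1 h2 e1 e2 e3 e4; split=> //.
- exact: comm_inv m1 e1 e3.
- by rewrite -[ps Z]mul1mx -e4 -(mulmxA GB) -m2 -!mulmxA e1 mulmx1.
- by rewrite -[pl Z]mul1mx -e3 -(mulmxA GT) -m3 -!mulmxA e2 mulmx1.
- by split; [exact: comm_inv d1 e1 e3|exact: comm_inv d2 e2 e4].
Qed.

(** * Reordering, cancelling and splitting off summands of cones *)

Definition mxblocks := (mul_col_mx, mul_mx_row, mul_row_col, mulmx0, mul0mx,
  mulmx1, mul1mx, addr0, add0r, row_mx0, col_mx0, add_row_mx, add_col_mx).

Lemma mx1_block n1 n2 :
  1%:M = col_mx (row_mx 1%:M 0) (row_mx 0 1%:M) :> 'M[F2]_(n1 + n2).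
Proof. exact: scalar_mx_block. Qed.

Ltac mxb := rewrite /= /block_mx ?mxblocks.


Lemma mx_ext m n (A B : 'M[F2]_(m, n)) :
  (forall x : 'rV_m, x *m A = x *m B) -> A = B.
Proof. by move=> h; apply/row_matrixP => i; rewrite !rowE h. Qed.

Lemma rv_ind n1 n2 (P : 'rV[F2]_(n1 + n2) -> Prop) :
  (forall x y, P (row_mx x y)) -> forall x, P x.
Proof. by move=> h x; rewrite -[x]hsubmxK. Qed.

(** The reordering behind [ciso_cone_dsum]: in an iterated cone the summand attached last comes
    first. *)
Definition assoc_mx (m n p : nat) : 'M[F2]_(m + n + p, n + (m + p)) :=
  col_mx (col_mx (row_mx 0 (row_mx 1%:M 0)) (row_mx 1%:M 0))
    (row_mx 0 (row_mx 0 1%:M)).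

Definition cossa_mx (m n p : nat) : 'M[F2]_(n + (m + p), m + n + p) :=
  col_mx (row_mx (row_mx 0 1%:M) 0)
    (col_mx (row_mx (row_mx 1%:M 0) 0) (row_mx 0 1%:M)).

Lemma assoc_mxE m n p (a : 'rV_m) (b : 'rV_n) (c : 'rV_p) :
  row_mx (row_mx a b) c *m assoc_mx m n p = row_mx b (row_mx a c).
Proof. by rewrite /assoc_mx; mxb. Qed.

Lemma cossa_mxE m n p (a : 'rV_m) (b : 'rV_n) (c : 'rV_p) :
  row_mx b (row_mx a c) *m cossa_mx m n p = row_mx (row_mx a b) c.
Proof. by rewrite /cossa_mx; mxb. Qed.

Lemma assoc_mxK m n p : assoc_mx m n p *m cossa_mx m n p = 1%:M.
Proof.
apply: mx_ext; apply: rv_ind => x c; move: x; apply: rv_ind => a b.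
by rewrite mulmxA assoc_mxE cossa_mxE mulmx1.
Qed.

Lemma cossa_mxK m n p : cossa_mx m n p *m assoc_mx m n p = 1%:M.
Proof.
apply: mx_ext; apply: rv_ind => b; apply: rv_ind => a c.
by rewrite mulmxA cossa_mxE assoc_mxE mulmx1.
Qed.

Ltac hmg := repeat first [exact: homog0 | exact: homog1 |
  (apply: homog_st; exact: homog1) | apply: homog_colD | apply: homog_rowD |
  apply: homog_col | apply: homog_row].

Lemma cmap_cone_dsum C A X CT CB AT AB :
  is_cmap (@cone (dsum C A) X (col_mx CT AT) (col_mx CB AB))
    (@cone A (@cone C X CT CB) (row_mx 0 AT) (row_mx 0 AB))
    (assoc_mx _ _ _) (assoc_mx _ _ _).
Proof.
split; first by split; hmg.
all: try split; rewrite /=.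
all: apply: mx_ext; apply: rv_ind => x c; move: x; apply: rv_ind => a b.
all: rewrite !mulmxA assoc_mxE; mxb; rewrite -/(assoc_mx _ _ _) ?assoc_mxE.
all: mxb; rewrite ?(addrC (a *m CT)) ?(addrC (a *m CB)) ?addrA //.
all: by rewrite addrAC.
Qed.

(** A sum may be attached one summand at a time. The map from [A] has no component in the suspension
    of [C], because it takes its values in [X]. *)
Lemma ciso_cone_dsum C A X CT CB AT AB :
  ciso (@cone (dsum C A) X (col_mx CT AT) (col_mx CB AB))
    (@cone A (@cone C X CT CB) (row_mx 0 AT) (row_mx 0 AB)).
Proof.
have hP := cmap_cone_dsum CT CB AT AB.
exists (assoc_mx _ _ _), (assoc_mx _ _ _), (cossa_mx _ _ _), (cossa_mx _ _ _).
split=> //; rewrite ?assoc_mxK ?cossa_mxK //.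
apply: (cmap_inv hP); rewrite ?assoc_mxK ?cossa_mxK //.
all: by hmg.
Qed.

Lemma ciso_cone0 X FT FB : ciso (@cone zero_cpx X FT FB) X.
Proof.
have e n : col_mx 0 1%:M *m row_mx 0 1%:M = 1%:M :> 'M[F2]_(0 + n).
  by mxb; rewrite [RHS]mx1_block; congr col_mx; rewrite [RHS]flatmx0.
have h : is_cmap (@cone zero_cpx X FT FB) X (col_mx 0 1%:M) (col_mx 0 1%:M).
  by apply: cmap_cone; [apply: cmap1|split; apply/matrixP => [[]]|move=> []
    |move=> []|apply/matrixP => [[]]|apply/matrixP => [[]]].
exists (col_mx 0 1%:M), (col_mx 0 1%:M), (row_mx 0 1%:M), (row_mx 0 1%:M).
split=> //.
- by apply: (cmap_inv h); rewrite ?e ?mul_row_col ?mul0mx ?add0r ?mulmx1 //;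
    hmg.
- by rewrite !e.
- by rewrite !mul_row_col !mul0mx !add0r !mulmx1.
Qed.

(** The source is embedded by [(a, p)] as a graph over the first summand, and dividing by a graph
    leaves the second. The projection [(t, s)] to [t b p + s] kills the graph: on [(x a, x p)] its
    two terms agree and cancel in characteristic 2. *)
Lemma hiso_cancel m q n (dA : 'M[F2]_m) (dT' : 'M[F2]_q) (dS : 'M[F2]_n)
    a b p :
  dA *m a = a *m dT' -> dT' *m b = b *m dA -> a *m b = 1%:M -> b *m a = 1%:M ->
  homology_iso (block_mx dA (row_mx a p) 0 (block_mx dT' 0 0 dS)) dS
    (col_mx 0 (col_mx (b *m p) 1%:M)).
Proof.
move=> ca cb ab ba; split.
  apply: rv_ind => x; apply: rv_ind => t s; mxb.
  rewrite -!row_mx0 => /row_mx_inj[xA /row_mx_inj[/addmm_eq xt /addmm_eq xs]].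
  case/submxP=> s' es; apply/submxP; exists (row_mx (t *m b) (row_mx 0 s')).
  mxb; rewrite -es mulmxA addmKm -!mulmxA ba mulmx1 -cb mulmxA -xt -mulmxA ab.
  by rewrite mulmx1.
move=> z hz; exists (row_mx 0 (row_mx 0 z)); mxb; first by rewrite hz !row_mx0.
by rewrite subrr sub0mx.
Qed.

Lemma qmap_cancel A T S AT AB BT BB ST SB :
  is_cpx A -> is_cpx T -> is_cpx S ->
  is_cmap A T AT AB -> is_cmap T A BT BB ->
  AT *m BT = 1%:M -> AB *m BB = 1%:M -> BT *m AT = 1%:M -> BB *m AB = 1%:M ->
  is_cmap A S ST SB ->
  qmap (@cone A (dsum T S) (row_mx AT ST) (row_mx AB SB)) S.
Proof.
move=> hA hT hS a b e1 e2 e3 e4 s; split.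
  by apply: cpx_cone => //; [apply: cpx_dsum|apply: cmap_row].
split=> //.
exists (col_mx 0 (col_mx (BT *m ST) 1%:M)), (col_mx 0 (col_mx (BB *m SB) 1%:M)).
split; last first.
  case: a => _ _ _ _ [a1 a2]; case: b => _ _ _ _ [b1 b2].
  by split; apply: hiso_cancel.
apply: cmap_cone; first by apply: cmap_col; [apply: cmap_comp b s|apply: cmap1].
- by split; rewrite !mulmx0 !mul0mx.
- exact: homog0.
- exact: homog0.
- by mxb; rewrite mulmxA e1 mul1mx addmm.
- by mxb; rewrite mulmxA e2 mul1mx addmm.
Qed.

Lemma hiso_retract m n (dV : 'M[F2]_m) (dY : 'M[F2]_n) i p :
  dV *m i = i *m dY -> dY *m p = p *m dV -> i *m p = 1%:M ->
  homology_iso dY (block_mx dV 0 0 (block_mx dV i 0 dY))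
    (row_mx p (row_mx 0 1%:M)).
Proof.
move=> ci cp ip; split.
  move=> y yY; mxb; case/submxP; apply: rv_ind => b; apply: rv_ind => b' y'; mxb.
  move=> /row_mx_inj[yp /row_mx_inj[_ ey]].
  apply/submxP; exists ((b + y' *m p) *m i + y').
  have e : b' = (b + y' *m p) *m dV.
    by rewrite mulmxDl -yp ey mulmxDl -!mulmxA cp ip mulmx1 addmmK.
  by rewrite ey mulmxDl e -!mulmxA ci.
apply: rv_ind => b; apply: rv_ind => c y; mxb.
rewrite -!row_mx0 => /row_mx_inj[bV /row_mx_inj[cV /addmm_eq e]].
have ec : c = y *m p *m dV.
  by rewrite -mulmxA -cp mulmxA -e -mulmxA ip mulmx1.
(* [y + y p i] removes the part of [y] inside the summand and [b i] puts in the prescribed one; what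
   remains in the cone is the boundary of [y p + b]. *)
exists (y + y *m p *m i + b *m i).
  rewrite !mulmxDl -e -!mulmxA -ci (mulmxA y) (mulmxA (y *m p)) -ec addmm add0r.
  by rewrite mulmxA bV mul0mx.
apply/submxP; exists (row_mx 0 (row_mx (y *m p + b) 0)); mxb.
rewrite opp_row_mx add_row_mx opp_row_mx add_row_mx !oppmm addr0.
rewrite !mulmxDl -!mulmxA ip !mulmx1 addmm add0r addmm (mulmxA y p dV) -ec bV.
by rewrite addr0 -addrA addmKm.
Qed.

Lemma cmap_cone_inr A X FT FB :
  is_cmap X (@cone A X FT FB) (row_mx 0 1%:M) (row_mx 0 1%:M).
Proof. by split; [split; hmg|..|split]; mxb. Qed.

(** A retract splits off. The complement is the cone of the inclusion, not the kernel of the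
    projection, so no basis has to be chosen for it; the map combines the projection with the
    inclusion of [Y] in that cone. *)
Lemma qmap_retract B Y IT IB PT PB :
  is_cpx B -> is_cpx Y -> is_cmap B Y IT IB -> is_cmap Y B PT PB ->
  IT *m PT = 1%:M -> IB *m PB = 1%:M ->
  qmap Y (dsum B (cone IT IB)).
Proof.
move=> hB hY i p e1 e2; split=> //; split.
  by apply: cpx_dsum => //; apply: cpx_cone.
exists (row_mx PT (row_mx 0 1%:M)), (row_mx PB (row_mx 0 1%:M)); split.
  exact: cmap_row p (cmap_cone_inr _ _).
case: i => _ _ _ _ [i1 i2]; case: p => _ _ _ _ [p1 p2].
by split; apply: hiso_retract.
Qed.

Lemma ciso_swap A B C :
  is_cmap (dsum A (dsum B C)) (dsum B (dsum A C))
    (col_mx (row_mx 0 (row_mx 1%:M 0))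
       (col_mx (row_mx 1%:M 0) (row_mx 0 (row_mx 0 1%:M))))
    (col_mx (row_mx 0 (row_mx 1%:M 0))
       (col_mx (row_mx 1%:M 0) (row_mx 0 (row_mx 0 1%:M)))).
Proof.
by apply: cmap_col; [|apply: cmap_col]; repeat first [exact: cmap1|
  exact: cmap0|apply: cmap_row].
Qed.

Lemma swapK m n p :
  col_mx (row_mx 0 (row_mx 1%:M 0))
    (col_mx (row_mx 1%:M 0) (row_mx 0 (row_mx 0 1%:M))) *m
  col_mx (row_mx 0 (row_mx 1%:M 0))
    (col_mx (row_mx 1%:M 0) (row_mx 0 (row_mx 0 1%:M))) =
  1%:M :> 'M[F2]_(m + (n + p)).
Proof.
by apply: mx_ext; apply: rv_ind => a; apply: rv_ind => b c; mxb.
Qed.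

Lemma cmap_block A B X Z FT FB GT GB :
  is_cmap A X FT FB -> is_cmap B Z GT GB ->
  is_cmap (dsum A B) (dsum X Z) (block_mx FT 0 0 GT) (block_mx FB 0 0 GB).
Proof.
by move=> f g; apply: cmap_col; [apply: cmap_row f (cmap0 _ _)|
  apply: cmap_row (cmap0 _ _) g].
Qed.

Lemma block1K m n p (F : 'M[F2]_(n, p)) G :
  F *m G = 1%:M -> block_mx 1%:M 0 0 F *m block_mx 1%:M 0 0 G =
  1%:M :> 'M[F2]_(m + n).
Proof. by move=> e; rewrite mulmx_block; mxb; rewrite e -mx1_block. Qed.

(** * The chain model *)

(** A sub-Mackey functor given by membership predicates. Equalisers, images and preimages are then
    all instances, and that some elements generate is expressed by quantifying over such pairs.
    Closure under the differential is not asked. *)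
Definition msub X (P : 'rV[F2]_(nT X) -> Prop) (Q : 'rV[F2]_(nB X) -> Prop) :=
  [/\ P 0, forall x y, P x -> P y -> P (x + y) & forall x, P x -> P (x *m tT X)]
  /\ [/\ Q 0, forall x y, Q x -> Q y -> Q (x + y),
         forall y, Q y -> P (y *m ps X) & forall x, P x -> Q (x *m pl X)].

Lemma msub_eq A X FT FB GT GB :
  @mack A X FT FB -> @mack A X GT GB ->
  msub (fun x => x *m FT = x *m GT) (fun y => y *m FB = y *m GB).
Proof.
case=> [m1 m2 m3] [m4 m5 m6]; split; split; rewrite ?mul0mx //.
- by move=> x y hx hy; rewrite !mulmxDl hx hy.
- by move=> x hx; rewrite -!mulmxA m1 m4 !mulmxA hx.
- by move=> x y hx hy; rewrite !mulmxDl hx hy.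
- by move=> x hx; rewrite -!mulmxA m2 m5 !mulmxA hx.
- by move=> x hx; rewrite -!mulmxA m3 m6 !mulmxA hx.
Qed.

Lemma msub_sum n (P : 'rV[F2]_n -> Prop) x :
  P 0 -> (forall x y, P x -> P y -> P (x + y)) ->
  (forall i, P (delta_mx 0 i)) -> P x.
Proof.
move=> P0 PD Pd; rewrite (row_sum_delta x); apply: (big_ind P) => // i _.
by case: (F2P (x 0 i)) => ->; rewrite ?scale0r ?scale1r.
Qed.

Section Chain.
Variable s : seq bool.
Notation D := (cdesc s).
Notation isF := (nth false s).

Definition cellof (i : nat) : nat * bool := nth (0%N, false) D i.

Lemma cdesc_mem p : (p \in D) = (p.1 < size s)%N && (p.2 ==> isF p.1).
Proof.
apply/flattenP/andP => [[x /mapP[k]]|[h1 h2]].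
  rewrite mem_iota /= add0n => h ->.
  by case: ifP => e; rewrite !inE; [case/orP|]; move/eqP => -> /=; rewrite ?e.
exists (if isF p.1 then [:: (p.1, false); (p.1, true)] else [:: (p.1, false)]).
  by apply/mapP; exists p.1; rewrite ?mem_iota.
by case: p h1 h2 => c [] /= _; [move=> ->|case: ifP]; rewrite !inE eqxx ?orbT.
Qed.

Lemma cdesc_uniq : uniq D.
Proof.
rewrite /cdesc; elim: (size s) (0%N) => //= n IH m; rewrite cat_uniq IH andbT.
have h : forall b : bool, (m, b) \notin flatten [seq (if isF k
    then [:: (k, false); (k, true)] else [:: (k, false)]) | k <- iota m.+1 n].
  move=> b; apply/negP => /flattenP[x /mapP[k]]; rewrite mem_iota => /andP[lk _].
  by move=> ->; case: ifP => _; rewrite !inE !xpair_eqE; case: eqP lk => [->|_];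
    rewrite ?ltnn.
by case: ifP => _; rewrite has_sym /= ?orbF ?(negPf (h _)) ?inE ?xpair_eqE
  ?andbF.
Qed.

Lemma cellP (i : 'I_(size D)) :
  ((cellof i).1 < size s)%N && ((cellof i).2 ==> isF (cellof i).1).
Proof. by rewrite -cdesc_mem; apply: mem_nth. Qed.

Lemma cell_eq (i j : 'I_(size D)) : (i == j) = (cellof i == cellof j).
Proof.
by rewrite /cellof (nth_uniq _ (ltn_ord i) (ltn_ord j) cdesc_uniq).
Qed.

Lemma sum_ord1 (V : nmodType) n c0 (K : nat -> V) :
  (forall c, c != c0 -> K c = 0) ->
  \sum_(k < n) K k = if (c0 < n)%N then K c0 else 0.
Proof.
move=> h; case: ifP => l; last first.
  by apply: big1 => k _; apply: h; apply: contraFN l => /eqP <-.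
by rewrite (bigD1 (Ordinal l)) //= big1 ?addr0 // => k kn; apply: h.
Qed.

(** Each row of a structure matrix is supported on a single cell, so products over the Theta-level
    basis collapse to at most two terms. The identities of the chain model are checked in this
    way. *)
Lemma cdesc_sum1 (V : nmodType) c0 (G : nat * bool -> V) :
  (forall p, p.1 != c0 -> G p = 0) ->
  \sum_(i < size D) G (cellof i) =
  if (c0 < size s)%N then
    if isF c0 then G (c0, false) + G (c0, true) else G (c0, false)
  else 0.
Proof.
move=> h; have -> : \sum_(i < size D) G (cellof i) = \sum_(p <- D) G p.
  by rewrite (big_nth (0%N, false)) big_mkord.
rewrite /cdesc big_flatten big_map.
have -> : iota 0 (size s) = index_iota 0 (size s) by rewrite /index_iota subn0.
rewrite big_mkord (@sum_ord1 _ _ c0 (fun k => \sum_(p <- if isF k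
  then [:: (k, false); (k, true)] else [:: (k, false)]) G p)) => [|c cn].
  by case: ifP => // _; case: ifP => _; rewrite !big_cons big_nil addr0.
by case: ifP => _; rewrite !big_cons big_nil !h ?addr0.
Qed.

(** The pattern F, H, F is excluded because [p : F -> H] followed by [p : H -> F] is [u], which is
    not zero. All other pairs of consecutive differentials compose to zero. *)
Hypothesis s_ok :
  forall c, ~~ [&& isF c, ~~ isF c.+1, (c.+1 < size s)%N & isF c.+2].
Variable top : int.


Definition tE (p q : nat * bool) : F2 :=
  ((p.1 == q.1) && (if isF p.1 then p.2 != q.2 else true))%:R.
Definition psE (k : nat) (q : nat * bool) : F2 := (q.1 == k)%:R.
Definition plE (p : nat * bool) (k : nat) : F2 := ((p.1 == k) && isF k)%:R.
Definition dE (p q : nat * bool) : F2 :=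
  ((q.1 == p.1.+1) && (isF p.1 || isF q.1))%:R.
Definition bE (k l : nat) : F2 := ((l == k.+1) && ~~ isF k && isF l)%:R.

Local Notation C := (chain top s).

Lemma tTE (i j : 'I_(size D)) : tT C i j = tE (cellof i) (cellof j).
Proof. by rewrite mxE. Qed.
Lemma psE' (i : 'I_(size s)) (j : 'I_(size D)) : ps C i j = psE i (cellof j).
Proof. by rewrite mxE. Qed.
Lemma plE' (i : 'I_(size D)) (j : 'I_(size s)) : pl C i j = plE (cellof i) j.
Proof. by rewrite mxE. Qed.
Lemma dTE (i j : 'I_(size D)) : dT C i j = dE (cellof i) (cellof j).
Proof. by rewrite mxE. Qed.
Lemma dBE (i j : 'I_(size s)) : dB C i j = bE i j.
Proof. by rewrite mxE. Qed.

Definition chE := (tTE, psE', plE', dTE, dBE).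


Ltac sT c0 G := rewrite (@cdesc_sum1 _ c0 G) => [|?];
  last by rewrite /= /tE /psE /plE /dE /= ?(eq_sym c0);
    move/negPf => ->; rewrite ?mul0r ?mulr0.
Ltac sB c0 G := rewrite (@sum_ord1 _ _ c0 G) => [|?];
  last by rewrite /= /tE /psE /plE /dE /bE /= ?(eq_sym c0);
    move/negPf => ->; rewrite ?mul0r ?mulr0.

Ltac fin := rewrite ?eqxx /=;
  repeat match goal with |- context [nth false s ?c] => case: (nth false s c) end;
  repeat match goal with b : bool |- _ => case: b end;
  first [by rewrite ?mulr0 ?mul0r ?addr0 | by move=> *; apply/val_inj].

Lemma cpx_chain : is_cpx C.
Proof.
have eqc (i j : 'I_(size D)) : (1%:M : 'M[F2]_(size D)) i j =
    (cellof i == cellof j)%:R by rewrite mxE cell_eq.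
have lt2 k : (k.+1 < size s)%N = false -> isF k.+1 = false.
  by move=> h; apply: nth_default; rewrite leqNgt h.
split; split.
all: try (apply/matrixP => /= i j; rewrite ?[(_ *m _) _ _]mxE ?[(_ + _) _ _]mxE
  ?[(0 : 'M__) _ _]mxE ?eqc;
  try (under [LHS]eq_bigr do rewrite !chE);
  try (under [RHS]eq_bigr do rewrite !chE); rewrite ?chE).
- move: (cellP i) (cellP j) => /andP[/= hi bi] /andP[/= hj bj].
  sT (cellof i).1 (fun q => tE (cellof i) q * tE q (cellof j)).
  move: hi hj bi bj; case: (cellof i) (cellof j) => [c b] [c' b'] /= -> _.
  rewrite /tE /= xpair_eqE; case: (eqVneq c c') => [<-|_];
  fin.
- sT (nat_of_ord i) (fun q => psE i q * tE q (cellof j)).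
  move: (cellP j) => /andP[/= hj bj]; rewrite ltn_ord.
  move: hj bj; case: (cellof j) => c' b' /= _.
  rewrite /tE /psE /= eqxx (eq_sym c'); case: (eqVneq (nat_of_ord i) c') => [<-|_];
  fin.
- sT (cellof i).1 (fun q => tE (cellof i) q * plE q j).
  move: (cellP i) => /andP[/= hi bi]; rewrite hi.
  move: bi; case: (cellof i) => c b /=.
  rewrite /tE /plE /= eqxx; case: (eqVneq c j) => [<-|_];
  fin.
- rewrite [(_ + _ : 'M__) _ _]mxE eqc.
  sB (cellof i).1 (fun q => plE (cellof i) q * psE q (cellof j)).
  move: (cellP i) (cellP j) => /andP[/= hi bi] /andP[/= hj bj].
  rewrite tTE hi; move: bi bj; case: (cellof i) (cellof j) => [c b] [c' b'] /=.
  rewrite /tE /plE /psE /= xpair_eqE eqxx (eq_sym c').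
  case: (eqVneq c c') => [<-|_]; fin.
- sT (nat_of_ord i) (fun q => psE i q * plE q j).
  rewrite ltn_ord /psE /plE /= eqxx; case: (eqVneq (nat_of_ord i) j) => [<-|_];
  fin.
- move=> i j; rewrite tTE /tE /= addr0 -!/(cellof _).
  by case: (eqVneq (cellof i).1) => [->|]; rewrite ?eqxx.
- move=> i j; rewrite psE' /psE /= addr0 -!/(cellof _).
  by case: (eqVneq (cellof j).1) => [->|]; rewrite ?eqxx.
- move=> i j; rewrite plE' /plE /= addr0 -!/(cellof _).
  by case: (eqVneq (cellof i).1) => [->|]; rewrite ?eqxx.
- move=> i j; rewrite dTE /dE /= -!/(cellof _).
  case: (eqVneq (cellof j).1) => [->|]; rewrite ?eqxx // => _; lia.
- move=> i j; rewrite dBE /bE /=.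
  case: (eqVneq (val j)) => [->|]; rewrite ?eqxx // => _; lia.
- sT (cellof i).1.+1 (fun q => dE (cellof i) q * dE q (cellof j)).
  case: ifP => // h; rewrite /dE /= eqxx.
  move: (s_ok (cellof i).1) (cellP j) => /=.
  rewrite h; move: (cellof i).1 (cellof j).1 => c c'.
  case: (eqVneq c' c.+2) => [->|_]; last by rewrite !mulr0 addr0 if_same.
  fin.
- sB (nat_of_ord i).+1 (fun q => bE i q * bE q j).
  case: ifP => // h; rewrite /bE /= eqxx.
  case: (isF i.+1); last by rewrite andbF mul0r.
  by rewrite andbF mulr0.
- sT (cellof i).1 (fun q => tE (cellof i) q * dE q (cellof j)).
  sT (cellof i).1.+1 (fun q => dE (cellof i) q * tE q (cellof j)).
  move: (cellP i) (cellP j) => /andP[/= hi bi] /andP[/= hj bj].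
  rewrite hi; move: hj bi bj; case: (cellof i) (cellof j) => [c b] [c' b'] /=.
  rewrite /tE /dE /= ?eqxx (eq_sym c.+1).
  case: (eqVneq c' c.+1) => [->|_] => [->|_];
    last by rewrite !mulr0 !addr0 !if_same.
  fin.
- sT (nat_of_ord i) (fun q => psE i q * dE q (cellof j)).
  sB (nat_of_ord i).+1 (fun q => bE i q * psE q (cellof j)).
  move: (cellP j) => /andP[/= hj bj]; rewrite ltn_ord.
  move: hj bj; case: (cellof j) => [c' b'] /=.
  rewrite /bE /psE /dE /= ?eqxx.
  case: (eqVneq c' i.+1) => [->|_] => [->|_];
    last by rewrite !mulr0 !addr0 !if_same.
  fin.
- sB (cellof i).1 (fun q => plE (cellof i) q * bE q j).
  sT (cellof i).1.+1 (fun q => dE (cellof i) q * plE q j).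
  move: (cellP i) => /andP[/= hi bi]; rewrite hi.
  move: (cellof i).1 => c.
  rewrite /bE /plE /dE /= ?eqxx /=.
  case: (eqVneq c.+1 j) => [->|_]; rewrite ?ltn_ord /=;
    case: (isF c); case: (isF _) => //=; rewrite ?andbF ?mulr0 ?mul0r ?addr0 ?if_same //;
    by case: (_ && _); apply/val_inj.
Qed.

(** [chv c] generates the cell [c] if it is F, [chw c] if it is H. Past the end of the chain [chw]
    is 0, the value that [chv_dT] needs when [c] is the last cell. *)
Definition chv (c : nat) : 'rV[F2]_(size D) :=
  \row_i (cellof i == (c, false))%:R.
Definition chw (c : nat) : 'rV[F2]_(size s) := \row_i (i == c :> nat)%:R.

Lemma eqp1 (q : nat * bool) c b : q.1 != c -> (q == (c, b)) = false.
Proof. by case: q => q b' /= h; rewrite xpair_eqE (negPf h). Qed.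

Lemma chv_mul n (M : 'M[F2]_(size D, n)) (m : nat * bool -> 'rV[F2]_n) c :
  (forall i : 'I__, row i M = m (cellof i)) -> (c < size s)%N ->
  chv c *m M = m (c, false).
Proof.
move=> h cn; rewrite mulmx_sum_row.
rewrite (eq_bigr (fun i : 'I__ => (fun q => (q == (c, false))%:R *: m q) (cellof i)))
  => [|i _];
  last by rewrite mxE h.
rewrite (@cdesc_sum1 _ c (fun q => (q == (c, false))%:R *: m q)) ?cn => [|q qc];
  last by rewrite eqp1 ?scale0r.
rewrite eqxx scale1r [(_, true) == _](_ : _ = false); last first.
  by rewrite xpair_eqE andbF.
by rewrite scale0r addr0 if_same.
Qed.

Lemma chw_mul n (M : 'M[F2]_(size s, n)) (m : nat -> 'rV[F2]_n) c :
  (forall i : 'I__, row i M = m i) -> (c < size s)%N -> chw c *m M = m c.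
Proof.
move=> h cn; rewrite mulmx_sum_row.
rewrite (eq_bigr (fun i : 'I__ => (fun q : nat => (q == c)%:R *: m q) i)) => [|i _];
  last by rewrite mxE h.
rewrite (@sum_ord1 _ _ c (fun q : nat => (q == c)%:R *: m q)) ?cn => [|q qc];
  last by rewrite (negPf qc) scale0r.
by rewrite eqxx scale1r.
Qed.

Lemma chw_out c : (size s <= c)%N -> chw c = 0.
Proof.
move=> h; apply/rowP => i; rewrite !mxE; case: eqP => // e.
by move: (ltn_ord i); rewrite e ltnNge h.
Qed.

Lemma chv_pl c : (c < size s)%N -> isF c -> chv c *m pl C = chw c.
Proof.
move=> cn Fc; rewrite (@chv_mul _ _ (fun p => \row_k plE p k)) //.
  by apply/rowP => k; rewrite !mxE /plE /= eq_sym; case: eqP => [->|]; rewrite ?Fc.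
by move=> i; apply/rowP => k; rewrite [LHS]mxE plE' [RHS]mxE.
Qed.

Lemma chw_psE c : (c < size s)%N ->
  chw c *m ps C = \row_i ((cellof i).1 == c)%:R.
Proof.
move=> cn; rewrite (@chw_mul _ _ (fun p => \row_i psE p (cellof i))) //.
by move=> i; apply/rowP => k; rewrite [LHS]mxE psE' [RHS]mxE.
Qed.

Lemma chw_ps c : (c < size s)%N -> ~~ isF c -> chw c *m ps C = chv c.
Proof.
move=> cn Fc; rewrite chw_psE //; apply/rowP => k; rewrite !mxE.
move: (cellP k); case: (cellof k) => c' b' /= /andP[_].
by rewrite xpair_eqE; case: eqP => //= ->; rewrite (negPf Fc); case: b'.
Qed.

Lemma chv_dT c : (c < size s)%N -> isF c -> chv c *m dT C = chw c.+1 *m ps C.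
Proof.
move=> cn Fc; rewrite (@chv_mul _ _ (fun p => \row_k dE p (cellof k))) //;
  last by move=> i; apply/rowP => k; rewrite [LHS]mxE dTE [RHS]mxE.
have [h|h] := ltnP c.+1 (size s).
  by rewrite chw_psE //; apply/rowP => k; rewrite !mxE /dE /= Fc andbT.
rewrite chw_out // mul0mx; apply/rowP => k; rewrite !mxE /dE /=.
case: eqP => // e; move: (cellP k); rewrite e ltnNge h //.
Qed.

Lemma chw_dB c : (c < size s)%N ->
  chw c *m dB C = if ~~ isF c && isF c.+1 then chw c.+1 else 0.
Proof.
move=> cn; rewrite (@chw_mul _ _ (fun p => \row_k bE p k)) //;
  last by move=> i; apply/rowP => k; rewrite [LHS]mxE dBE [RHS]mxE.
apply/rowP => k; rewrite !mxE /bE; case: eqP => e; rewrite /= ?mxE.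
  by rewrite e; case: (isF c); case: (isF c.+1); rewrite /= !mxE ?e ?eqxx.
by case: ifP => _; rewrite !mxE //; move/eqP/negPf: e => ->.
Qed.

Lemma chv_tE c : (c < size s)%N -> isF c ->
  chv c *m tT C = \row_i (cellof i == (c, true))%:R.
Proof.
move=> cn Fc; rewrite (@chv_mul _ _ (fun p => \row_k tE p (cellof k))) //;
  last by move=> i; apply/rowP => k; rewrite [LHS]mxE tTE [RHS]mxE.
apply/rowP => k; rewrite !mxE /tE /= Fc; case: (cellof k) => c' b' /=.
by rewrite xpair_eqE eq_sym; case: eqP => //=; case: b'.
Qed.

Lemma hd_chv c : hd (gT C) (top - c%:Z) (chv c).
Proof.
move=> j; rewrite mxE /= -!/(cellof _); by case: (eqVneq (cellof j)) => [->|].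
Qed.

Lemma hd_chw c : hd (gB C) (top - c%:Z) (chw c).
Proof.
by move=> j; rewrite mxE /=; case: (eqVneq (val j)) => [->|].
Qed.

(** F is generated at the Theta level: [t] gives its second Theta vector and [p_*] its bullet
    vector. H is generated at the bullet level, and [p^*] gives its Theta vector. *)
Lemma chain_span P Q : @msub C P Q ->
  (forall c, (c < size s)%N -> isF c -> P (chv c)) ->
  (forall c, (c < size s)%N -> ~~ isF c -> Q (chw c)) ->
  (forall x, P x) /\ (forall y, Q y).
Proof.
move=> [[P0 PD Pt] [Q0 QD Qp Qq]] hv hw.
have hw' c : (c < size s)%N -> Q (chw c).
  move=> cn; case: (boolP (isF c)) => Fc; last exact: hw.
  by rewrite -chv_pl //; apply/Qq/hv.
split=> x; apply: msub_sum => // i; last first.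
  have e (k : 'I_(size s)) : chw k = delta_mx 0 k.
    by apply/rowP => j; rewrite !mxE eqxx.
  by have := hw' _ (ltn_ord i); rewrite e.
move: (cellP i); case ei: (cellof i) => [c b] /= /andP[cn Fc].
suff : P (\row_j (cellof j == (c, b))%:R).
  have ed : delta_mx 0 i = \row_(j < size D) (cellof j == (c, b))%:R :> 'rV[F2]_(size D).
    by apply/rowP => j; rewrite !mxE eqxx cell_eq ei.
  by rewrite -ed.
case: b {ei} Fc => [/= Fc|_]; first by rewrite -chv_tE //; apply/Pt/hv.
rewrite -/(chv c); case: (boolP (isF c)) => Fc; first exact: hv.
by rewrite -chw_ps //; apply/Qp/hw'.
Qed.

Lemma chain_ext X FT FB GT GB : @mack C X FT FB -> @mack C X GT GB ->
  (forall c, (c < size s)%N -> isF c -> chv c *m FT = chv c *m GT) ->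
  (forall c, (c < size s)%N -> ~~ isF c -> chw c *m FB = chw c *m GB) ->
  FT = GT /\ FB = GB.
Proof.
move=> m1 m2 h1 h2; have [e1 e2] := chain_span (msub_eq m1 m2) h1 h2.
by split; apply: mx_ext.
Qed.

Section Map.
Variables (X : cpx) (v : nat -> 'rV[F2]_(nT X)) (w : nat -> 'rV[F2]_(nB X)).
Hypotheses (hX : is_cpx X)
  (vw : forall c, (c < size s)%N -> isF c -> v c *m pl X = w c).

Let R (p : nat * bool) : 'rV[F2]_(nT X) :=
  if isF p.1 then if p.2 then v p.1 *m tT X else v p.1 else w p.1 *m ps X.
Definition chFT : 'M[F2]_(size D, nT X) := \matrix_i R (cellof i).
Definition chFB : 'M[F2]_(size s, nB X) := \matrix_i w i.

Lemma chFT_v c : (c < size s)%N -> isF c -> chv c *m chFT = v c.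
Proof.
move=> cn Fc; rewrite (@chv_mul _ _ R) //; last by move=> i; rewrite rowK.
by rewrite /R /= Fc.
Qed.

Lemma chFB_w c : (c < size s)%N -> chw c *m chFB = w c.
Proof. by move=> cn; rewrite (@chw_mul _ _ w) // => i; rewrite rowK. Qed.

(** Freeness of the cells: a map out of F is an arbitrary Theta-level element, a map out of H an
    arbitrary bullet-level element. For H the compatibility with [p_*] is the axiom [p_* p^* = 0] in
    [X]. *)
Lemma mack_ch : @mack C X chFT chFB.
Proof.
case: hX => [[a1 a2 a3 a4 a5] _ _].
have vt c : (c < size s)%N -> isF c -> v c + v c *m tT X = w c *m ps X.
  by move=> cn Fc; rewrite -vw // -mulmxA a4 mulmxDr mulmx1.
split; apply/row_matrixP => i; rewrite !row_mul.
- rewrite mulmx_sum_row.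
  rewrite (eq_bigr (fun l : 'I__ => (fun q => tE (cellof i) q *: R q) (cellof l)))
    => [|l _];
    last by rewrite rowK mxE tTE.
  rewrite (@cdesc_sum1 _ (cellof i).1 (fun q => tE (cellof i) q *: R q))
    => [|q qc]; last first.
    by rewrite /tE eq_sym (negPf qc) scale0r.
  rewrite rowK /tE /=; move: (cellP i); case: (cellof i) => c b /andP[/= -> bF].
  rewrite eqxx /R /=; case: (boolP (isF c)) bF => Fc.
    by case: b => _; rewrite ?scale1r ?scale0r ?add0r ?addr0 // -mulmxA a1 mulmx1.
  by case: b => // _; rewrite scale1r -mulmxA a2.
- rewrite mulmx_sum_row.
  rewrite (eq_bigr (fun l : 'I__ => (fun q => psE i q *: R q) (cellof l)))
    => [|l _];
    last by rewrite rowK mxE psE'.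
  rewrite (@cdesc_sum1 _ i (fun q => psE i q *: R q)) => [|q qc];
    last by rewrite /psE (negPf qc) scale0r.
  rewrite rowK /psE /= ltn_ord eqxx !scale1r /R /=.
  by case: (boolP (isF i)) => Fi; rewrite ?vt.
- rewrite mulmx_sum_row.
  rewrite (eq_bigr (fun l : 'I__ => (fun q => plE (cellof i) q *: w q) l))
    => [|l _];
    last by rewrite rowK mxE plE'.
  rewrite (@sum_ord1 _ _ (cellof i).1 (fun q => plE (cellof i) q *: w q))
    => [|q qc]; last first.
    by rewrite /plE eq_sym (negPf qc) scale0r.
  rewrite rowK /plE /=; move: (cellP i); case: (cellof i) => c b /andP[/= cn bF].
  rewrite cn eqxx /R /=; case: (boolP (isF c)) bF => Fc.
    by case: b => _; rewrite scale1r ?vw // -mulmxA a3 vw.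
  by case: b => // _; rewrite scale0r -mulmxA a5 mulmx0.
Qed.

Variables (k : int).
Hypotheses
  (hv : forall c, (c < size s)%N -> isF c -> hd (gT X) (top - c%:Z + k) (v c))
  (hw : forall c, (c < size s)%N -> hd (gB X) (top - c%:Z + k) (w c)).

Lemma homog_chFT : homog (gT C) (gT X) k chFT.
Proof.
case: hX => [_ [h1 h2 _ _ _] _].
apply/homogP => i; rewrite rowK /= -!/(cellof _).
move: (cellP i); case: (cellof i) => c b /andP[/= cn bF].
rewrite /R /=; case: ifP => Fc.
  case: b {bF} => //; last exact: hv.
  by have := hd_mul h1 (hv cn Fc); rewrite addr0.
by have := hd_mul h2 (hw cn); rewrite addr0.
Qed.

Lemma homog_chFB : homog (gB C) (gB X) k chFB.
Proof. by apply/homogP => i; rewrite rowK; apply: hw. Qed.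

End Map.

Lemma chain_coordB y c : (c < size s)%N -> hd (gB C) (top - c%:Z) y ->
  exists a, y = a *: chw c.
Proof.
move=> cn hy; exists (y 0 (Ordinal cn)); apply/rowP => j; rewrite !mxE.
case: (eqVneq (val j) c) => [e|e].
  by rewrite mulr1; congr (y 0 _); apply/val_inj.
rewrite mulr0; apply/eqP; apply: contraNT e => /hy /=.
by move/addrI/oppr_inj => [->].
Qed.

(** For a cell F the basis [e], [e + t e] replaces [e], [t e], since [e + t e = p^* p_* e] is [p^*]
    of the bullet generator, as is the Theta vector of a cell H. *)
Lemma chain_coordT x c : (c < size s)%N -> hd (gT C) (top - c%:Z) x ->
  exists a b, x = (if isF c then a else 0) *: chv c + b *: (chw c *m ps C).
Proof.
move=> cn hx.
have h0 (j : 'I_(size D)) : (cellof j).1 != c -> x 0 j = 0.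
  move=> jc; apply/eqP; apply: contraNT jc => /hx /=; rewrite -!/(cellof _).
  by move/addrI/oppr_inj => [->].
pose al b := \sum_(i < size D | cellof i == (c, b)) x 0 i.
have hal (j : 'I_(size D)) b : cellof j = (c, b) -> al b = x 0 j.
  move=> e; rewrite /al (big_pred1 j) // => i /=.
  by rewrite -e -cell_eq.
case: (boolP (isF c)) => Fc; last first.
  exists 0, (al false); rewrite scale0r add0r chw_ps //.
  apply/rowP => j; rewrite !mxE.
  case: (eqVneq (cellof j).1 c) => e; last by rewrite eqp1 // mulr0 h0.
  move: (cellP j); case ej: (cellof j) e => [c' b'] /= e.
  rewrite e (negPf Fc); case: b' ej => [|ej]; first by rewrite andbF.
  by rewrite eqxx mulr1 (hal j) // ej e.
(* [alpha e + beta t e = (alpha + beta) e + beta (e + t e)] in characteristic 2. *)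
exists (al false + al true), (al true); rewrite scalerDl -addrA -scalerDr.
apply/rowP => j; rewrite chw_psE // !mxE.
case: (eqVneq (cellof j).1 c) => e; last by rewrite eqp1 // addr0 !mulr0 addr0 h0.
case ej: (cellof j) e => [c' b'] /= e; rewrite xpair_eqE e eqxx /=.
case: b' ej => ej; rewrite /=; rewrite e in ej.
  by rewrite -(hal j true ej) mulr0 add0r add0r mulr1.
rewrite -(hal j false ej) mulr1 (_ : 1 + 1 = 0) ?mulr0 ?addr0 //.
exact/val_inj.
Qed.

Lemma chain_deg0T x z : hd (gT C) z x ->
  (forall c, (c < size s)%N -> top - c%:Z != z) -> x = 0.
Proof.
move=> hx h; apply/rowP => j; rewrite mxE; apply/eqP.
case: (eqVneq (x 0 j) 0) => // /hx /= e; case/andP: (cellP j) => /h.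
by rewrite -e eqxx.
Qed.

Lemma chain_deg0B x z : hd (gB C) z x ->
  (forall c, (c < size s)%N -> top - c%:Z != z) -> x = 0.
Proof.
move=> hx h; apply/rowP => j; rewrite mxE; apply/eqP.
case: (eqVneq (x 0 j) 0) => // /hx /= e; move: (h j (ltn_ord j)).
by rewrite -e eqxx.
Qed.

Lemma chw_neq0 c : (c < size s)%N -> chw c != 0.
Proof.
move=> cn; apply/eqP => /rowP/(_ (Ordinal cn)); rewrite !mxE eqxx => h.
by move/eqP: h; rewrite oner_eq0.
Qed.

Lemma chw_ps_neq0 c : (c < size s)%N -> chw c *m ps C != 0.
Proof.
move=> cn; rewrite chw_psE //.
have mD : (c, false) \in D by rewrite cdesc_mem cn.
have iD : (index (c, false) D < size D)%N by rewrite index_mem.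
apply/eqP => /rowP/(_ (Ordinal iD)); rewrite !mxE /cellof nth_index // eqxx.
by move/eqP; rewrite oner_eq0.
Qed.

End Chain.

(** * Cells and strands *)

(* A copy of the generators of [Sigma^k H(k - f)]: [e j] generates the F in degree
   [j] and [g f] the H at the bottom, while [g j] is [p_* (e j)] for [j > f]. *)
Definition strand X (k f : nat) (e : nat -> 'rV[F2]_(nT X))
    (g : nat -> 'rV[F2]_(nB X)) : Prop :=
  (forall j : nat, (f < j <= k)%N ->
     [/\ hd (gT X) j%:Z (e j), e j *m pl X = g j &
         e j *m dT X = g j.-1 *m ps X]) /\
  (forall j : nat, (f <= j <= k)%N -> hd (gB X) j%:Z (g j) /\ g j *m dB X = 0).

Arguments strand : clear implicits.

Definition cell_seq (r : nat) : seq bool := rcons (nseq r true) false.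
Definition cell (k r : nat) : cpx := shift k%:Z (Hq r).
(* The generators of [cell m r] numbered by their degree when [k = m]; with
   [k = m.+1] they carry the degree they acquire in a mapping cone. *)
Definition genT (r k j : nat) := chv (cell_seq r) (k - j).
Definition genB (r k j : nat) := chw (cell_seq r) (k - j).

Lemma cell_seq_size r : size (cell_seq r) = r.+1.
Proof. by rewrite size_rcons size_nseq. Qed.

Lemma cell_seq_nth r c : nth false (cell_seq r) c = (c < r)%N.
Proof.
by rewrite nth_rcons size_nseq nth_nseq; case: ltngtP.
Qed.

Lemma cell_seq_ok r c : ~~ [&& nth false (cell_seq r) c, ~~ nth false (cell_seq r) c.+1,
  (c.+1 < size (cell_seq r))%N & nth false (cell_seq r) c.+2].
Proof. by rewrite !cell_seq_nth cell_seq_size; lia. Qed.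

Lemma cpx_cell k r : is_cpx (cell k r).
Proof. by apply: cpx_shift; apply: cpx_chain; apply: cell_seq_ok. Qed.

Lemma hd_shift n (g : 'I_n -> int) z k x :
  hd (fun i => g i + k) z x <-> hd g (z - k) x.
Proof.
split=> h j /h; [move=> <-; lia|move=> e; lia].
Qed.

Section Cell.
Variables (a r : nat).
Hypothesis ra : (r <= a)%N.
Notation s := (cell_seq r).
Notation e := (genT r a).
Notation g := (genB r a).
Notation b := (a - r)%N.

Lemma cell_pl m j : (b < j <= a)%N -> e j *m pl (cell m r) = g j.
Proof.
move=> h; rewrite /genT /genB; apply: (@chv_pl s 0); rewrite ?cell_seq_size ?cell_seq_nth; lia.
Qed.

Lemma cell_dT m j : (b < j <= a)%N ->
  e j *m dT (cell m r) = g j.-1 *m ps (cell m r).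
Proof.
move=> h; rewrite /genT /genB (_ : a - j.-1 = (a - j).+1)%N; last by lia.
by apply: (@chv_dT s 0); rewrite ?cell_seq_size ?cell_seq_nth; lia.
Qed.

Lemma cell_dB m j : (b <= j <= a)%N -> g j *m dB (cell m r) = 0.
Proof.
move=> h; rewrite /genB [LHS](@chw_dB s 0) ?cell_seq_size; last by lia.
by rewrite !cell_seq_nth; case: ifP => //; lia.
Qed.

Lemma hd_cellT m j : (j <= a)%N ->
  hd (gT (cell m r)) (j%:Z + m%:Z - a%:Z) (e j).
Proof.
move=> h; apply/hd_shift; have := @hd_chv s 0 (a - j).
by rewrite (_ : _ - _ = j%:Z + m%:Z - a%:Z - m%:Z); last by lia.
Qed.

Lemma hd_cellB m j : (j <= a)%N ->
  hd (gB (cell m r)) (j%:Z + m%:Z - a%:Z) (g j).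
Proof.
move=> h; apply/hd_shift; have := @hd_chw s 0 (a - j).
by rewrite (_ : _ - _ = j%:Z + m%:Z - a%:Z - m%:Z); last by lia.
Qed.

Lemma cell_span m P Q : @msub (cell m r) P Q ->
  (forall j, (b < j <= a)%N -> P (e j)) -> Q (g b) ->
  (forall x, P x) /\ (forall y, Q y).
Proof.
move=> PQ hP hQ; apply: (chain_span (s := s) (top := 0) PQ) => c.
  rewrite cell_seq_size cell_seq_nth => h1 h2; have := hP (a - c)%N.
  by rewrite /genT (_ : a - (a - c) = c)%N; [apply|]; lia.
rewrite cell_seq_size cell_seq_nth => h1 h2; have <- : (a - b)%N = c by lia.
exact: hQ.
Qed.

Lemma cell_ext m X FT FB GT GB :
  @mack (cell m r) X FT FB -> @mack (cell m r) X GT GB ->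
  (forall j, (b < j <= a)%N -> e j *m FT = e j *m GT) ->
  g b *m FB = g b *m GB -> FT = GT /\ FB = GB.
Proof.
move=> m1 m2 h1 h2; have [e1 e2] := cell_span (msub_eq m1 m2) h1 h2.
by split; apply: mx_ext.
Qed.

Lemma cell_mack m X (k : int) v w : is_cpx X ->
  (forall j, (b < j <= a)%N ->
     hd (gT X) (j%:Z + m%:Z - a%:Z + k) (v j) /\ v j *m pl X = w j) ->
  (forall j, (b <= j <= a)%N -> hd (gB X) (j%:Z + m%:Z - a%:Z + k) (w j)) ->
  exists FT FB, [/\ @mack (cell m r) X FT FB,
    homog (gT (cell m r)) (gT X) k FT, homog (gB (cell m r)) (gB X) k FB,
    forall j, (b < j <= a)%N -> e j *m FT = v j &
    forall j, (b <= j <= a)%N -> g j *m FB = w j].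
Proof.
move=> hX hv hw.
have vw c : (c < size s)%N -> nth false s c -> v (a - c)%N *m pl X = w (a - c)%N.
  by rewrite cell_seq_size cell_seq_nth => h1 h2; case: (hv (a - c)%N) => //; lia.
have hv' c : (c < size s)%N -> nth false s c ->
    hd (gT X) (0 - c%:Z + (m%:Z + k)) (v (a - c)%N).
  rewrite cell_seq_size cell_seq_nth => h1 h2; case: (hv (a - c)%N); first by lia.
  by rewrite (_ : _ + k = 0 - c%:Z + (m%:Z + k)) //; lia.
have hw' c : (c < size s)%N -> hd (gB X) (0 - c%:Z + (m%:Z + k)) (w (a - c)%N).
  rewrite cell_seq_size => h1; have := hw (a - c)%N.
  rewrite (_ : _ + k = 0 - c%:Z + (m%:Z + k)); last by lia.
  by apply; lia.
exists (chFT s (fun c => v (a - c)%N) (fun c => w (a - c)%N)).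
exists (chFB s (fun c => w (a - c)%N)); split.
- exact: (mack_ch 0 hX vw).
- by apply: homog_s (homog_chFT hX hv' hw'); rewrite addrC.
- by apply: homog_s (homog_chFB hw'); rewrite addrC.
- move=> j h; rewrite /genT chFT_v ?cell_seq_size ?cell_seq_nth; try by lia.
  by congr v; lia.
- move=> j h; rewrite /genB chFB_w ?cell_seq_size; try by lia.
  by congr w; lia.
Qed.

Section Attach.
Variables (m : nat) (X : cpx).
Hypothesis am : a = m.+1.
Variables (FT : 'M[F2]_(nT (cell m r), nT X)) (FB : 'M[F2]_(nB (cell m r), nB X)).
Hypothesis f : is_cmap (cell m r) X FT FB.
Notation x j := (e j *m FT).
Notation z j := (g j *m FB).

Lemma src_x j : (b < j <= a)%N ->
  [/\ hd (gT X) (j%:Z - 1) (x j), x j *m pl X = z j &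
      x j *m dT X = z j.-1 *m ps X].
Proof.
case: f => [[h1 h2] h3 h4 h5 [h6 h7]] h; split.
- have := hd_mul h1 (@hd_cellT m j _).
  rewrite (_ : j%:Z + m%:Z - a%:Z + 0 = j%:Z - 1); last by lia.
  by apply; lia.
- by rewrite -mulmxA -h5 mulmxA; congr (_ *m _); apply: cell_pl.
- rewrite -mulmxA -h6 -mulmxA -h4 !mulmxA; congr (_ *m _); exact: cell_dT.
Qed.

Lemma src_z j : (b <= j <= a)%N ->
  hd (gB X) (j%:Z - 1) (z j) /\ z j *m dB X = 0.
Proof.
case: f => [[h1 h2] h3 h4 h5 [h6 h7]] h; split.
  have := hd_mul h2 (@hd_cellB m j _).
  rewrite (_ : j%:Z + m%:Z - a%:Z + 0 = j%:Z - 1); last by lia.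
  by apply; lia.
by rewrite -mulmxA -h7 mulmxA (cell_dB m h) mul0mx.
Qed.

(** Both sides of the homotopy equation are natural, so the homotopy is prescribed and checked on
    generators. On the bottom H only the condition on [w b] remains, because [g b] is a cycle in the
    cell. *)
Lemma cell_null B RT RB v w : is_cpx B -> is_cmap X B RT RB ->
  (forall j, (b < j <= a)%N -> [/\ hd (gT B) j%:Z (v j), v j *m pl B = w j &
     v j *m dT B = w j.-1 *m ps B + x j *m RT]) ->
  (forall j, (b <= j <= a)%N -> hd (gB B) j%:Z (w j)) ->
  w b *m dB B = z b *m RB ->
  exists HT HB, [/\ mack HT HB,
    homog (gT (cell m r)) (gT B) 1 HT /\ homog (gB (cell m r)) (gB B) 1 HB,
    dT (cell m r) *m HT + FT *m RT = HT *m dT B,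
    dB (cell m r) *m HB + FB *m RB = HB *m dB B &
    forall j, (b <= j <= a)%N -> g j *m HB = w j].
Proof.
move=> hB hr hv hw wb.
have [||HT [HB [M h1 h2 ev ew]]] := @cell_mack m B 1 v w hB.
- move=> j hj; case: (hv j hj) => ? ? _; split=> //.
  by rewrite (_ : _ + 1 = j%:Z) //; lia.
- by move=> j hj; rewrite (_ : _ + 1 = j%:Z) //; [apply: hw|lia].
exists HT, HB.
have mcell := mack_d (cpx_cell m r); have mB := mack_d hB.
have [c1 c2] : dT (cell m r) *m HT + FT *m RT = HT *m dT B /\
    dB (cell m r) *m HB + FB *m RB = HB *m dB B.
  apply: (@cell_ext m).
  - apply: mackD; first exact: mackM mcell M.
    exact: mackM (cmap_mack f) (cmap_mack hr).
  - exact: mackM M mB.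
  - move=> j hj; case: (hv j hj) => _ _ e3.
    rewrite mulmxDr !mulmxA (cell_dT m hj) ev // e3.
    case: M => _ M _; congr (_ + _); rewrite -[LHS]mulmxA M mulmxA ew //.
    by lia.
  - rewrite mulmxDr !mulmxA (@cell_dB m b) ?mul0mx ?add0r ?ew ?wb //; lia.
by split.
Qed.

End Attach.
End Cell.

Lemma strand_cell k r : (r <= k)%N ->
  strand (cell k r) k (k - r) (genT r k) (genB r k).
Proof.
move=> rk; split=> j h; split.
- have := @hd_cellT k r rk k j; rewrite (_ : _ - _ = j%:Z); last by lia.
  by apply; lia.
- exact: cell_pl.
- exact: cell_dT.
- have := @hd_cellB k r rk k j; rewrite (_ : _ - _ = j%:Z); last by lia.
  by apply; lia.
- exact: cell_dB.
Qed.

(** A strand is what is needed to map a cell into [X]. Injectivity is not part of it: a strand may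
    vanish in part or altogether. *)
Lemma strand_map k r X e g : is_cpx X -> (r <= k)%N -> strand X k (k - r) e g ->
  exists FT FB, [/\ is_cmap (cell k r) X FT FB,
    forall j, (k - r < j <= k)%N -> genT r k j *m FT = e j &
    forall j, (k - r <= j <= k)%N -> genB r k j *m FB = g j].
Proof.
move=> hX rk [h1 h2].
have [||FT [FB [M g1 g2 ev ew]]] := @cell_mack k r rk k X 0 e g hX.
- move=> j hj; case: (h1 j hj) => ? ? _; split=> //.
  by rewrite (_ : _ + 0 = j%:Z) //; lia.
- move=> j hj; rewrite (_ : _ + 0 = j%:Z) //; last by lia.
  by case: (h2 j hj).
exists FT, FB; split=> //; split=> //; try by case: M.
have mX := mack_d hX; have mc := mack_d (cpx_cell k r).
apply: (cell_ext rk); [exact: mackM mc M|exact: mackM M mX| |].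
  move=> j hj; case: (h1 j hj) => _ _ e3.
  rewrite !mulmxA (cell_dT rk k hj) ev // e3.
  by case: M => _ M _; rewrite -[LHS]mulmxA M mulmxA ew //; lia.
rewrite !mulmxA (@cell_dB k r rk k (k - r)%N); last by lia.
rewrite mul0mx ew; last by lia.
by case: (h2 (k - r)%N) => //; lia.
Qed.

Lemma cell_coordB k r z y : (r <= k)%N -> hd (gB (cell k r)) z y ->
  y = 0 \/ exists j : nat, [/\ z = j%:Z, (k - r <= j <= k)%N & y = genB r k j].
Proof.
move=> rk /hd_shift hy.
have [/existsP[c /eqP ec]|/existsPn h] := boolP [exists c : 'I_r.+1,
    0 - c%:Z == z - k%:Z].
  rewrite -ec in hy; case: (chain_coordB (s := cell_seq r) (c := c) _ hy) => [|x ->].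
    by rewrite cell_seq_size.
  case: (F2P x) => ->; rewrite ?scale0r ?scale1r; [by left|right].
  exists (k - c)%N; split; [by have := ltn_ord c; lia|by have := ltn_ord c; lia|].
  by rewrite /genB; congr chw; have := ltn_ord c; lia.
left; apply: (chain_deg0B (s := cell_seq r) hy) => c; rewrite cell_seq_size => h'.
exact: (h (Ordinal h')).
Qed.

Lemma cell_coordT k r z x : (r <= k)%N -> hd (gT (cell k r)) z x ->
  x = 0 \/ exists j : nat, [/\ z = j%:Z, (k - r <= j <= k)%N &
    exists a b, x = (if (k - r < j)%N then a else 0) *: genT r k j +
      b *: (genB r k j *m ps (cell k r))].
Proof.
move=> rk /hd_shift hy.
have [/existsP[c /eqP ec]|/existsPn h] := boolP [exists c : 'I_r.+1,
    0 - c%:Z == z - k%:Z].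
  rewrite -ec in hy; case: (chain_coordT (s := cell_seq r) (c := c) _ hy) => [|a [b ->]].
    by rewrite cell_seq_size.
  right; exists (k - c)%N; split.
  - by have := ltn_ord c; lia.
  - by have := ltn_ord c; lia.
  exists a, b; rewrite /genB /genT (_ : k - (k - c) = c)%N;
    last by have := ltn_ord c; lia.
  rewrite cell_seq_nth (_ : (k - r < k - c)%N = (c < r)%N) //.
  by have := ltn_ord c; lia.
left; apply: (chain_deg0T (s := cell_seq r) hy) => c; rewrite cell_seq_size => h'.
exact: (h (Ordinal h')).
Qed.

Lemma genB_neq0 k r j : (k - r <= j <= k)%N -> genB r k j != 0.
Proof. by move=> h; apply: chw_neq0; rewrite cell_seq_size; lia. Qed.

Lemma genB_ps_neq0 k r j : (k - r <= j <= k)%N ->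
  genB r k j *m ps (cell k r) != 0.
Proof. by move=> h; apply: (@chw_ps_neq0 _ 0); rewrite cell_seq_size; lia. Qed.

(** In one degree an element has the form [a e_j + b p^* g_j]. The second term is a cycle, while
    [e_j] has the nonzero boundary [p^* g_(j-1)], so [a = 0]. *)
Lemma cell_cycle k r z x : (r <= k)%N -> hd (gT (cell k r)) z x ->
  x *m dT (cell k r) = 0 ->
  x = 0 \/ exists j : nat, [/\ z = j%:Z, (k - r <= j <= k)%N &
    x = genB r k j *m ps (cell k r)].
Proof.
move=> rk hx dx; case: (cell_coordT rk hx) => [|[j [zj hj [a [b e]]]]]; first by left.
have [_ hd2] := cpx_cell k r.
suff e0 : (if (k - r < j)%N then a else 0) = 0.
  move: e; rewrite e0 scale0r add0r; case: (F2P b) => ->.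
    by rewrite scale0r; left.
  by rewrite scale1r => e; right; exists j.
case: ifP => // h; move: dx; rewrite e h mulmxDl -!scalemxAl.
have pd : ps (cell k r) *m dT (cell k r) = dB (cell k r) *m ps (cell k r).
  by case: (cpx_cell k r) => _ _ [].
rewrite -mulmxA pd mulmxA (cell_dB rk k hj) mul0mx scaler0 addr0.
rewrite (@cell_dT k r rk k j); last by lia.
case: (F2P a) => -> //; rewrite scale1r => /eqP h'.
by move: h'; rewrite (negPf (@genB_ps_neq0 k r j.-1 _)) //; lia.
Qed.

(** * Attaching a cell whose bottom generator maps to zero *)

Fixpoint All T (p : T -> Prop) (l : seq T) : Prop :=
  if l is x :: l' then p x /\ All p l' else True.

Lemma All_cat T (p : T -> Prop) l1 l2 : All p (l1 ++ l2) <-> All p l1 /\ All p l2.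
Proof. by elim: l1 => /= [|x l1 IH]; tauto. Qed.

Lemma All_map T U (p : U -> Prop) (h : T -> U) l :
  All p (map h l) <-> All (fun x => p (h x)) l.
Proof. by elim: l => //= x l ->. Qed.

Lemma All_imp T (p q : T -> Prop) l : (forall x, p x -> q x) -> All p l -> All q l.
Proof. by move=> h; elim: l => //= x l IH [/h ? /IH]. Qed.

Lemma max_split T (m : T -> nat) l : (0 < size l)%N ->
  exists l1 x l2, l = l1 ++ x :: l2 /\ All (fun y => (m y <= m x)%N) l.
Proof.
elim: l => //= y l IH _; case: l IH => [|y' l] IH; first by exists [::], y, [::].
have [//|l1 [x [l2 [e h]]]] := IH.
have [le|lt] := leqP (m y) (m x).
  by exists (y :: l1), x, l2; rewrite e /= -e.
exists [::], y, (y' :: l); split=> //; split=> //.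
by apply: All_imp h => z hz; apply: leq_trans hz (ltnW lt).
Qed.

Record sdata (X : cpx) := SD {sk : nat; sf : nat;
  se : nat -> 'rV[F2]_(nT X); sg : nat -> 'rV[F2]_(nB X)}.

Definition good X M (s : sdata X) :=
  strand X (sk s) (sf s) (se s) (sg s) /\ (sf s <= sk s <= M)%N.

(** Of the bullet-level generators only the bottom one is listed: those above it are [p_*] of the
    Theta-level ones. *)
Definition contains X P Q (s : sdata X) : Prop :=
  (forall j, (sf s < j <= sk s)%N -> P (se s j)) /\ Q (sg s (sf s)).

Definition ht X (s : sdata X) := (sk s - sf s)%N.

(** After normalization this is, up to [p^*], the part of the differential of the new cell that
    leads to the strands: it hits only their bottoms, each in its own degree. *)
Definition theta X (L : seq (sdata X)) (i : nat) :=
  \sum_(s <- L | sf s == i) sg s (sf s).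

Lemma theta_hd X M (L : seq (sdata X)) i : All (good M) L ->
  hd (gB X) i%:Z (theta L i) /\ theta L i *m dB X = 0.
Proof.
rewrite /theta; elim: L => [_|s L IH [[[_ s2] s3] /IH[h1 h2]]].
  by rewrite big_nil; split; [exact: hd0|rewrite mul0mx].
rewrite big_cons; case: eqP => // e.
have [|h3 h4] := s2 (sf s); first by rewrite leqnn; case/andP: s3.
by split; [apply: hdD => //; rewrite -e|rewrite mulmxDl h4 h2 addr0].
Qed.

Lemma theta_in X P Q (L : seq (sdata X)) i : msub P Q ->
  All (contains P Q) L -> Q (theta L i).
Proof.
rewrite /theta => [[_ [Q0 QD _ _]]]; elim: L => [_|s L IH /= [[_ hq0] /IH h]].
  by rewrite big_nil.
by rewrite big_cons; case: ifP => // _; apply: QD.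
Qed.

Lemma theta_split X (L1 L2 : seq (sdata X)) s i :
  theta (L1 ++ s :: L2) i =
  (if sf s == i then sg s (sf s) else 0) + theta (L1 ++ L2) i.
Proof.
rewrite /theta !big_cat big_cons /=; case: ifP => _; last by rewrite add0r.
by rewrite addrCA.
Qed.

Lemma theta_max X (L : seq (sdata X)) i :
  All (fun s => sf s < i)%N L -> theta L i = 0.
Proof.
rewrite /theta; elim: L => [|s L IH /= [h /IH e]]; first by rewrite big_nil.
by rewrite big_cons e ltn_eqF.
Qed.

(* [L] lists the strands hit by the new cell. If [T] in [L] has maximal bottom
   degree [f], then above [f] the new cell becomes a strand ending at the bottom
   of [T] (or [T] does so itself, if its top is higher), while the sum of the
   two continues as a new cell which no longer hits [T]. *)
Lemma kronholm_shift X M n : forall (L R : seq (sdata X)) a b E G,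
  size L = n -> (b <= a <= M)%N ->
  (forall j, (b < j <= a)%N -> [/\ hd (gT X) j%:Z (E j), E j *m pl X = G j &
     E j *m dT X = (G j.-1 + theta L j.-1) *m ps X]) ->
  (forall j, (b <= j <= a)%N -> hd (gB X) j%:Z (G j) /\ G j *m dB X = 0) ->
  All (good M) L -> All (fun s => b <= sf s)%N L -> All (good M) R ->
  (forall P Q, @msub X P Q -> All (contains P Q) L -> All (contains P Q) R ->
    (forall j, (b < j <= a)%N -> P (E j)) -> Q (G b) ->
    (forall x, P x) /\ (forall y, Q y)) ->
  exists R', [/\ All (good M) R', size R' = (size L + size R).+1,
    (\sum_(s <- R') ht s = (a - b) + \sum_(s <- L) ht s + \sum_(s <- R) ht s)%N &
    forall P Q, @msub X P Q -> All (contains P Q) R' ->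
      (forall x, P x) /\ (forall y, Q y)].
Proof.
elim: n => [|n IH] L R a b E G.
  case: L => // _ ba hE hG _ _ gR span.
  exists (SD a b E G :: R); split.
  - do 2!split=> //; split=> // j /hE[? ? ->].
    by rewrite /theta big_nil addr0.
  - by [].
  - by rewrite big_cons big_nil addn0.
  - by move=> P Q PQ /= [[h1 h2] h3]; apply: span.
move=> sL ba hE hG gL bL gR span.
have [|L1 [T [L2 [eL maxL]]]] := @max_split _ (@sf X) L; first by rewrite sL.
set k := sk T; set f := sf T.
have [gL' bL' sL'] : [/\ All (good M) (L1 ++ L2),
    All (fun s => b <= sf s)%N (L1 ++ L2) & size (L1 ++ L2) = n].
  move: gL bL sL; rewrite eL !size_cat /= => /All_cat[h1 [_ h2]].
  move=> /All_cat[h3 [_ h4]] h5.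
  by split; [apply/All_cat|apply/All_cat|move: h5; rewrite addnS => [[]]].
have [[[T1 T2] /andP[fk kM]] bf] : good M T /\ (b <= f)%N.
  by move: gL bL; rewrite eL => /All_cat[_ [h _]] /All_cat[_ [h' _]].
rewrite -/k -/f in T1 T2 fk kM.
have th i : theta L i = (if f == i then sg T f else 0) + theta (L1 ++ L2) i.
  by rewrite eL theta_split.
have th0 i : (f < i)%N -> theta L i = 0.
  move=> h; apply: theta_max; apply: All_imp maxL => s hq0.
  exact: leq_ltn_trans hq0 h.
have th0' i : (f < i)%N -> theta (L1 ++ L2) i = 0.
  by move=> h; move: (th i); rewrite th0 // ltn_eqF // add0r => <-.
(* Above [f] the strand [T] is added to the cell. In degree [f + 1] its boundary contributes [p^*]
   of the bottom of [T] and so cancels the term of [T] in [theta L f]; from degree [f] downwards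
   nothing changes. *)
pose E' j := if (f < j)%N then E j + se T j else E j.
pose G' j := if (f < j)%N then G j + sg T j else G j.
have hE' j : (b < j <= a)%N -> (j <= k)%N ->
  [/\ hd (gT X) j%:Z (E' j), E' j *m pl X = G' j &
     E' j *m dT X = (G' j.-1 + theta (L1 ++ L2) j.-1) *m ps X].
  move=> hj jk; have [h1 h2 h3] := hE j hj; rewrite /E' /G'.
  case: ltnP => fj; last first.
    have -> : (f < j.-1)%N = false by lia.
    split=> //; rewrite h3 th; case: eqP => [e|_]; first by lia.
    by rewrite add0r.
  have [|t1 t2 t3] := T1 j; first by lia.
  split; [exact: hdD|by rewrite mulmxDl h2 t2|].
  rewrite [LHS]mulmxDl h3 t3 -[LHS]mulmxDl; congr (_ *m _).
  have [h|h] := ltnP f j.-1; first by rewrite th0 // th0' // !addr0.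
  have -> : j.-1 = f by lia.
  by rewrite th eqxx (addrC (sg T f)) addrA addmmK.
have hG' j : (b <= j <= a)%N -> (j <= k)%N ->
    hd (gB X) j%:Z (G' j) /\ G' j *m dB X = 0.
  move=> hj jk; have [h1 h2] := hG j hj; rewrite /G'; case: ltnP => fj //.
  have [|t1 t2] := T2 j; first by lia.
  by split; [exact: hdD|rewrite mulmxDl h2 t2 addr0].
have cnt : (\sum_(s <- L) ht s = (k - f) + \sum_(s <- L1 ++ L2) ht s)%N.
  by rewrite eL !big_cat big_cons /= addnCA.
have spanL P Q : msub P Q -> All (contains P Q) (L1 ++ L2) -> contains P Q T ->
    All (contains P Q) L.
  by rewrite eL => _ /All_cat[h1 h2] h3; apply/All_cat.
have szL : size L = n.+1 by [].
(* The sum of cell and strand has generators only up to the lower of the two tops, so the one with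
   the higher top, or the cell in case of a tie, is kept as a finished strand. *)
have [ka|ak] := leqP k a.
(* The new bottom collects all that the boundary of [E f.+1] hits. In degrees above [f] [theta L] is
   zero by maximality of [f], so there the cell already satisfies the relations of a strand. *)
- pose g1 j := if j == f then G f + theta L f else G j.
  have gS : good M (SD a f E g1).
    split=> /=; last by lia.
    split=> j hj; rewrite /g1.
      have [|h1 h2 h3] := hE j; first by lia.
      split=> //; first by have -> : (j == f) = false by lia.
      rewrite h3; case: eqP => [->//|ne].
      by rewrite th0 ?addr0 //; lia.
    case: eqP => [->|_]; last by apply: hG; lia.
    have [|h1 h2] := hG f; first by lia.
    have [h3 h4] := theta_hd f gL.
    by split; [exact: hdD|rewrite mulmxDl h2 h4 addr0].
  have [||||||| R' [r1 r2 r3 r4]] := IH (L1 ++ L2) (SD a f E g1 :: R) k b E' G' sL'.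
  - lia.
  - by move=> j hj; apply: hE'; lia.
  - by move=> j hj; apply: hG'; lia.
  - exact: gL'.
  - exact: bL'.
  - by [].
  - move=> P Q PQ hL' [[/= s1 s2] hR] hP hQ.
    have [[P0 PD Pt] [Q0 QD Qp Pq]] := PQ.
    have PE j : (b < j <= a)%N -> P (E j).
      move=> hj; have [fj|jf] := ltnP f j; first by apply: s1; lia.
      by have := hP j; rewrite /E' (_ : (f < j)%N = false); [apply|]; lia.
    have Qb : Q (G b) by move: hQ; rewrite /G' ltnNge bf.
    apply: span => //; apply: spanL => //; split=> [j|].
      rewrite -/f -/k => hj; rewrite -[se T j](addmKm (se T j) (E j)).
      apply: PD; first by apply: PE; lia.
      by have := hP j; rewrite /E'; case: (ltnP f j) => [_|]; [apply|]; lia.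
    (* The bottom of [T] is recovered from the new bottom by adding [G f] and the remaining bottoms
       in degree [f]. [G f] itself is [p_*] of [E f], or the bottom of the cell when [f = b]. *)
    rewrite -/f; move: s2; rewrite /g1 eqxx th eqxx => s2.
    have Qf : Q (G f).
      have [->//|ne] := eqVneq f b.
      have [|_ <- _] := hE f; first by lia.
      by apply: Pq; apply: PE; lia.
    have -> : sg T f = G f + (G f + (sg T f + theta (L1 ++ L2) f)) +
        theta (L1 ++ L2) f by rewrite addmKm addmmK.
    by apply: (QD); [apply: (QD)|apply: theta_in PQ hL'].
  exists R'; split=> //.
  + by rewrite r2 /= sL' szL; lia.
  + by rewrite r3 big_cons cnt -[ht (SD _ _ _ _)]/(a - f)%N; lia.
- have [|||||| R' [r1 r2 r3 r4]] := IH (L1 ++ L2) (T :: R) a b E' G' sL' ba.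
  - by move=> j hj; apply: hE'; lia.
  - by move=> j hj; apply: hG'; lia.
  - exact: gL'.
  - exact: bL'.
  - by split=> //; split=> //; rewrite -/k -/f fk.
  - move=> P Q PQ hL' [hT hR] hP hQ.
    have [[P0 PD Pt] _] := PQ.
    apply: span => //; first exact: spanL.
      move=> j hj; have := hP j hj; rewrite /E'; case: ltnP => // fj h.
      rewrite -[E j](addmmK (E j) (se T j)); apply: PD => //.
      by case: hT => hT _; apply: hT; rewrite -/f -/k; lia.
    by move: hQ; rewrite /G' ltnNge bf.
  exists R'; split=> //.
  + by rewrite r2 /= sL' szL; lia.
  + by rewrite r3 big_cons cnt -[ht T]/(k - f)%N; lia.
Qed.

(** The degree-preserving part [G'] of [G] is still a left inverse of [F], hence equal to [G]. *)
Lemma homog_inv m n (g1 : 'I_m -> int) (g2 : 'I_n -> int) F G :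
  homog g1 g2 0 F -> F *m G = 1%:M -> G *m F = 1%:M -> homog g2 g1 0 G.
Proof.
move=> hF FG GF.
pose G' := \matrix_(i < n, j < m) if g1 j == g2 i then G i j else 0.
have e : G' *m F = 1%:M.
  apply/matrixP => i k; rewrite !mxE -[RHS]/((i == k)%:R).
  transitivity (if g2 k == g2 i then (1%:M : 'M[F2]_n) i k else 0); last first.
    by rewrite mxE; case: (eqVneq i k) => [->|_]; rewrite ?eqxx ?if_same.
  rewrite -GF mxE; case: ifP => hk.
    apply: eq_bigr => j _; rewrite mxE.
    case: (eqVneq (F j k) 0) => [->|/hF ek]; first by rewrite !mulr0.
    by rewrite -[g1 j]addr0 -ek hk.
  apply: big1 => j _; rewrite mxE.
  case: (eqVneq (F j k) 0) => [->|/hF ek]; first by rewrite mulr0.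
  by rewrite -[g1 j]addr0 -ek hk mul0r.
have <- : G' = G by rewrite -[G']mulmx1 -FG mulmxA e mul1mx.
by move=> i j; rewrite mxE addr0; case: (eqVneq (g1 j) (g2 i)).
Qed.

(** Each F contributes dimensions 2 and 1 at the two levels, the bottom H contributes 1 and 1. *)
Lemma cell_size k r : nT (cell k r) = (2 * r).+1 /\ nB (cell k r) = r.+1.
Proof.
split; last exact: cell_seq_size.
rewrite /= -/(cell_seq r) /cdesc size_flatten /shape -map_comp sumnE big_map cell_seq_size.
have -> : iota 0 r.+1 = index_iota 0 r.+1 by rewrite /index_iota subn0.
rewrite big_nat_recr //= cell_seq_nth ltnn /=.
rewrite (eq_big_nat _ _ (F2 := fun=> 2)) => [|c cr].
  by rewrite sum_nat_const_nat subn0 addn1 mulnC.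
by rewrite /= cell_seq_nth; case/andP: cr => _ ->.
Qed.

Definition cells (ss : seq (nat * nat)) : cpx :=
  bigsum [seq cell kr.1 kr.2 | kr <- ss].

Lemma cpx_cells ss : is_cpx (cells ss).
Proof.
by apply: cpx_bigsum; elim: ss => //= kr ss IH; split=> //; apply: cpx_cell.
Qed.

Definition lab X (s : sdata X) := (sk s, ht s).

Lemma cells_size X (R : seq (sdata X)) :
  nT (cells (map (@lab X) R)) = (2 * \sum_(s <- R) ht s + size R)%N /\
  nB (cells (map (@lab X) R)) = (\sum_(s <- R) ht s + size R)%N.
Proof.
elim: R => [|s R [IH1 IH2]]; first by rewrite big_nil.
have [c1 c2] := cell_size (sk s) (ht s).
rewrite big_cons; split.
  rewrite -[LHS]/(nT (cell (sk s) (ht s)) + nT (cells (map (@lab X) R)))%N.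
  by rewrite c1 IH1 /=; lia.
rewrite -[LHS]/(nB (cell (sk s) (ht s)) + nB (cells (map (@lab X) R)))%N.
by rewrite c2 IH2 /=; lia.
Qed.

Lemma msub_im A X FT FB : @mack A X FT FB ->
  @msub X (fun x => exists u, u *m FT = x) (fun y => exists u, u *m FB = y).
Proof.
case=> m1 m2 m3; split; split.
- by exists 0; rewrite mul0mx.
- by move=> _ _ [u <-] [v <-]; exists (u + v); rewrite mulmxDl.
- by move=> _ [u <-]; exists (u *m tT A); rewrite -!mulmxA m1.
- by exists 0; rewrite mul0mx.
- by move=> _ _ [u <-] [v <-]; exists (u + v); rewrite mulmxDl.
- by move=> _ [u <-]; exists (u *m ps A); rewrite -!mulmxA m2.
- by move=> _ [u <-]; exists (u *m pl A); rewrite -!mulmxA m3.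
Qed.

Lemma cells_map X M (R : seq (sdata X)) : is_cpx X -> All (good M) R ->
  exists FT FB, is_cmap (cells (map (@lab X) R)) X FT FB /\
    All (contains (fun x => exists u, u *m FT = x)
      (fun y => exists u, u *m FB = y)) R.
Proof.
move=> hX; elim: R => [_|s R IH /= [[gs lt] /IH[FT [FB [f im]]]]].
  by exists 0, 0; split=> //; apply: cmap0.
have sf_ : (sk s - ht s)%N = sf s by rewrite /ht; lia.
have [||GT [GB [g g1 g2]]] := @strand_map (sk s) (ht s) X (se s) (sg s) hX.
- by rewrite /ht; lia.
- by rewrite sf_.
exists (col_mx GT FT), (col_mx GB FB); split; first exact: cmap_col.
rewrite sf_ in g1 g2; split.
  split=> [j hj|].
    by exists (row_mx (genT (ht s) (sk s) j) 0);
      rewrite mul_row_col mul0mx addr0; apply: g1.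
  exists (row_mx (genB (ht s) (sk s) (sf s)) 0).
  by rewrite mul_row_col mul0mx addr0; apply: g2; lia.
apply: All_imp im => s' [h1 [v h2]]; split=> [j /h1[u hu]|].
  by exists (row_mx 0 u); rewrite mul_row_col mul0mx add0r.
by exists (row_mx 0 v); rewrite mul_row_col mul0mx add0r.
Qed.

Lemma square_inv m n (F : 'M[F2]_(m, n)) : m = n ->
  (forall x : 'rV_n, exists u, u *m F = x) ->
  exists G, F *m G = 1%:M /\ G *m F = 1%:M.
Proof.
move=> mn h.
have full : row_full F.
  rewrite -sub1mx; apply/row_subP => i; have [u <-] := h (row i 1%:M).
  exact: submxMl.
have free : row_free F.
  by rewrite /row_free (eqP full) mn.
have [G FG] := row_freeP free; have [G' GF] := row_fullP full.
by exists G; split=> //; rewrite -[G]mul1mx -GF -mulmxA FG mulmx1.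
Qed.

(** Generating strands give a surjection from the sum of cells, and equality of dimensions makes it
    invertible at both levels. For this purpose [kronholm_shift] keeps track of the number of
    strands and of their total height. *)
Lemma ciso_cells X M (R : seq (sdata X)) : is_cpx X -> All (good M) R ->
  (forall P Q, @msub X P Q -> All (contains P Q) R ->
      (forall x, P x) /\ (forall y, Q y)) ->
  nT X = (2 * \sum_(s <- R) ht s + size R)%N ->
  nB X = (\sum_(s <- R) ht s + size R)%N ->
  ciso X (cells (map (@lab X) R)).
Proof.
move=> hX gR span eqT eqB.
have [FT [FB [f im]]] := cells_map hX gR.
have [imT imB] := span _ _ (msub_im (cmap_mack f)) im.
have [s1 s2] := cells_size R.
have [GT [e1 e2]] := square_inv (etrans s1 (esym eqT)) imT.
have [GB [e3 e4]] := square_inv (etrans s2 (esym eqB)) imB.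
apply: ciso_sym; exists FT, FB, GT, GB; split=> //.
by case: (f) => [[h1 h2] _ _ _ _]; apply: (cmap_inv f) => //;
  [apply: homog_inv h1 _ _|apply: homog_inv h2 _ _].
Qed.

(** * Normalizing the differential of a new cell *)

Lemma strand_cmap X Z FT FB k f e g : is_cmap X Z FT FB -> strand X k f e g ->
  strand Z k f (fun j => e j *m FT) (fun j => g j *m FB).
Proof.
case=> [[h1 h2] h3 h4 h5 [h6 h7]] [s1 s2]; split=> j hj.
  have [t1 t2 t3] := s1 j hj; split.
  - by have := hd_mul h1 t1; rewrite addr0.
  - by rewrite -mulmxA -h5 mulmxA t2.
  - by rewrite -mulmxA -h6 mulmxA t3 -!mulmxA h4.
have [t1 t2] := s2 j hj; split; first by have := hd_mul h2 t1; rewrite addr0.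
by rewrite -mulmxA -h7 mulmxA t2 mul0mx.
Qed.

Definition emb X Z (FT : 'M[F2]_(nT X, nT Z)) (FB : 'M[F2]_(nB X, nB Z)) s :=
  SD (sk s) (sf s) (fun j => se s j *m FT) (fun j => sg s j *m FB).

Lemma good_emb X Z FT FB M L : is_cmap X Z FT FB -> All (@good X M) L ->
  All (good M) (map (emb FT FB) L).
Proof.
move=> f h; apply/All_map; apply: All_imp h => s [h1 h2]; split=> //.
exact: strand_cmap f h1.
Qed.

Lemma theta_emb X Z (FT : 'M[F2]_(nT X, nT Z)) (FB : 'M[F2]_(nB X, nB Z)) L i :
  theta (map (emb FT FB) L) i = theta L i *m FB.
Proof. by rewrite /theta big_map mulmx_suml. Qed.

Lemma ht_emb X Z (FT : 'M[F2]_(nT X, nT Z)) (FB : 'M[F2]_(nB X, nB Z)) L :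
  (\sum_(s <- map (emb FT FB) L) ht s = \sum_(s <- L) ht s)%N.
Proof. by rewrite big_map. Qed.

Lemma msub_pull A X FT FB P Q : @mack A X FT FB -> @msub X P Q ->
  @msub A (fun x => P (x *m FT)) (fun y => Q (y *m FB)).
Proof.
case=> m1 m2 m3 [[P0 PD Pt] [Q0 QD Qp Pq]]; split; split.
- by rewrite mul0mx.
- by move=> x y hx hy; rewrite mulmxDl; apply: PD.
- by move=> x hx; rewrite -mulmxA m1 mulmxA; apply: Pt.
- by rewrite mul0mx.
- by move=> x y hx hy; rewrite mulmxDl; apply: QD.
- by move=> x hx; rewrite -mulmxA m2 mulmxA; apply: Qp.
- by move=> x hx; rewrite -mulmxA m3 mulmxA; apply: Pq.
Qed.

(** Each [x j] is 0 or [p^* g_(j-1)], which is also the boundary of [e_j] in the strand. Correcting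
    the generators of the new cell by [c j] times those of the strand, with [c (j-1) = be j + c j],
    pushes these terms downwards. The process stops at the bottom [f], since no element there has
    [p_*] equal to [g_f]; [ga] records whether a term is left over. *)
Lemma cell_normalize k r a b (x : nat -> 'rV[F2]_(nT (cell k r))) :
  (r <= k)%N ->
  (forall j, (b < j <= a)%N ->
     hd (gT (cell k r)) (j%:Z - 1) (x j) /\ x j *m dT (cell k r) = 0) ->
  exists sg_ tau (ga : bool),
   [/\ forall j, (b < j <= a)%N -> [/\ hd (gT (cell k r)) j%:Z (sg_ j),
         sg_ j *m pl (cell k r) = tau j &
         x j + sg_ j *m dT (cell k r) = (tau j.-1 +
           (if ga && (k - r == j.-1)%N then genB r k (k - r) else 0)) *m
           ps (cell k r)],
       forall j, (b <= j <= a)%N -> hd (gB (cell k r)) j%:Z (tau j) /\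
         tau j *m dB (cell k r) = 0 & ga -> (b <= k - r)%N].
Proof.
move=> rk hx; set f := (k - r)%N.
pose be j : F2 := (x j != 0)%:R.
pose c j : F2 := \sum_(j.+1 <= i < a.+1) be i.
have xE j : (b < j <= a)%N -> x j = be j *: (genB r k j.-1 *m ps (cell k r)) /\
    (be j = 0 \/ (f <= j.-1 <= k)%N).
  move=> hj; have [h1 h2] := hx j hj; rewrite /be.
  case: (eqVneq (x j) 0) => [->|ne]; first by rewrite scale0r; split=> //; left.
  case: (cell_cycle rk h1 h2) => [e|[i [e1 e2 e3]]]; first by rewrite e eqxx in ne.
  have -> : j.-1 = i by lia.
  by rewrite scale1r; split=> //; right.
have cS j : (b < j <= a)%N -> c j.-1 = be j + c j.
  by move=> hj; rewrite /c prednK; [rewrite big_ltn //; lia|lia].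
have c0 j : (b <= j)%N -> (k < j)%N -> c j = 0.
  move=> bj kj; rewrite /c big_nat_cond big1 // => i /andP[hi _].
  by case: (xE i) => [|_ []] //; lia.
have [s1 s2] := strand_cell rk; rewrite -/f in s1 s2.
pose ins j := (f < j <= k)%N.
exists (fun j => if ins j then c j *: genT r k j else 0).
exists (fun j => if ins j then c j *: genB r k j else 0).
(* For [f < b] the sum [c f] also runs over indices up to [b], where [x] is unconstrained, so its
   value must then be ignored. *)
exists ((c f != 0) && (b <= f)%N); split; last by case/andP.
- move=> j hj; have [xj bj] := xE j hj; split.
  + case: ifP => h; last exact: hd0.
    by apply: hdZ; case: (s1 j h).
  + case: ifP => h; last by rewrite mul0mx.
    by case: (s1 j h) => _ h' _; rewrite -scalemxAl h'.
  rewrite {1}xj.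
  have -> : (if ins j then c j *: genT r k j else 0) *m dT (cell k r) =
     (if ins j then c j else 0) *: (genB r k j.-1 *m ps (cell k r)).
    case: ifP => h; last by rewrite mul0mx scale0r.
    by case: (s1 j h) => _ _ h'; rewrite -scalemxAl h'.
  rewrite -scalerDl scalemxAl; congr (_ *m _).
  have [i e] : exists i, j = i.+1 by exists j.-1; lia.
  have cSj := cS j hj; have c0j := c0 j; rewrite e /= in hj bj cSj c0j *.
  have [if_|fi|ei] := ltngtP i f.
  + have -> : ins i = false by rewrite /ins; lia.
    have -> : ins i.+1 = false by rewrite /ins; lia.
    by case: bj => [->|]; [rewrite andbF !addr0 scale0r|lia].
  + rewrite andbF addr0 /ins fi (ltnW fi : f < i.+1)%N /=.
    have [ik|ki] := leqP i k.
      rewrite cSj; congr (_ *: _); congr (_ + _).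
      by case: ifP => h //; rewrite c0j //; lia.
    have -> : (i < k)%N = false by lia.
    by case: bj => [->|]; [rewrite addr0 scale0r|lia].
  + have -> : ins i = false by rewrite /ins; lia.
    rewrite ei ?eqxx ?andbT add0r.
    have -> : be f.+1 + (if ins f.+1 then c f.+1 else 0) = c f.
      rewrite -ei cSj; congr (_ + _); case: ifP => // h.
      by rewrite c0j //; move: h; rewrite /ins; lia.
    rewrite (_ : (b <= f)%N) ?andbT; last by lia.
    by case: (F2P (c f)) => ->; rewrite ?eqxx ?oner_eq0 ?scale0r ?scale1r.
- move=> j hj; case: ifP => h; last by split; [exact: hd0|rewrite mul0mx].
  case: (s2 j); first by move: h; rewrite /ins; lia.
  by move=> h1 h2; split; [exact: hdZ|rewrite -scalemxAl h2 scaler0].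
Qed.

Definition okc (M : nat) (kr : nat * nat) := (kr.2 <= kr.1 <= M)%N.

(** Each summand is normalized separately; its strand goes to [L] if a term is left over at its
    bottom, and to [R] otherwise. *)
Lemma cells_normalize M ss a b : all (okc M) ss ->
  forall x : nat -> 'rV[F2]_(nT (cells ss)),
  (forall j, (b < j <= a)%N ->
     hd (gT (cells ss)) (j%:Z - 1) (x j) /\ x j *m dT (cells ss) = 0) ->
  exists L R sg_ tau,
   [/\ All (good M) L /\ All (good M) R, All (fun s => b <= sf s)%N L,
       forall P Q, @msub (cells ss) P Q -> All (contains P Q) L ->
         All (contains P Q) R -> (forall x, P x) /\ (forall y, Q y),
       (forall j, (b < j <= a)%N -> [/\ hd (gT (cells ss)) j%:Z (sg_ j),
         sg_ j *m pl (cells ss) = tau j &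
         x j + sg_ j *m dT (cells ss) =
           (tau j.-1 + theta L j.-1) *m ps (cells ss)]) &
       forall j, (b <= j <= a)%N -> hd (gB (cells ss)) j%:Z (tau j) /\
         tau j *m dB (cells ss) = 0] /\
   (size L + size R = size ss /\
    \sum_(s <- L) ht s + \sum_(s <- R) ht s = \sum_(kr <- ss) kr.2)%N.
Proof.
elim: ss => [_ x hx|[k r] ss IH okss x hx].
  exists [::], [::], (fun=> 0), (fun=> 0); split; last by rewrite !big_nil.
  split=> //.
  - move=> P Q [[P0 _ _] [Q0 _ _ _]] _ _.
    have z n (y : 'rV[F2]_n) : n = 0%N -> y = 0.
      by move=> e; apply/rowP => i; have := ltn_ord i; rewrite {2}e.
    by split=> y; rewrite (z _ y).
  - move=> j _; split; [exact: hd0|by rewrite mul0mx|].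
    by apply/matrixP => ? [].
  - by move=> j _; split; [exact: hd0|rewrite mul0mx].
have /andP[/andP[/= rk kM] hss] : okc M (k, r) && all (okc M) ss := okss.
pose T := cell k r; pose S := cells ss.
have hx1 j : (b < j <= a)%N -> hd (gT T) (j%:Z - 1) (lsubmx (x j)) /\
    lsubmx (x j) *m dT T = 0.
  move=> hj; have [h1 h2] := hx j hj; split; first exact: hd_rowl h1.
  by move: h2; rewrite -{1}[x j]hsubmxK mul_row_block !mulmx0 addr0 add0r
    -[0]row_mx0 => /row_mx_inj[].
have hx2 j : (b < j <= a)%N -> hd (gT S) (j%:Z - 1) (rsubmx (x j)) /\
    rsubmx (x j) *m dT S = 0.
  move=> hj; have [h1 h2] := hx j hj; split; first exact: hd_rowr h1.
  by move: h2; rewrite -{1}[x j]hsubmxK mul_row_block !mulmx0 addr0 add0r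
    -[0]row_mx0 => /row_mx_inj[].
have [s1 [t1 [ga [A1 A2 A3]]]] := cell_normalize rk hx1.
have [L [R [s2 [t2 [[[gL gR] bL sp B1 B2] [cnt1 cnt2]]]]]] := IH hss _ hx2.
have fl := injl T S; have fr := injr T S.
pose s0 := @emb T (dsum T S) (row_mx 1%:M 0) (row_mx 1%:M 0)
  (@SD T k (k - r) (genT r k) (genB r k)).
have gs0 : good M s0.
  by split=> /=; [apply: strand_cmap fl (strand_cell rk)|lia].
pose eL := map (@emb S (dsum T S) (row_mx 0 1%:M) (row_mx 0 1%:M)) L.
pose eR := map (@emb S (dsum T S) (row_mx 0 1%:M) (row_mx 0 1%:M)) R.
exists (if ga then s0 :: eL else eL), (if ga then eR else s0 :: eR).
exists (fun j => row_mx (s1 j) (s2 j)), (fun j => row_mx (t1 j) (t2 j)).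
have geL : All (good M) eL by apply: good_emb fr gL.
have geR : All (good M) eR by apply: good_emb fr gR.
have beL : All (fun s => b <= sf s)%N eL by apply/All_map.
split; last first.
  split; first by case: (ga); rewrite /= !size_map ?addnS ?addSn cnt1.
  have h0 : ht s0 = r by rewrite /ht /=; lia.
  case: (ga); rewrite !big_cons /eL /eR !ht_emb h0 -cnt2 /=.
    exact: esym (addnA _ _ _).
  exact: addnCA.
split.
- by case: (ga).
- by case: (ga) A3 => // h /=; split=> //; apply: h.
- move=> P Q PQ hL hR.
  have [h0 [hL' hR']] : @contains (dsum T S) P Q s0 /\
      All (@contains (dsum T S) P Q) eL /\ All (@contains (dsum T S) P Q) eR.
    by case: (ga) hL hR => /=; tauto.
  have PQ1 := msub_pull (cmap_mack fl) PQ.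
  have PQ2 := msub_pull (cmap_mack fr) PQ.
  have [u1 u2] : (forall x, P (x *m row_mx 1%:M 0)) /\
      (forall y, Q (y *m row_mx 1%:M 0)).
    by case: h0 => h1 h2; apply: (cell_span rk PQ1).
  have [u3 u4] : (forall x, P (x *m row_mx 0 1%:M)) /\
      (forall y, Q (y *m row_mx 0 1%:M)).
    by apply: (sp _ _ PQ2); [move/All_map: hL'|move/All_map: hR'].
  have [[_ PD _] [_ QD _ _]] := PQ.
  split=> y; rewrite -[y]hsubmxK.
    have := PD _ _ (u1 (lsubmx y)) (u3 (rsubmx y)).
    by rewrite !mul_mx_row !mulmx1 !mulmx0 add_row_mx addr0 add0r.
  have := QD _ _ (u2 (lsubmx y)) (u4 (rsubmx y)).
  by rewrite !mul_mx_row !mulmx1 !mulmx0 add_row_mx addr0 add0r.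
- move=> j hj; have [a1 a2 a3] := A1 j hj; have [b1 b2 b3] := B1 j hj.
  split; first exact: hd_row.
    by rewrite mul_row_block !mulmx0 addr0 add0r a2 b2.
  rewrite -{1}[x j]hsubmxK mul_row_block !mulmx0 addr0 add0r add_row_mx a3 b3.
  have -> : theta (if ga then s0 :: eL else eL) j.-1 = row_mx
      (if ga && (k - r == j.-1)%N then genB r k (k - r) else 0) (theta L j.-1).
    have e : theta eL j.-1 = row_mx 0 (theta L j.-1).
      by rewrite /eL theta_emb mul_mx_row mulmx0 mulmx1.
    case: (ga) => //=; rewrite (theta_split [::]) /= e.
    case: ifP => _; rewrite ?add0r // mul_mx_row mulmx1 mulmx0 add_row_mx.
    by rewrite addr0 add0r.
  by rewrite add_row_mx mul_row_block !mulmx0 addr0 add0r.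
- move=> j hj; have [a1 a2] := A2 j hj; have [b1 b2] := B2 j hj.
  split; first exact: hd_row.
  by rewrite mul_row_block !mulmx0 addr0 add0r a2 b2 row_mx0.
Qed.

Lemma cells_cycle M ss z x : all (okc M) ss -> hd (gT (cells ss)) z x ->
  x *m dT (cells ss) = 0 -> exists v, x = v *m ps (cells ss).
Proof.
elim: ss x => [x _ _ _|[k r] ss IH x okss].
  by exists 0; apply/matrixP => ? [].
have /andP[/andP[/= rk _] hss] : okc M (k, r) && all (okc M) ss := okss.
rewrite -[x]hsubmxK => h; rewrite mul_row_block !mulmx0 addr0 add0r.
have := hd_rowr h; have := hd_rowl h; rewrite row_mxKl row_mxKr.
rewrite -row_mx0 => h1 h2 /row_mx_inj[e1 e2].
have [v2 ->] := IH _ hss h2 e2.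
have [v1 ->] : exists v, lsubmx x = v *m ps (cell k r).
  case: (cell_cycle rk h1 e1) => [->|[j [_ _ ->]]]; last by eexists.
  by exists 0; rewrite mul0mx.
by exists (row_mx v1 v2); rewrite mul_row_block !mulmx0 addr0 add0r.
Qed.

(** This inclusion is not a chain map in general, but naturality is enough to pull back a generation
    statement along it. *)
Lemma homogl_cone A X FT FB :
  @mack A (@cone A X FT FB) (row_mx 1%:M 0) (row_mx 1%:M 0).
Proof. by split; mxb. Qed.

Lemma attach_cell m q ss FT FB : (q <= m.+1)%N -> all (okc m.+1) ss ->
  is_cmap (cell m q) (cells ss) FT FB ->
  genB q m.+1 (m.+1 - q) *m FB = 0 ->
  exists ss', all (okc m.+1) ss' /\ ciso (cone FT FB) (cells ss').
Proof.
move=> qm hss f z0.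
set a := m.+1 in qm z0 *; set b := (a - q)%N.
have hS := cpx_cells ss; have hC := cpx_cell m q.
(* Induction upwards from the bottom: the image of [e_j] is a cycle because the bullet image one
   degree lower is 0; cycles lie in the image of [p^*], and applying [p_*] then gives 0. *)
have zz j : (b <= j <= a)%N -> genB q a j *m FB = 0.
  elim: j => [|j IH] hj; first by rewrite -z0; congr (genB _ _ _ *m _); lia.
  have [<-//|ne] := eqVneq b j.+1.
  have [|h1 <- h3] := @src_x a q qm m _ erefl _ _ f j.+1; first by lia.
  have [|v ->] := cells_cycle hss h1.
    by rewrite h3 /= IH ?mul0mx //; lia.
  by case: hS => [[_ _ _ _ e] _ _]; rewrite -mulmxA e mulmx0.
pose x j := genT q a j *m FT.
have hx j : (b < j <= a)%N -> hd (gT (cells ss)) (j%:Z - 1) (x j) /\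
    x j *m dT (cells ss) = 0.
  move=> hj; have [h1 _ h3] := src_x qm (erefl _ : a = m.+1) f hj.
  by split=> //; rewrite h3 zz ?mul0mx //; lia.
have [L [R [sg_ [tau [[[gL gR] bL sp B1 B2] [c1 c2]]]]]] :=
  cells_normalize hss hx.
set Y := cone FT FB.
have hY : is_cpx Y by apply: cpx_cone.
have fr : is_cmap (cells ss) Y (row_mx 0 1%:M) (row_mx 0 1%:M).
  exact: cmap_cone_inr.
pose eL := map (@emb (cells ss) Y (row_mx 0 1%:M) (row_mx 0 1%:M)) L.
pose eR := map (@emb (cells ss) Y (row_mx 0 1%:M) (row_mx 0 1%:M)) R.
(* The first block is the generator of the new cell, the second its correction in the old strands,
   which makes the boundary end on bottoms only. *)
have [|||||||R' [r1 r2 r3 r4]] := @kronholm_shift Y a (size eL) eL eR a b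
  (fun j => row_mx (genT q a j) (sg_ j)) (fun j => row_mx (genB q a j) (tau j)) erefl.
- lia.
- move=> j hj; have [b1 b2 b3] := B1 j hj.
  split.
  + apply: hd_row => //; apply/hd_shift.
    have := @hd_cellT a q qm m j; rewrite (_ : _ - _ = j%:Z - 1); first by apply; lia.
    by rewrite /a; lia.
  + by rewrite mul_row_block !mulmx0 addr0 add0r (cell_pl qm m hj) b2.
  + rewrite mul_row_block !mulmx0 addr0 (cell_dT qm m hj) -/(x j) b3.
    rewrite theta_emb mul_mx_row mulmx0 mulmx1 add_row_mx addr0.
    by rewrite mul_row_block !mulmx0 addr0 add0r.
- move=> j hj; have [b1 b2] := B2 j hj; split.
    apply: hd_row => //; apply/hd_shift.
    have := @hd_cellB a q qm m j; rewrite (_ : _ - _ = j%:Z - 1); first by apply; lia.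
    by rewrite /a; lia.
  by rewrite mul_row_block !mulmx0 addr0 (cell_dB qm m hj) zz // b2 add0r row_mx0.
- exact: good_emb fr gL.
- by apply/All_map.
- exact: good_emb fr gR.
- move=> P Q PQ hL hR hP hQ.
  have [[_ PD _] [_ QD _ _]] := PQ.
  have PQ2 := msub_pull (cmap_mack fr) PQ.
  have [u1 u2] : (forall x, P (x *m row_mx 0 1%:M)) /\
      (forall y, Q (y *m row_mx 0 1%:M)).
    by apply: (sp _ _ PQ2); [move/All_map: hL|move/All_map: hR].
  have PQ1 := msub_pull (homogl_cone FT FB) PQ.
  have [u3 u4] : (forall x, P (x *m row_mx 1%:M 0)) /\
      (forall y, Q (y *m row_mx 1%:M 0)).
    apply: (cell_span qm PQ1) => [j hj|].
      have := PD _ _ (hP j hj) (u1 (sg_ j)).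
      by rewrite !mul_mx_row !mulmx0 !mulmx1 add_row_mx addmm addr0.
    have := QD _ _ hQ (u2 (tau b)).
    by rewrite !mul_mx_row !mulmx0 !mulmx1 add_row_mx addmm addr0.
  split=> y; rewrite -[y]hsubmxK.
    have := PD _ _ (u3 (lsubmx y)) (u1 (rsubmx y)).
    by rewrite !mul_mx_row !mulmx1 !mulmx0 add_row_mx addr0 add0r.
  have := QD _ _ (u4 (lsubmx y)) (u2 (rsubmx y)).
  by rewrite !mul_mx_row !mulmx1 !mulmx0 add_row_mx addr0 add0r.
exists (map (@lab Y) R'); split.
  apply/allP => kr; elim: R' r1 {r2 r3 r4} => //= s R' IH [[_ hq0] /IH h].
  by rewrite inE => /orP[/eqP ->|//]; rewrite /okc /= /ht; lia.
have [n1 n2] := cell_size m q.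
have [n3 n4] : nT (cells ss) = (2 * \sum_(kr <- ss) kr.2 + size ss)%N /\
    nB (cells ss) = (\sum_(kr <- ss) kr.2 + size ss)%N.
  elim: (ss) => [|[k r] l [IH1 IH2]]; first by rewrite big_nil.
  have [d1 d2] := cell_size k r; rewrite big_cons; split.
    rewrite -[LHS]/(nT (cell k r) + nT (cells l))%N d1 IH1 /=; lia.
  rewrite -[LHS]/(nB (cell k r) + nB (cells l))%N d2 IH2 /=; lia.
apply: (ciso_cells hY r1 r4).
  rewrite -[LHS]/(nT (cell m q) + nT (cells ss))%N n1 n3 r2 r3.
  by rewrite /eL /eR !ht_emb !size_map; lia.
rewrite -[LHS]/(nB (cell m q) + nB (cells ss))%N n2 n4 r2 r3.
by rewrite /eL /eR !ht_emb !size_map; lia.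
Qed.

(** * Extracting a cell and a strand *)

Definition bottom (m q : nat) := genB q m.+1 (m.+1 - q).

(* [z] is the image of the bottom generator of the summand [cell m q]. *)
Fixpoint allz m n (p : nat -> 'rV[F2]_n -> Prop) qs :
    'M[F2]_(nB (cellsum m qs), n) -> Prop :=
  match qs with
  | [::] => fun _ => True
  | q :: qs' => fun FB =>
      let G : 'M_(nB (cell m q) + nB (cellsum m qs'), n) := FB in
      p q (bottom m q *m usubmx G) /\ allz p (dsubmx G)
  end.

Lemma allz_imp m n n' p p' (G : 'M[F2]_(n, n')) qs
    (FB : 'M[F2]_(nB (cellsum m qs), n)) :
  (forall q z, p q z -> p' q (z *m G)) -> allz p FB -> allz p' (FB *m G).
Proof.
move=> h; elim: qs FB => //= q qs IH FB [h1 h2]; split.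
  have -> : usubmx (FB *m G) = usubmx (FB : 'M_(nB (cell m q) + _, _)) *m G.
    exact: esym (mul_usub_mx _ _).
  by rewrite mulmxA; apply: h.
have -> : dsubmx (FB *m G) = dsubmx (FB : 'M_(nB (cell m q) + _, _)) *m G.
  exact: esym (mul_dsub_mx _ _).
exact: IH.
Qed.

Lemma allz_w m n p p' qs (FB : 'M[F2]_(nB (cellsum m qs), n)) :
  (forall q z, p q z -> p' q z) -> allz p FB -> allz p' FB.
Proof.
move=> h h'; rewrite -[FB]mulmx1; apply: allz_imp h' => q z.
by rewrite mulmx1; apply: h.
Qed.

Lemma allz_all m n p (a : pred nat) qs (FB : 'M[F2]_(nB (cellsum m qs), n)) :
  (forall q z, a q -> p q z) -> all a qs -> allz p FB.
Proof.
move=> h; elim: qs FB => //= q qs IH FB /andP[h1 h2].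
by split; [apply: h|apply: IH].
Qed.

Lemma allz_row0 m n1 n n' (G : 'M[F2]_(n1 + n, n')) qs
    (FB : 'M[F2]_(nB (cellsum m qs), n)) :
  allz (fun _ z => z = 0) FB -> allz (fun _ z => z = 0) (row_mx 0 FB *m G).
Proof.
move=> h; have -> : row_mx 0 FB *m G = FB *m (row_mx 0 1%:M *m G).
  by rewrite mulmxA mul_mx_row mulmx0 mulmx1.
by apply: allz_imp h => _ z ->; rewrite mul0mx.
Qed.

Lemma cpx_cellsum m qs : is_cpx (cellsum m qs).
Proof.
by apply: cpx_bigsum; elim: qs => //= q qs IH; split=> //; apply: cpx_cell.
Qed.

(** Attaching one cell preserves the vanishing of the bottom images of the others: these are merely
    composed with the inclusion into the cone and with an isomorphism. *)
Lemma cone_step m qs C X Z CT CB AT AB PT PB QT QB :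
  is_cmap (@cone C X CT CB) Z PT PB -> is_cmap Z (@cone C X CT CB) QT QB ->
  PT *m QT = 1%:M -> PB *m QB = 1%:M -> QT *m PT = 1%:M -> QB *m PB = 1%:M ->
  is_cmap (cellsum m qs) X AT AB -> allz (fun _ z => z = 0) AB ->
  exists GT GB, is_cmap (cellsum m qs) Z GT GB /\
    allz (fun _ z => z = 0) GB /\
    ciso (@cone _ (@cone C X CT CB) (row_mx 0 AT) (row_mx 0 AB)) (cone GT GB).
Proof.
move=> p1 p2 e1 e2 e3 e4 fa zs.
exists ((row_mx 0 AT : 'M_(_, nT C + nT X)) *m PT).
exists ((row_mx 0 AB : 'M_(_, nB C + nB X)) *m PB).
split; last by split; [exact: allz_row0 zs|exact: ciso_cone_target p1 p2 _ _ _ _].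
have rE n1 n2 n3 (A : 'M[F2]_(n1, n3)) :
    row_mx 0 A = A *m row_mx 0 1%:M :> 'M_(n1, n2 + n3).
  by rewrite mul_mx_row mulmx0 mulmx1.
by rewrite (rE _ _ _ AT) (rE _ _ _ AB);
  exact: cmap_comp (cmap_comp fa (cmap_cone_inr CT CB)) p1.
Qed.

Lemma attach_cells m qs : forall ss FT FB,
  all (fun q => q <= m.+1)%N qs -> all (okc m.+1) ss ->
  is_cmap (cellsum m qs) (cells ss) FT FB -> allz (fun _ z => z = 0) FB ->
  exists ss', all (okc m.+1) ss' /\ qmap (cone FT FB) (cells ss').
Proof.
elim: qs => [|q qs IH] ss FT FB.
  move=> _ hss f _; exists ss; split=> //; apply: ciso_qmap.
  - exact: cpx_cone cpx_zero (cpx_cells ss) f.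
  - exact: cpx_cells.
  - exact: ciso_cone0.
move=> /andP[/= qm hqs] hss f [z0 zs].
have [fc fa] := @cmap_sub (cell m q) (cellsum m qs) _ _ _ f.
set CT := usubmx _ in fc; set CB := usubmx _ in fc z0.
set AT := dsubmx _ in fa; set AB := dsubmx _ in fa zs.
have [ss1 [hss1 [PT [PB [QT [QB [p1 p2 [e1 e2] [e3 e4]]]]]]]] :=
  attach_cell qm hss fc z0.
have i1 := ciso_cone_dsum CT CB AT AB.
rewrite -/CT -/AT vsubmxK /CB /AB vsubmxK -/CB -/AB in i1.
have [GT [GB [g [zg i2]]]] := cone_step p1 p2 e1 e2 e3 e4 fa zs.
have [ss' [h1 h2]] := IH ss1 _ _ hqs hss1 g zg.
exists ss'; split; first exact: h1.
apply: qmap_trans h2; apply: ciso_qmap.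
- exact: cpx_cone (cpx_cellsum m (q :: qs)) (cpx_cells ss) f.
- exact: cpx_cone (cpx_cellsum m qs) (cpx_cells ss1) g.
- exact: ciso_trans i1 i2.
Qed.

Lemma block_col1 m1 m2 n p (A : 'M[F2]_(n, m2)) (F : 'M[F2]_(m1 + m2, p)) :
  (block_mx 1%:M 0 0 A : 'M_(m1 + n, _)) *m F =
  col_mx (usubmx F) (A *m dsubmx F).
Proof. by rewrite -{1}[F]vsubmxK mul_block_col !mul0mx mul1mx addr0 add0r. Qed.

Lemma swap_col n1 n2 n3 p (A : 'M[F2]_(n1, p)) B C :
  col_mx (row_mx 0 (row_mx 1%:M 0))
    (col_mx (row_mx 1%:M 0) (row_mx 0 (row_mx 0 1%:M))) *m
  col_mx A (col_mx B C) = col_mx B (col_mx A C) :> 'M[F2]_(n2 + (n1 + n3), p).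
Proof. by rewrite !mul_col_mx !mul_row_col !mul0mx !mul1mx !addr0 !add0r. Qed.

(** [Q] is an upper bound for the [q] of cells with nonzero image. Either it can be lowered, or a
    cell attaining it is moved to the front; descending on [Q] thus selects a maximal [q]. *)
Lemma extract_cell m Q n qs (FB : 'M[F2]_(nB (cellsum m qs), n)) :
  allz (fun q z => z = 0 \/ (q <= Q)%N) FB ->
  allz (fun q z => z = 0 \/ (q < Q)%N) FB \/
  exists qs' PT PB QT QB, [/\
    is_cmap (dsum (cell m Q) (cellsum m qs')) (cellsum m qs) PT PB /\
    is_cmap (cellsum m qs) (dsum (cell m Q) (cellsum m qs')) QT QB,
    PT *m QT = 1%:M /\ PB *m QB = 1%:M, QT *m PT = 1%:M /\ QB *m PB = 1%:M,
    perm_eq qs (Q :: qs') &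
    exists G : 'M_(nB (cell m Q) + nB (cellsum m qs'), n), [/\ PB *m FB = G,
      bottom m Q *m usubmx G <> 0 &
      allz (fun q z => z = 0 \/ (q <= Q)%N) (dsubmx G)]].
Proof.
elim: qs FB => [|q qs IH] FB; first by left.
case=> [h1 h2].
set u := usubmx _ in h1; set d := dsubmx _ in h2.
have eF : FB = col_mx u d by rewrite /u /d vsubmxK.
case: (IH _ h2) => [hl|[qs' [PT [PB [QT [QB [[p1 p2] [e1 e2] [e3 e4] pe
    [G [eG g1 g2]]]]]]]]].
  have [e0|ne] := eqVneq (bottom m q *m u) 0; first by left; split=> //; left.
  case: h1 => [e|]; first by rewrite e eqxx in ne.
  rewrite leq_eqVlt => /orP[/eqP e|lt]; last by left; split=> //; right.
  subst Q; right; exists qs, 1%:M, 1%:M, 1%:M, 1%:M.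
  split; rewrite ?mul1mx //; try by split; exact: cmap1.
  exists (col_mx u d); rewrite col_mxKu col_mxKd; split=> //.
  by move/eqP; apply/negP.
right; exists (q :: qs').
pose sT := col_mx (row_mx 0 (row_mx 1%:M 0))
  (col_mx (row_mx 1%:M 0) (row_mx 0 (row_mx 0 1%:M))).
have s1 := ciso_swap (cell m Q) (cell m q) (cellsum m qs').
have s2 := ciso_swap (cell m q) (cell m Q) (cellsum m qs').
have b1 := cmap_block (cmap1 (cell m q)) p1.
have b2 := cmap_block (cmap1 (cell m q)) p2.
have f1 := cmap_comp s1 b1; have f2 := cmap_comp b2 s2.
match type of f1 with is_cmap _ _ ?a ?b => exists a, b end.
match type of f2 with is_cmap _ _ ?a ?b => exists a, b end.
split=> //.
- by split; apply: mulmx_cancel; [exact: swapK|exact: block1K|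
    exact: swapK|exact: block1K].
- by split; apply: mulmx_cancel; [exact: block1K|exact: swapK|
    exact: block1K|exact: swapK].
- rewrite perm_sym; apply: (perm_trans (y := q :: Q :: qs')).
    by rewrite (perm_catCA [:: Q] [:: q] qs').
  by rewrite perm_cons perm_sym.
exists (col_mx (usubmx G) (col_mx u (dsubmx G))).
rewrite col_mxKu col_mxKd; split=> //.
  rewrite -mulmxA block_col1 -/u -/d eG -{1}[G]vsubmxK.
  exact: swap_col.
split; first by rewrite col_mxKu.
by rewrite col_mxKd.
Qed.

Lemma block_swap_row n1 n2 n3 n4 (z0 : 'rV[F2]_n1) (z1 : 'rV_n4)
    (P : 'M_(n4, n2 + n3)) zT z' :
  z1 *m P = row_mx zT z' ->
  row_mx z0 z1 *m (block_mx 1%:M 0 0 P *m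
    col_mx (row_mx 0 (row_mx 1%:M 0))
      (col_mx (row_mx 1%:M 0) (row_mx 0 (row_mx 0 1%:M)))) =
  row_mx zT (row_mx z0 z').
Proof.
move=> e; rewrite mulmxA mul_row_block !mulmx0 addr0 add0r mulmx1 e.
rewrite mul_row_col mul_row_col !mul_mx_row !mulmx0 !mulmx1 !add_row_mx.
by rewrite ?row_mx0 ?addr0 ?add0r ?add_row_mx ?addr0 ?add0r.
Qed.

(** The condition on the components of [z] off the chosen strand under which the F-part of [B_r] can
    be mapped in below [z], down to degree [f]. *)
Definition liftable X (z : 'rV[F2]_(nB X)) (b f : nat) :=
  exists e g, strand X b f e g /\ g b = z.

Lemma lift0 X b f : @liftable X 0 b f.
Proof.
exists (fun=> 0), (fun=> 0); split=> //.
by split=> j _; split; rewrite ?mul0mx //; exact: hd0.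
Qed.

Lemma strand_dsum X Z k f e g e' g' : strand X k f e g -> strand Z k f e' g' ->
  strand (dsum X Z) k f (fun j => row_mx (e j) (e' j))
    (fun j => row_mx (g j) (g' j)).
Proof.
move=> [s1 s2] [s1' s2']; split=> j hj.
  have [a1 a2 a3] := s1 j hj; have [b1 b2 b3] := s1' j hj.
  split; first exact: hd_row.
    by rewrite mul_row_block !mulmx0 addr0 add0r a2 b2.
  by rewrite !mul_row_block !mulmx0 !addr0 !add0r a3 b3.
have [a1 a2] := s2 j hj; have [b1 b2] := s2' j hj.
split; first exact: hd_row.
by rewrite mul_row_block !mulmx0 addr0 add0r a2 b2 row_mx0.
Qed.

Lemma lift_dsum X Z x z b f : @liftable X x b f -> @liftable Z z b f ->
  @liftable (dsum X Z) (row_mx x z) b f.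
Proof.
move=> [e [g [s eg]]] [e' [g' [s' eg']]].
exists (fun j => row_mx (e j) (e' j)), (fun j => row_mx (g j) (g' j)).
by split; [exact: strand_dsum|rewrite eg eg'].
Qed.

Lemma lift_cmap X Z FT FB x b f : is_cmap X Z FT FB -> liftable x b f ->
  liftable (x *m FB) b f.
Proof.
move=> h [e [g [s eg]]]; exists (fun j => e j *m FT), (fun j => g j *m FB).
by split; [exact: strand_cmap h s|rewrite eg].
Qed.

Lemma lift_trunc X x b f f' : (f <= f')%N -> @liftable X x b f -> liftable x b f'.
Proof.
move=> h [e [g [[s1 s2] eg]]]; exists e, g; split=> //.
by split=> j hj; [apply: s1|apply: s2]; lia.
Qed.

Lemma strand_top X k k' f e g : (k' <= k)%N -> strand X k f e g ->
  strand X k' f e g.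
Proof. by move=> h [s1 s2]; split=> j hj; [apply: s1|apply: s2]; lia. Qed.

Lemma lift_cell k r b : (r <= k)%N -> (b <= k)%N ->
  @liftable (cell k r) (genB r k b) b (k - r).
Proof.
move=> rk bk; exists (genT r k), (genB r k); split=> //.
exact: strand_top bk (strand_cell rk).
Qed.

(* The chosen strand has maximal bottom degree among those met by [z]: this is
   what makes the complementary component [z'] liftable down to [k - r]. *)
Lemma pick_strand M ss z d : all (okc M) ss -> hd (gB (cells ss)) d z -> z != 0 ->
  exists k r b ss' PT PB QT QB, [/\ d = b%:Z, okc M (k, r), all (okc M) ss',
    (k - r <= b <= k)%N & [/\
    is_cmap (cells ss) (dsum (cell k r) (cells ss')) PT PB /\
    is_cmap (dsum (cell k r) (cells ss')) (cells ss) QT QB,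
    PT *m QT = 1%:M /\ PB *m QB = 1%:M, QT *m PT = 1%:M /\ QB *m PB = 1%:M &
    exists z', z *m PB = row_mx (genB r k b) z' /\
      @liftable (cells ss') z' b (k - r)]].
Proof.
elim: ss z => [z _ _|[k0 r0] ss IH z okss].
  by case/eqP; apply/matrixP => ? [].
have /andP[ok0 hss] : okc M (k0, r0) && all (okc M) ss := okss.
have /andP[/= rk0 _] := ok0.
rewrite -[z]hsubmxK; move: (lsubmx _) (rsubmx _) => {z} z0 z1 hz nz.
have hz0 : hd (gB (cell k0 r0)) d z0 by have := hd_rowl hz; rewrite row_mxKl.
have hz1 : hd (gB (cells ss)) d z1 by have := hd_rowr hz; rewrite row_mxKr.
have idn (b : nat) : d = b%:Z -> (k0 - r0 <= b <= k0)%N -> z0 = genB r0 k0 b ->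
  @liftable (cells ss) z1 b (k0 - r0) ->
  exists k r b ss' PT PB QT QB, [/\ d = b%:Z, okc M (k, r), all (okc M) ss',
    (k - r <= b <= k)%N & [/\
    is_cmap (cells ((k0, r0) :: ss)) (dsum (cell k r) (cells ss')) PT PB /\
    is_cmap (dsum (cell k r) (cells ss')) (cells ((k0, r0) :: ss)) QT QB,
    PT *m QT = 1%:M /\ PB *m QB = 1%:M, QT *m PT = 1%:M /\ QB *m PB = 1%:M &
    exists z', row_mx z0 z1 *m PB = row_mx (genB r k b) z' /\
      @liftable (cells ss') z' b (k - r)]].
  move=> db hb ez lf; exists k0, r0, b, ss, 1%:M, 1%:M, 1%:M, 1%:M.
  split=> //; split; rewrite ?mul1mx //; try by split; exact: cmap1.
  by exists z1; split=> //; rewrite mulmx1 ez.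
have [e1|n1] := eqVneq z1 0.
  have [e|[b [db hb ez]]] := cell_coordB rk0 hz0.
    by move: nz; rewrite e e1 row_mx0 eqxx.
  by apply: (idn b) => //; rewrite e1; apply: lift0.
have [k [r [b [ss' [PT [PB [QT [QB [db ok hss' hb [[p1 p2] [e1 e2] [e3 e4]
  [z' [ez' lf]]]]]]]]]]]] := IH z1 hss hz1 n1.
have /andP[/= rk _] := ok.
have [c0|[b0 [db0 hb0 ez0]]] := cell_coordB rk0 hz0; last first.
  (* The strand with the higher bottom is chosen. The component on the other one lifts down to its
     own bottom, hence, after truncation, to the bottom of the chosen strand. If the head wins, all
     of [z1] has to be lifted, including the part on the strand chosen before. *)
  have [fle|flt] := leqP (k0 - r0) (k - r); last first.
    have eb : b0 = b by lia.
    rewrite eb in hb0 ez0; apply: (idn b) => //.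
    rewrite -[z1]mulmx1 -e2 mulmxA ez'; apply: lift_cmap p2 _.
    apply: lift_trunc (ltnW flt) _; apply: lift_dsum => //.
    by apply: lift_cell => //; case/andP: hb.
all: exists k, r, b, ((k0, r0) :: ss').
all: have s1 := ciso_swap (cell k0 r0) (cell k r) (cells ss').
all: have s2 := ciso_swap (cell k r) (cell k0 r0) (cells ss').
all: have b1 := cmap_block (cmap1 (cell k0 r0)) p1.
all: have b2 := cmap_block (cmap1 (cell k0 r0)) p2.
all: have f1 := cmap_comp b1 s1; have f2 := cmap_comp s2 b2.
all: match type of f1 with is_cmap _ _ ?a ?b => exists a, b end.
all: match type of f2 with is_cmap _ _ ?a ?b => exists a, b end.
all: split=> //; first by rewrite /= ok0.
all: split=> //.
1, 4: by split; apply: mulmx_cancel; [exact: block1K|exact: swapK|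
    exact: block1K|exact: swapK].
1, 3: by split; apply: mulmx_cancel; [exact: swapK|exact: block1K|
    exact: swapK|exact: block1K].
all: exists (row_mx z0 z'); split.
1, 3: exact: block_swap_row ez'.
all: apply: lift_dsum => //.
  have eb : b0 = b by lia.
  rewrite eb in hb0 ez0; rewrite ez0; apply: (lift_trunc fle).
  by apply: lift_cell => //; case/andP: hb0.
by rewrite c0; apply: lift0.
Qed.

(** * Split summands of type B *)

Definition B_seq (r : nat) : seq bool := false :: cell_seq r.+1.

Lemma B_seq_size r : size (B_seq r) = r.+3.
Proof. by rewrite /= cell_seq_size. Qed.

Lemma B_seq_nth r c : nth false (B_seq r) c = (0 < c < r.+2)%N.
Proof. by case: c => //= c; rewrite cell_seq_nth. Qed.

Section BStrand.
Variables (w f r0 : nat).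
Hypothesis wf : w = (f + r0.+2)%N.
Definition Bcpx := shift w%:Z (Br r0).
Definition BgenT (j : nat) := chv (B_seq r0) (w - j).
Definition BgenB (j : nat) := chw (B_seq r0) (w - j).
Notation W := (BgenB w).

Lemma B_seq_ok c : ~~ [&& nth false (B_seq r0) c, ~~ nth false (B_seq r0) c.+1,
  (c.+1 < size (B_seq r0))%N & nth false (B_seq r0) c.+2].
Proof. by rewrite !B_seq_nth B_seq_size; lia. Qed.

Lemma cpx_B : is_cpx Bcpx.
Proof. by apply: cpx_shift; apply: cpx_chain; apply: B_seq_ok. Qed.

Lemma hd_BgenT j : (j <= w)%N -> hd (gT Bcpx) j%:Z (BgenT j).
Proof.
move=> h; apply/hd_shift; have := @hd_chv (B_seq r0) 0 (w - j).
by rewrite (_ : _ - _ = j%:Z - w%:Z); last by lia.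
Qed.

Lemma hd_BgenB j : (j <= w)%N -> hd (gB Bcpx) j%:Z (BgenB j).
Proof.
move=> h; apply/hd_shift; have := @hd_chw (B_seq r0) 0 (w - j).
by rewrite (_ : _ - _ = j%:Z - w%:Z); last by lia.
Qed.

Lemma BgenT_pl j : (f < j < w)%N -> BgenT j *m pl Bcpx = BgenB j.
Proof.
move=> h; apply: (@chv_pl (B_seq r0) 0); rewrite ?B_seq_size ?B_seq_nth; lia.
Qed.

Lemma BgenT_dT j : (f < j < w)%N -> BgenT j *m dT Bcpx = BgenB j.-1 *m ps Bcpx.
Proof.
move=> h; rewrite /BgenT /BgenB (_ : w - j.-1 = (w - j).+1)%N; last by lia.
by apply: (@chv_dT (B_seq r0) 0); rewrite ?B_seq_size ?B_seq_nth; lia.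
Qed.

Lemma BgenB_dB j : (f <= j < w)%N -> BgenB j *m dB Bcpx = 0.
Proof.
move=> h; rewrite /BgenB [LHS](@chw_dB (B_seq r0) 0) ?B_seq_size; last by lia.
by rewrite !B_seq_nth; case: ifP => //; lia.
Qed.

Lemma W_dB : W *m dB Bcpx = BgenB w.-1.
Proof.
have h := @chw_dB (B_seq r0) 0 0 isT; rewrite !B_seq_nth in h.
by rewrite /BgenB subnn (_ : w - w.-1 = 1)%N; [exact: h|lia].
Qed.

(** The strand of [B] continues above its F-part: [p^* W] serves as the generator in degree [w],
    because its boundary is [p^*] of the boundary of [W]. As [p_* p^* W = 0], it can go on with
    zeros to any height [k], so a cell with any top and bottom [f] maps to [B]. *)
Lemma strand_B k : strand Bcpx k f
  (fun j => if (f < j < w)%N then BgenT j else if j == w then W *m ps Bcpx else 0)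
  (fun j => if (f <= j < w)%N then BgenB j else 0).
Proof.
have [[_ _ _ _ a5] [_ h2 _ _ _] [_ _ _ c4 _]] := cpx_B.
split=> j hj; last first.
  case: ifP => h; last by split; [exact: hd0|rewrite mul0mx].
  by split; [apply: hd_BgenB; lia|exact: BgenB_dB].
case: ifP => h.
  rewrite !ifT; try lia.
  by split; [apply: hd_BgenT; lia|exact: BgenT_pl|exact: BgenT_dT].
rewrite [if (f <= j < w)%N then _ else _]ifF; last by lia.
case: eqP => [->|ne].
  rewrite ifT; last by lia.
  split.
  - by have := hd_mul h2 (hd_BgenB (leqnn w)); rewrite addr0.
  - by rewrite -mulmxA a5 mulmx0.
  - by rewrite -mulmxA c4 mulmxA W_dB.
by rewrite ifF; [split; rewrite ?mul0mx //; exact: hd0|lia].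
Qed.

Lemma B_ext X FT FB GT GB : @mack Bcpx X FT FB -> @mack Bcpx X GT GB ->
  (forall j, (f < j < w)%N -> BgenT j *m FT = BgenT j *m GT) ->
  W *m FB = W *m GB -> BgenB f *m FB = BgenB f *m GB -> FT = GT /\ FB = GB.
Proof.
move=> m1 m2 h1 h2 h3; apply: (chain_ext (s := B_seq r0) (top := 0) m1 m2) => c.
  move=> cs; rewrite B_seq_nth => cF; have := h1 (w - c)%N.
  by rewrite /BgenT (_ : w - (w - c) = c)%N; [apply|]; lia.
move=> cs; have {}cs : (c < r0.+3)%N by rewrite -(B_seq_size r0).
rewrite B_seq_nth => cF; have [e|ne] := eqVneq c 0%N.
  by move: h2; rewrite /BgenB subnn e.
have ec : c = (w - f)%N by lia.
by move: h3; rewrite /BgenB -ec.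
Qed.

Lemma B_map X V e g : is_cpx X -> strand X w.-1 f e g ->
  hd (gB X) w%:Z V -> V *m dB X = g w.-1 ->
  exists FT FB, [/\ is_cmap Bcpx X FT FB, W *m FB = V,
    forall j, (f < j < w)%N -> BgenT j *m FT = e j &
    forall j, (f <= j < w)%N -> BgenB j *m FB = g j].
Proof.
move=> hX [s1 s2] hV dV.
pose v c := e (w - c)%N.
pose u c := if c == 0%N then V else g (w - c)%N.
have vu c : (c < size (B_seq r0))%N -> nth false (B_seq r0) c -> v c *m pl X = u c.
  rewrite B_seq_size B_seq_nth => h1 h2; rewrite /u ifF; last by lia.
  by case: (s1 (w - c)%N) => //; lia.
have hv c : (c < size (B_seq r0))%N -> nth false (B_seq r0) c ->
    hd (gT X) (0 - c%:Z + w%:Z) (v c).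
  rewrite B_seq_size B_seq_nth => h1 h2; case: (s1 (w - c)%N); first by lia.
  by rewrite (_ : 0 - c%:Z + w%:Z = (w - c)%N%:Z) //; lia.
have hu c : (c < size (B_seq r0))%N -> hd (gB X) (0 - c%:Z + w%:Z) (u c).
  rewrite B_seq_size /u => h1; case: eqP => [->|ne].
    by rewrite (_ : 0 - 0%N%:Z + w%:Z = w%:Z) //; lia.
  case: (s2 (w - c)%N); first by lia.
  by rewrite (_ : 0 - c%:Z + w%:Z = (w - c)%N%:Z) //; lia.
have M := mack_ch 0 hX vu.
have ev j : (f < j < w)%N -> BgenT j *m chFT (B_seq r0) v u = e j.
  move=> h; rewrite /BgenT chFT_v ?B_seq_size ?B_seq_nth; try by lia.
  by rewrite /v; congr e; lia.
have eu j : (f <= j < w)%N -> BgenB j *m chFB (B_seq r0) u = g j.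
  move=> h; rewrite /BgenB chFB_w ?B_seq_size; try by lia.
  by rewrite /u ifF; [congr g|]; lia.
have eW : W *m chFB (B_seq r0) u = V by rewrite /BgenB subnn chFB_w ?B_seq_size.
exists (chFT (B_seq r0) v u), (chFB (B_seq r0) u); split=> //.
have mX := mack_d hX; have mB := mack_d cpx_B.
have [c1 c2] : dT Bcpx *m (chFT (B_seq r0) v u : 'M_(nT Bcpx, nT X)) =
    (chFT (B_seq r0) v u : 'M_(nT Bcpx, nT X)) *m dT X /\
    dB Bcpx *m (chFB (B_seq r0) u : 'M_(nB Bcpx, nB X)) =
    (chFB (B_seq r0) u : 'M_(nB Bcpx, nB X)) *m dB X.
  apply: B_ext; [exact: (mackM mB M)|exact: (mackM M mX)| | |].
  - move=> j h; rewrite !mulmxA (BgenT_dT h) ev //.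
    have [|_ _ ->] := s1 j; first by lia.
    have [_ m2 _] := M; have m2' : ps Bcpx *m (chFT (B_seq r0) v u) =
      (chFB (B_seq r0) u) *m ps X := m2.
    by rewrite -mulmxA m2' mulmxA eu //; lia.
  - by rewrite !mulmxA W_dB eW dV eu //; lia.
  - rewrite !mulmxA BgenB_dB ?mul0mx ?eu; try by lia.
    by case: (s2 f) => // ; lia.
have g1 := homog_chFT hX hv hu; have g2 := homog_chFB hu.
case: M => m1 m2 m3; split=> //; split.
  by apply: homog_s g1; rewrite add0r.
by apply: homog_s g2; rewrite add0r.
Qed.

End BStrand.

(** Once the map is nonzero on the bottom generator it climbs. The boundary of the image of
    [e_(j+1)] is a nonzero [p^* g_(j-1)], so that image contains the generator [e_j] of the strand,
    and [p_*] gives the next bullet generator. In particular the strand must reach degree [m]. *)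
Lemma coef_propagates m q k r FT FB d : (q <= m.+1)%N -> (r <= k)%N ->
  is_cmap (cell m q) (cell k r) FT FB -> (m.+1 - q = d.+1)%N ->
  (k - r <= d <= k)%N -> bottom m q *m FB = genB r k d ->
  forall j, (d < j <= m.+1)%N ->
  [/\ genB q m.+1 j *m FB = genB r k j.-1, (k - r <= j.-1 <= k)%N &
      (d.+1 < j)%N -> exists c, genT q m.+1 j *m FT =
        genT r k j.-1 + c *: (genB r k j.-1 *m ps (cell k r))].
Proof.
move=> qm rk f bd hd_ hb; elim=> [|j IH] hj; first by lia.
have [e|ne] := eqVneq d j.
  rewrite -e; split=> //; last by lia.
  by rewrite -hb /bottom bd.
have [|g1 g2 _] := IH; first by lia.
have [|h1 h2 h3] := @src_x m.+1 q qm m _ erefl _ _ f j.+1; first by lia.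
rewrite /= g1 in h3; rewrite /=.
have gn : genB r k j.-1 *m ps (cell k r) != 0 by apply: genB_ps_neq0.
case: (cell_coordT rk h1) => [e|[i [ei hi [a [b e]]]]].
  by move: h3 gn; rewrite e mul0mx => <-; rewrite eqxx.
have eij : i = j by lia.
rewrite eij in hi e.
have ps_d : ps (cell k r) *m dT (cell k r) = dB (cell k r) *m ps (cell k r).
  by case: (cpx_cell k r) => _ _ [].
have ps_l : ps (cell k r) *m pl (cell k r) = 0.
  by case: (cpx_cell k r) => [[]].
have zd : genB r k j *m ps (cell k r) *m dT (cell k r) = 0.
  by rewrite -mulmxA ps_d mulmxA (cell_dB rk k hi) mul0mx.
have [fj|jf] := ltnP (k - r) j; last first.
  move: h3; rewrite e ltnNge jf /= scale0r add0r -scalemxAl zd scaler0 => h3.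
  by rewrite -h3 eqxx in gn.
rewrite fj in e.
have hj' : (k - r < j <= k)%N by lia.
have ea : a = 1.
  case: (F2P a) => // a0; move: h3; rewrite e a0 scale0r add0r -scalemxAl zd.
  by rewrite scaler0 => h3; rewrite -h3 eqxx in gn.
rewrite ea scale1r in e.
split=> //; last by exists b.
by rewrite -h2 e mulmxDl -scalemxAl -mulmxA ps_l mulmx0 scaler0 addr0 (cell_pl rk k hj').
Qed.

(** By [coef_propagates] such a map sends [e] to [e + c p^* p_* e] and fixes the bullet generators,
    so in characteristic 2 it is its own inverse. *)
Lemma cell_map_involutive m q FT FB : (q <= m)%N ->
  is_cmap (cell m q) (cell m q) FT FB -> bottom m q *m FB = bottom m q ->
  FT *m FT = 1%:M /\ FB *m FB = 1%:M.
Proof.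
move=> qm f hb.
have qm1 : (q <= m.+1)%N by lia.
have eg j : (0 < j)%N -> genB q m j.-1 = genB q m.+1 j.
  by move=> h; rewrite /genB; congr chw; lia.
have ee j : (0 < j)%N -> genT q m j.-1 = genT q m.+1 j.
  by move=> h; rewrite /genT; congr chv; lia.
have hb' : bottom m q *m FB = genB q m (m - q).
  by rewrite hb /bottom /genB; congr chw; lia.
have P := @coef_propagates m q m q FT FB (m - q) qm1 qm f.
have P' j : (m - q < j <= m.+1)%N ->
  genB q m.+1 j *m FB = genB q m.+1 j /\ (((m - q).+1 < j)%N -> exists c,
    genT q m.+1 j *m FT = genT q m.+1 j + c *: (genB q m.+1 j *m ps (cell m q))).
  move=> hj; have [||h1 h2 h3] := P _ _ hb' j hj; try by lia.
  have j0 : (0 < j)%N by lia.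
  by move: h1 h3; rewrite eg // ee.
have mf := cmap_mack f; have m1 := cmap_mack (cmap1 (cell m q)).
apply: (cell_ext qm1 (mackM mf mf) m1) => [j hj|].
  have [|h1 h2] := P' j; first by lia.
  have [|c e] := h2; first by lia.
  have [_ m2 _] := mf.
  rewrite mulmx1 mulmxA e mulmxDl e -scalemxAl -mulmxA m2 mulmxA h1.
  by rewrite addmmK.
by rewrite mulmx1 mulmxA -/(bottom m q) !hb.
Qed.

(** * Null-homotopies of attaching maps after projection to B *)

Definition ehat w f r0 j :=
  if (f < j < w)%N then BgenT w r0 j
  else if j == w then BgenB w r0 w *m ps (Bcpx w r0) else 0.
Definition ghat w f r0 j := if (f <= j < w)%N then BgenB w r0 j else 0.

Lemma col_null m1 m2 n p (dC : 'M[F2]_m1) (dA : 'M[F2]_m2)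
    (F : 'M[F2]_(m1 + m2, n)) (R : 'M_(n, p)) H' H D :
  dC *m H' + usubmx F *m R = H' *m D -> dA *m H + dsubmx F *m R = H *m D ->
  block_mx dC 0 0 dA *m col_mx H' H + F *m R = col_mx H' H *m D.
Proof.
rewrite -{3}[F]vsubmxK mul_block_col !mul_col_mx !mul0mx addr0 add0r add_col_mx.
by move=> -> ->.
Qed.

Section Null.
Variables (m k r w f r0 : nat) (RT : 'M[F2]_(nT (cell k r), nT (Bcpx w r0)))
  (RB : 'M[F2]_(nB (cell k r), nB (Bcpx w r0))).
Hypotheses (rk : (r <= k)%N) (fE : f = (k - r)%N) (wf : w = (f + r0.+2)%N)
  (hr : is_cmap (cell k r) (Bcpx w r0) RT RB)
  (rT : forall j, (k - r < j <= k)%N -> genT r k j *m RT = ehat w f r0 j)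
  (rB : forall j, (k - r <= j <= k)%N -> genB r k j *m RB = ghat w f r0 j).

Let B := Bcpx w r0.

Lemma gps_R j : (k - r <= j <= k)%N ->
  genB r k j *m ps (cell k r) *m RT = ghat w f r0 j *m ps B.
Proof.
by move=> h; case: hr => _ _ e _ _; rewrite -mulmxA e mulmxA rB.
Qed.

(** The last clause concerns a cell whose bottom is exactly at [w] and has nonzero image: its
    homotopy hits the top generator [W] of [B]. This is what makes the projection of the cone onto
    [B] surjective in that degree. *)
Lemma null_cell q FT FB : (q <= m.+1)%N ->
  is_cmap (cell m q) (cell k r) FT FB ->
  (bottom m q *m FB = 0 \/ (w <= m.+1 - q)%N) ->
  exists HT HB, [/\ mack HT HB,
    homog (gT (cell m q)) (gT B) 1 HT /\ homog (gB (cell m q)) (gB B) 1 HB,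
    dT (cell m q) *m HT + FT *m RT = HT *m dT B,
    dB (cell m q) *m HB + FB *m RB = HB *m dB B &
    (m.+1 - q)%N = w -> bottom m q *m FB <> 0 -> bottom m q *m HB = BgenB w r0 w].
Proof.
move=> qm th; have hB : is_cpx B by apply: (cpx_B wf).
have hs_ := strand_B wf k; rewrite -/(ehat w f r0) -/(ghat w f r0) in hs_.
have [sT sB] := hs_.
have [[_ _ _ _ a5] [_ h2 _ _ _] [_ _ _ c4 _]] := hB.
set b := (m.+1 - q)%N.
have bb : (b <= b <= m.+1)%N by lia.
have [z0|zn] := eqVneq (bottom m q *m FB) 0.
  move=> _.
  have zz j : (b <= j <= m.+1)%N -> genB q m.+1 j *m FB = 0.
    elim: j => [|j IH] hj; first by rewrite -z0; congr (genB _ _ _ *m _); lia.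
    have [e|ne] := eqVneq b j.+1; first by rewrite -e -z0.
    have [|h1 <- h3] := src_x qm erefl th (j := j.+1); first by lia.
    rewrite /= IH ?mul0mx in h3; last by lia.
    have [->|[i [_ _ ->]]] := cell_cycle rk h1 h3; first by rewrite mul0mx.
    by case: (cpx_cell k r) => [[_ _ _ _ e] _ _]; rewrite -mulmxA e mulmx0.
  pose be j : F2 := (genT q m.+1 j *m FT != 0)%:R.
  (* Unlike in [cell_normalize], the sums start at the bottom of the cell: terms are pushed upwards
     in [B], where they end at [p^* W], whose [p_*] is 0. *)
  pose c j : F2 := \sum_(b.+1 <= i < j.+1) be i.
  have xE j : (b < j <= m.+1)%N ->
      (be j = 0 /\ genT q m.+1 j *m FT = 0) \/ [/\ be j = 1, (f <= j.-1 <= k)%N &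
        genT q m.+1 j *m FT = genB r k j.-1 *m ps (cell k r)].
    move=> hj; have [h1 _ h3] := src_x qm erefl th hj.
    rewrite zz ?mul0mx in h3; last by lia.
    rewrite /be; have [->|[i [e1 e2 e3]]] := cell_cycle rk h1 h3.
      by left; rewrite eqxx.
    right; have -> : j.-1 = i by lia.
    by rewrite e3 genB_ps_neq0 // fE.
  have cS j : (b < j <= m.+1)%N -> c j = c j.-1 + be j.
    move=> hj; have [i e] : exists i, j = i.+1 by exists j.-1; lia.
    by rewrite e /c big_nat_recr //=; lia.
  have c0 j : (b <= j <= m.+1)%N -> (j <= f)%N -> c j = 0.
    move=> hj jf; rewrite /c big_nat_cond big1 // => i /andP[hi _].
    by case: (xE i) => [|[-> //]|[_ h _]]; lia.
  pose v j := if (f < j)%N then c j *: ehat w f r0 j else 0.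
  pose u j := c j *: ghat w f r0 j.
  have ghat0 j : (j < f)%N || (w <= j)%N -> ghat w f r0 j = 0.
    by move=> h; rewrite /ghat ifF //; lia.
  have strB K j : (f < j)%N -> (j <= K)%N -> [/\ hd (gT B) j%:Z (ehat w f r0 j),
      ehat w f r0 j *m pl B = ghat w f r0 j &
      ehat w f r0 j *m dT B = ghat w f r0 j.-1 *m ps B].
    move=> h1 h3; have [s1 _] := strand_B wf K; apply: s1; lia.
  have strBg j : hd (gB B) j%:Z (ghat w f r0 j).
    have [_ s2] := strand_B wf j; have [h|h] := leqP f j.
      by case: (s2 j) => //; lia.
    by rewrite ghat0 ?h //; exact: hd0.
  have [||| HT [HB [H1 H2 H3 H4 H5]]] :=
    @cell_null m.+1 q qm m _ erefl _ _ th B RT RB v u hB hr.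
  - move=> j hj; rewrite /v; have [jf|fj] := leqP j f.
      split; [exact: hd0| |].
        by rewrite mul0mx /u c0 ?scale0r //; lia.
      rewrite mul0mx /u (ghat0 j.-1) ?scaler0 ?mul0mx ?add0r; last by lia.
      by case: (xE j hj) => [[_ ->]|[_ h ->]]; rewrite ?mul0mx //; lia.
    have [s1 s2 s3] := strB j j fj (leqnn j).
    split; [exact: hdZ|by rewrite -scalemxAl s2|].
    rewrite -scalemxAl s3 cS // scalerDl -scalemxAl; congr (_ + _).
    case: (xE j hj) => [[-> ->]|[-> h ->]]; first by rewrite scale0r mul0mx.
    by rewrite scale1r gps_R // -fE.
  - by move=> j hj; apply: hdZ.
  - rewrite /u /c big_geq // scale0r mul0mx -/b.
    by rewrite -/(bottom m q) z0 mul0mx.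
  by exists HT, HB; split=> // _ [].
case=> [e|wb]; first by rewrite e eqxx in zn.
have [h1 h2'] := src_z qm erefl th bb.
have [e|[d [ed hd_ eg]]] := cell_coordB rk h1; first by rewrite -e eqxx in zn.
have bd : (m.+1 - q = d.+1)%N by lia.
have prop := coef_propagates qm rk th bd hd_ eg.
(* The bottom image lies in degree [b - 1 >= w - 1]. Its projection to [B] is 0 unless [b = w]; in
   that case it is the boundary of [W], so the homotopy must take the value [W] there. *)
pose u j := if (j == b) && (b == w) then BgenB w r0 w else 0.
have ghat0 j : (w <= j)%N -> ghat w f r0 j = 0.
  by move=> h; rewrite /ghat ifF //; lia.
have [||| HT [HB [H1 H2 H3 H4 H5]]] :=
  @cell_null m.+1 q qm m _ erefl _ _ th B RT RB (fun=> 0) u hB hr.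
- move=> j hj; split; first exact: hd0.
    by rewrite mul0mx /u ifF //; lia.
  have [|g1 g2 g3] := prop j; first by lia.
  have [|c ->] := g3; first by lia.
  rewrite mul0mx mulmxDl -scalemxAl gps_R // ghat0; last by lia.
  rewrite mul0mx scaler0 addr0 rT; last by lia.
  rewrite /ehat ifF; last by lia.
  rewrite /u.
  have [e|ne] := eqVneq j.-1 w.
    by rewrite e ifT ?addmm //; lia.
  by rewrite ifF ?mul0mx ?addr0 //; lia.
- move=> j hj; rewrite /u; case: ifP => [/andP[/eqP jb /eqP bw]|_].
    rewrite jb bw; exact: (hd_BgenB wf (leqnn w)).
  exact: hd0.
- rewrite -/b /u eqxx /= -/(bottom m q) eg rB //.
  case: eqP => [e|ne]; last by rewrite mul0mx ghat0 //; lia.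
  by rewrite (W_dB wf) /ghat ifT; [congr BgenB|]; lia.
exists HT, HB; split=> // bw _.
by rewrite /bottom H5 // /u -/b bw !eqxx.
Qed.

Lemma null_cells X PT PB qs : is_cmap X (cell k r) PT PB ->
  forall FT FB, all (fun q => q <= m.+1)%N qs ->
  is_cmap (cellsum m qs) X FT FB ->
  allz (fun q z => z = 0 \/ (w <= m.+1 - q)%N) FB ->
  exists HT HB, [/\ mack HT HB,
    homog (gT (cellsum m qs)) (gT B) 1 HT /\
    homog (gB (cellsum m qs)) (gB B) 1 HB,
    dT (cellsum m qs) *m HT + FT *m (PT *m RT) = HT *m dT B &
    dB (cellsum m qs) *m HB + FB *m (PB *m RB) = HB *m dB B].
Proof.
move=> hp; elim: qs => [|q qs IH] FT FB.
  move=> _ _ _; exists 0, 0; split.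
  - by split; apply/matrixP => [[]].
  - by split; exact: homog0.
  - by apply/matrixP => [[]].
  - by apply/matrixP => [[]].
move=> /andP[qm hqs] f_ [z0 zs].
have [fc fa] := @cmap_sub (cell m q) (cellsum m qs) _ _ _ f_.
have [HT [HB [[M1 M2 M3] [h1 h2] e1 e2]]] := IH _ _ hqs fa zs.
have [|HT' [HB' [[M1' M2' M3'] [h1' h2'] e1' e2' _]]] :=
  null_cell qm (cmap_comp fc hp).
  by case: z0 => h; [left; rewrite mulmxA h mul0mx|right].
exists (col_mx HT' HT), (col_mx HB' HB).
split.
- by split; rewrite /= mul_block_col mul_col_mx !mul0mx addr0 add0r
    ?M1 ?M2 ?M3 ?M1' ?M2' ?M3'.
- by split; apply: homog_col.
- by apply: col_null; [rewrite mulmxA|].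
- by apply: col_null; [rewrite mulmxA|].
Qed.
End Null.

(** * Reduction of an attaching map *)

(** Attach [C] first and [A] to the resulting cone, which cancels to [S']; the map from [A] is
    pushed forward along this cancellation. The component [C -> C] is assumed to be its own inverse,
    the form in which [cell_map_involutive] supplies it. *)
Lemma cancel_step A C S S' GT GB PT PB QT QB :
  is_cpx A -> is_cpx C -> is_cpx S -> is_cpx S' ->
  is_cmap (dsum C A) S GT GB ->
  is_cmap S (dsum C S') PT PB -> is_cmap (dsum C S') S QT QB ->
  PT *m QT = 1%:M -> PB *m QB = 1%:M -> QT *m PT = 1%:M -> QB *m PB = 1%:M ->
  (forall F G, F = (usubmx GT *m PT) *m col_mx 1%:M 0 ->
     G = (usubmx GB *m PB) *m col_mx 1%:M 0 ->
     F *m F = 1%:M /\ G *m G = 1%:M) ->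
  exists HT HB, is_cmap A S' HT HB /\ qmap (cone GT GB) (@cone A S' HT HB).
Proof.
move=> hA hC hS hS' g p q e1 e2 e3 e4 inv.
have [gc ga] := cmap_sub g.
set CT := usubmx _ in gc inv; set CB := usubmx _ in gc inv.
set AT := dsubmx _ in ga; set AB := dsubmx _ in ga.
have fc := cmap_comp gc p; have fa := cmap_comp ga p.
have fl := cmap_comp fc (projl C S'); have fr := cmap_comp fc (projr C S').
have [i1 i2] := inv _ _ erefl erefl.
set aT := _ *m col_mx 1%:M 0 in fl i1; set aB := _ *m col_mx 1%:M 0 in fl i2.
set pT := _ *m col_mx 0 1%:M in fr; set pB := _ *m col_mx 0 1%:M in fr.
have rE n n1 n2 (F : 'M[F2]_(n, n1 + n2)) :
    F = row_mx (F *m col_mx 1%:M 0) (F *m col_mx 0 1%:M).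
  rewrite -{1}[F]hsubmxK; congr row_mx.
    by rewrite -{2}[F]hsubmxK mul_row_col mulmx1 mulmx0 addr0.
  by rewrite -{2}[F]hsubmxK mul_row_col mulmx1 mulmx0 add0r.
have genT : CT *m PT = row_mx aT pT by apply: rE.
have eB_ : CB *m PB = row_mx aB pB by apply: rE.
have [_ [_ [RT [RB [r [r1 r2]]]]]] := qmap_cancel hC hC hS' fl fl i1 i2 i1 i2 fr.
rewrite -genT -eB_ in RT RB r r1 r2.
have hD := cpx_dsum hC hS'.
have hK := cpx_cone hC hD fc.
have ha' := cmap_comp fa (cmap_cone_inr (CT *m PT) (CB *m PB)).
have c1 := ciso_cone_target GT GB p q e1 e2 e3 e4.
have c2 := ciso_cone_dsum (CT *m PT) (CB *m PB) (AT *m PT) (AB *m PB).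
have eG : GT *m PT = col_mx (CT *m PT) (AT *m PT).
  by rewrite -mul_col_mx /CT /AT vsubmxK.
have eG' : GB *m PB = col_mx (CB *m PB) (AB *m PB).
  by rewrite -mul_col_mx /CB /AB vsubmxK.
rewrite -eG -eG' in c2.
have eA n n1 n2 (F : 'M[F2]_(n, n2)) :
    F *m row_mx 0 1%:M = row_mx 0 F :> 'M_(n, n1 + n2).
  by rewrite mul_mx_row mulmx0 mulmx1.
have ha : is_cmap A (@cone C (dsum C S') (CT *m PT) (CB *m PB))
    (row_mx 0 (AT *m PT)) (row_mx 0 (AB *m PB)).
  by rewrite -(eA _ (nT C) _ (AT *m PT)) -(eA _ (nB C) _ (AB *m PB)).
have q3 := qmap_cone hA ha hK hS' r r1 r2.
have f := cmap_comp ha r.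
match type of f with is_cmap _ _ ?a ?b => exists a, b end.
split; first exact: f.
apply: qmap_trans q3; apply: ciso_qmap.
- exact: cpx_cone (cpx_dsum hC hA) hS g.
- exact: cpx_cone hA hK ha.
- exact: ciso_trans c1 c2.
Qed.

(* The strand met by the cell has a lower bottom than the cell: the cell down to
   degree [b.+1] cancels against it and leaves a copy of [B_(b - f - 1)]. *)
Lemma split_B m q qs S S' k r b GT GB PT PB QT QB z' :
  (q <= m.+1)%N -> all (fun q => q <= m.+1)%N qs -> (r <= k)%N ->
  (m.+1 - q = b.+1)%N -> (k - r < b <= k)%N ->
  is_cpx S -> is_cpx S' ->
  is_cmap (dsum (cell m q) (cellsum m qs)) S GT GB ->
  is_cmap S (dsum (cell k r) S') PT PB -> is_cmap (dsum (cell k r) S') S QT QB ->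
  PT *m QT = 1%:M -> PB *m QB = 1%:M -> QT *m PT = 1%:M -> QB *m PB = 1%:M ->
  bottom m q *m usubmx GB *m PB = row_mx (genB r k b) z' ->
  liftable z' b (k - r) ->
  allz (fun q' z => z = 0 \/ (q' <= q)%N) (dsubmx GB) ->
  ~ spacelike GT GB.
Proof.
move=> qm hqs rk eb hb hS hS' g p p' e1 e2 e3 e4 ez [e' [g' [s' eg']]] az sp.
have [gc ga] := cmap_sub g.
set CT := usubmx _ in gc; set CB := usubmx _ in gc ez.
set AT := dsubmx _ in ga; set AB := dsubmx _ in ga az.
(* [w] is the degree in the cone of the bottom generator of the cell, one above its image. [B_r0]
   has its two H-cells [r0 + 2] degrees apart, and [f < b] makes [w - f] at least 2. *)
set f := (k - r)%N in hb s'; pose w := b.+1; pose r0 := (w - f).-2.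
have wf : w = (f + r0.+2)%N by rewrite /r0 /w; lia.
have hB : is_cpx (Bcpx w r0) := cpx_B wf.
have [RT [RB [hr rT rB]]] := strand_map hB rk (strand_B wf k).
have rho := cmap_comp p (projl (cell k r) S').
(* Here the maximality of [q] is used: another cell with nonzero image is not longer, so its bottom
   in the cone is at [w] or above. *)
have az' : allz (fun q z => z = 0 \/ (w <= m.+1 - q)%N) AB.
  apply: allz_w az => q' z [->|h]; [by left|right]; rewrite /w; lia.
have [HT [HB [M1 [h1 h2] n1 n2]]] :=
  null_cells rk erefl wf hr rT rB rho hqs ga az'.
have fc := cmap_comp gc rho.
have ezl : bottom m q *m (CB *m (PB *m col_mx 1%:M 0)) = genB r k b.
  by rewrite !mulmxA ez mul_row_col mulmx1 mulmx0 addr0.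
have [|HT' [HB' [M1' [h1' h2'] n1' n2' hW]]] :=
  null_cell rk erefl wf hr rT rB qm fc.
  by right; rewrite eb.
have zn : bottom m q *m (CB *m (PB *m col_mx 1%:M 0)) <> 0.
  by rewrite ezl; apply/eqP; apply: genB_neq0; lia.
have {}hW := hW eb zn.
have rho' := cmap_comp rho hr.
have hA := cpx_dsum (cpx_cell m q) (cpx_cellsum m qs).
have hY := cpx_cone hA hS g.
have pi : is_cmap (cone GT GB) (Bcpx w r0)
    (col_mx (col_mx HT' HT) (PT *m col_mx 1%:M 0 *m RT))
    (col_mx (col_mx HB' HB) (PB *m col_mx 1%:M 0 *m RB)).
  apply: (cmap_cone rho').
  - case: M1 M1' => [M1 M2 M3] [M1' M2' M3'].
    by split; rewrite /= mul_block_col mul_col_mx !mul0mx addr0 add0r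
      ?M1 ?M2 ?M3 ?M1' ?M2' ?M3'.
  - exact: homog_col.
  - exact: homog_col.
  - by apply: col_null => //; rewrite mulmxA.
  - by apply: col_null => //; rewrite mulmxA.
have fk : (b <= k)%N by lia.
have sT := strand_dsum (strand_top fk (strand_cell rk)) s'.
have sS := strand_cmap p' sT.
have sY := strand_cmap (cmap_cone_inr GT GB) sS.
(* The bottom generator of the cell becomes the image of [W]. Its boundary in the cone is the
   attaching image, from which the lifted strand continues the inclusion of [B] downwards. *)
pose V : 'rV[F2]_(nB (cone GT GB)) :=
  row_mx (row_mx (bottom m q) 0 : 'rV_(nB (cell m q) + nB (cellsum m qs))) 0.
have hV : hd (gB (cone GT GB)) w%:Z V.
  apply: hd_row; last exact: hd0.
  apply/hd_shift; apply: hd_row; last exact: hd0.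
  have := @hd_cellB m.+1 q qm m (m.+1 - q).
  rewrite eb (_ : _ - _ = w%:Z - 1); last by rewrite /w; lia.
  by rewrite /bottom eb; apply; lia.
have dV : V *m dB (cone GT GB) = row_mx (genB r k b) (g' b) *m QB *m row_mx 0 1%:M.
  rewrite /V [LHS]mul_row_block mul0mx !mul0mx !addr0.
  rewrite [X in row_mx X _]mul_row_block !mulmx0 mul0mx !addr0.
  rewrite /bottom (@cell_dB m.+1 q qm m) ?row_mx0; last by lia.
  rewrite mul_mx_row mulmx0 mulmx1 -/(bottom m q) eg' -ez.
  rewrite -[_ *m PB *m QB]mulmxA e2 mulmx1; congr row_mx.
  by rewrite -[GB]vsubmxK mul_row_col mul0mx addr0.
have [IT [IB [io iW ie ig]]] := B_map wf hY sY hV dV.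
have mi := mackM (cmap_mack io) (cmap_mack pi).
have m1 := cmap_mack (cmap1 (Bcpx w r0)).
have back n1_ n2_ n3 n4 n5 (u : 'rV[F2]_n1_) (v : 'rV_n2_)
    (F : 'M_(n1_ + n2_, n3)) (P : 'M_(n3, n1_ + n2_)) (H : 'M_(n4, n5)) R :
    F *m P = 1%:M -> row_mx u v *m F *m row_mx 0 1%:M *m
      col_mx H (P *m col_mx 1%:M 0 *m R) = u *m R.
  move=> FP; rewrite -[_ *m row_mx 0 1%:M *m _]mulmxA mul_row_col mul0mx add0r.
  rewrite mul1mx !mulmxA -(mulmxA _ F) FP mulmx1 mul_row_col mulmx1 mulmx0.
  by rewrite addr0.
have fb : (f <= b)%N by lia.
have [|||id1 id2] := B_ext wf mi m1.
- move=> j hj; rewrite mulmx1 mulmxA ie // [LHS](back _ _ _ _ _ _ _ _ _ _ _ e3).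
  have hj' : (k - r < j <= k)%N by move: hj; rewrite /w /f; lia.
  by rewrite (rT j hj') /= -/f hj.
- rewrite mulmx1 mulmxA iW /V [LHS]mul_row_col mul0mx addr0.
  by rewrite [LHS]mul_row_col mul0mx addr0 hW.
- rewrite mulmx1 mulmxA ig; last by rewrite /w; lia.
  rewrite [LHS](back _ _ _ _ _ _ _ _ _ _ _ e4) rB; last by lia.
  by rewrite ifT //; lia.
apply: sp; exists w%:Z, r0, (cone IT IB); split.
  exact: cpx_cone hB hY io.
by apply: rst_step; apply: (qmap_retract hB hY io pi id1 id2).
Qed.

Lemma spacelike_qmap A X A' X' FT FB GT GB :
  qmap (@cone A X FT FB) (@cone A' X' GT GB) -> spacelike FT FB -> spacelike GT GB.
Proof.
move=> q h [i [r [Y [hY e]]]]; apply: h; exists i, r, Y; split=> //.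
exact: rst_trans (rst_step _ _ _ _ q) e.
Qed.

Lemma reduce_cell m q qs ss GT GB :
  (q <= m.+1)%N -> all (fun q => q <= m.+1)%N qs -> all (okc m) ss ->
  is_cmap (dsum (cell m q) (cellsum m qs)) (cells ss) GT GB ->
  bottom m q *m usubmx GB <> 0 ->
  allz (fun q' z => z = 0 \/ (q' <= q)%N) (dsubmx GB) ->
  spacelike GT GB ->
  exists ss' HT HB, [/\ all (okc m) ss',
    is_cmap (cellsum m qs) (cells ss') HT HB & qmap (cone GT GB) (cone HT HB)].
Proof.
move=> qm hqs hss g /eqP zn az sp.
have [gc ga] := cmap_sub g.
have [|hz _] := @src_z m.+1 q qm m _ erefl _ _ gc (m.+1 - q); first by lia.
have [k [r [b [ss' [PT [PB [QT [QB [db ok hss' hb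
  [[p p'] [e1 e2] [e3 e4] [z' [ez lz]]]]]]]]]]]] := pick_strand hss hz zn.
have /andP[/= rk km] := ok.
have eb : (m.+1 - q = b.+1)%N by lia.
have hS := cpx_cells ss; have hS' := cpx_cells ss'.
have [lt|ge] := ltnP (k - r) b.
  have hb' : (k - r < b <= k)%N by lia.
  by case: (split_B qm hqs rk eb hb' hS hS' g p p' e1 e2 e3 e4 ez lz az sp).
have fl := cmap_comp (cmap_comp gc p) (projl (cell k r) (cells ss')).
have ezl : bottom m q *m (usubmx GB *m PB *m col_mx 1%:M 0) = genB r k b.
  by rewrite !mulmxA ez mul_row_col mulmx1 mulmx0 addr0.
(* Climbing to the top generator of the cell gives [m <= k], and the bound on tops gives [k <= m]:
   this is where the filtration index matters. Since the bottoms match, [r = q] follows. *)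
have [|_ h2 _] := coef_propagates qm rk fl eb hb ezl (j := m.+1).
  by lia.
have ek : k = m by move: h2 => /=; lia.
subst k; have er : r = q by lia.
subst r; have qm' : (q <= m)%N by lia.
have [|HT [HB [h1 h3]]] := @cancel_step (cellsum m qs) (cell m q) _ _ _ _
  PT PB QT QB (cpx_cellsum m qs) (cpx_cell m q) hS hS' g p p' e1 e2 e3 e4.
  move=> F G -> ->; apply: cell_map_involutive qm' fl _.
  by rewrite ezl /bottom /genB; congr chw; lia.
by exists ss', HT, HB; split.
Qed.

(** The outer induction is on the number of cells, the inner one on the bound [Q]. Cancelling a cell
    may change the bottom images of the others, so [Q] is then reset to [m + 2], above every
    admissible [q]; the number of cells has dropped meanwhile. *)
Lemma reduce_cells m n : forall Q qs ss FT FB, (size qs < n)%N ->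
  all (fun q => q <= m.+1)%N qs -> all (okc m) ss ->
  is_cmap (cellsum m qs) (cells ss) FT FB -> spacelike FT FB ->
  allz (fun q z => z = 0 \/ (q < Q)%N) FB ->
  exists qs' ss' GT GB, [/\ all (fun q => q <= m.+1)%N qs', all (okc m) ss',
    is_cmap (cellsum m qs') (cells ss') GT GB, allz (fun _ z => z = 0) GB &
    qmap (cone FT FB) (cone GT GB)].
Proof.
elim: n => // n IHn; elim=> [|Q IHQ] qs ss FT FB szn hqs hss f sp az.
  have hY := cpx_cone (cpx_cellsum m qs) (cpx_cells ss) f.
  exists qs, ss, FT, FB; split; [exact: hqs|exact: hss|exact: f| |].
    by apply: allz_w az => q z [].
  exact: (ciso_qmap hY hY (ciso_refl _)).
have [az'|] := extract_cell az; first exact: IHQ szn hqs hss f sp az'.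
case=> [qs' [PT [PB [QT [QB [[p1 p2] [e1 e2] [e3 e4] pe [G [eG zn az']]]]]]]].
have hqs' : all (fun q => q <= m.+1)%N (Q :: qs') by rewrite -(perm_all _ pe).
have /andP[/= qm hq'] := hqs'.
have g := cmap_comp p1 f; rewrite eG in g.
have hY := cpx_cone (cpx_cellsum m qs) (cpx_cells ss) f.
have hZ := cpx_cone (cpx_dsum (cpx_cell m Q) (cpx_cellsum m qs')) (cpx_cells ss) g.
have q1 : qmap (cone FT FB) (cone (PT *m FT) G).
  apply: (ciso_qmap hY hZ); rewrite -eG.
  exact: ciso_cone_source p1 p2 e1 e2 e3 e4.
have [ss1 [HT [HB [hss1 h q2]]]] :=
  reduce_cell qm hq' hss g zn az' (spacelike_qmap q1 sp).
have q12 := qmap_trans q1 q2.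
have szq : (size qs' < n)%N by move: szn; rewrite (perm_size pe).
have [|qs2 [ss2 [KT [KB [k1 k2 k3 k4 k5]]]]] :=
  IHn m.+2 qs' ss1 HT HB szq hq' hss1 h (spacelike_qmap q12 sp).
  by apply: allz_all hq' => q z; right.
exists qs2, ss2, KT, KB; split; [exact: k1|exact: k2|exact: k3|exact: k4|].
exact: qmap_trans q12 k5.
Qed.

(** * Induction over the stages *)

Lemma ciso_dsum A B X Z : ciso A X -> ciso B Z -> ciso (dsum A B) (dsum X Z).
Proof.
case=> FT [FB [GT [GB [f g [e1 e2] [e3 e4]]]]].
case=> FT' [FB' [GT' [GB' [f' g' [e1' e2'] [e3' e4']]]]].
exists (block_mx FT 0 0 FT'), (block_mx FB 0 0 FB').
exists (block_mx GT 0 0 GT'), (block_mx GB 0 0 GB').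
split; [exact: cmap_block|exact: cmap_block|split|split];
  by rewrite mulmx_block !mulmx0 !mul0mx !addr0 !add0r ?(e1, e2, e3, e4)
    ?(e1', e2', e3', e4') -scalar_mx_block.
Qed.

Lemma ciso_Hcx : ciso Hcx (cell 0 0).
Proof.
have h n (g : 'I_n -> int) : homog g (fun i => g i + 0) 0 1%:M /\
    homog (fun i => g i + 0) g 0 1%:M.
  by split; apply: homog_eq (homog1 g) => // i; rewrite addr0.
exists 1%:M, 1%:M, 1%:M, 1%:M; split; rewrite ?mulmx1 //.
  by split; rewrite ?mulmx1 ?mul1mx //; split; case: (h _ (gT Hcx)); case: (h _ (gB Hcx)).
by split; rewrite ?mulmx1 ?mul1mx //; split; case: (h _ (gT Hcx)); case: (h _ (gB Hcx)).
Qed.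

Lemma ciso_Hsum a : ciso (Hsum a) (cells (nseq a (0, 0)%N)).
Proof.
elim: a => [|a IH]; first exact: ciso_refl.
exact: ciso_dsum ciso_Hcx IH.
Qed.

(** The quasi-isomorphism points from [X] to the sum, so the next attaching map is simply composed
    with it and never has to be lifted. The bound on tops remains [m] during the reduction, where it
    is needed, and rises to [m + 1] only when the remaining cells are attached. *)
Lemma built_cells N X : built N X ->
  exists ss, all (okc N) ss /\ qmap X (cells ss).
Proof.
elim=> [a|m {}X qs FT FB _ [ss [hss q]] hqs f sp].
  exists (nseq a (0, 0)%N); split; first by rewrite all_nseq orbT.
  apply: ciso_qmap (ciso_Hsum a); last exact: cpx_cells.
  by apply: cpx_bigsum; elim: a => //= a IH; split=> //; apply: cpx_chain;
    case=> [|[]].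
have [hX [hS [RT [RB [r [r1 r2]]]]]] := q.
have q1 := qmap_cone (cpx_cellsum m qs) f hX hS r r1 r2.
have g := cmap_comp f r.
have [|qs' [ss' [GT [GB [h1 h2 h3 h4 h5]]]]] :=
  reduce_cells (ltnSn (size qs)) hqs hss g (spacelike_qmap q1 sp) (Q := m.+2).
  by apply: allz_all hqs => d z; right.
have hss' : all (okc m.+1) ss'.
  by apply: sub_all h2 => kr /andP[e1 e2]; rewrite /okc e1 ltnW.
have [ss2 [h6 h7]] := attach_cells h1 hss' h3 h4.
exists ss2; split; first exact: h6.
exact: qmap_trans q1 (qmap_trans h5 h7).
Qed.

Theorem theorem8p5 (N : nat) (X : cpx) :
  built N X ->
  exists ks : seq (nat * nat),
    all (fun kr => kr.2 <= kr.1)%N ks /\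
    qiso X (bigsum [seq shift (kr.1)%:Z (Hq kr.2) | kr <- ks]).
Proof.
move=> /built_cells[ss [hss q]]; exists ss; split; last exact: rst_step.
by apply: sub_all hss => kr /andP[].
Qed.
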